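(* Let $\mathsf n,t\ge 1$ be integers and $N=2^{\mathsf n}$. Let $\mathcal P_{\mathsf n}=\{\mathbf 1_2,\sigma^x,\sigma^y,\sigma^z\}^{\otimes \mathsf n}\setminus\{\mathbf 1_{N}\}$ be the set of all non-identity $\mathsf n$-qubit Pauli operators. Then \[ \Big\| \mathbb E_{\theta\sim(-\pi,\pi)}\mathbb E_{P\sim\mathcal P_{\mathsf n}}\big(e^{\mathrm i\frac\theta2 P}\otimes e^{-\mathrm i\frac\theta2\bar P}\big)^{\otimes t}-\mathbb E_{U\sim \mathrm{SU}(N)}(U\otimes\bar U)^{\otimes t}\Big\|\le 1-\frac1{4t}-\frac1{4^{\mathsf n}-1}. \] Moreover, for every finite-dimensional unitary representation $\rho$ of $\mathrm{SU}(N)$, \[ \Big\|\mathbb E_{\theta\sim(-2\pi,2\pi)}\mathbb E_{P\sim\mathcal P_{\mathsf n}}\rho\big(e^{\mathrm i\frac\theta2 P}\big)-\mathbb E_{U\sim\mathrm{SU}(N)}\rho(U)\Big\|\le 1-\frac1{4^{\mathsf n}-1}. \]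
   Context: $\sigma^x,\sigma^y,\sigma^z$ are the Pauli matrices. The norm is the operator norm (largest singular value). $\bar U$ denotes entrywise complex conjugate. $P$ is uniform on $\mathcal P_{\mathsf n}$, $\theta$ uniform on the indicated interval, independent of $P$, and $U$ is Haar-distributed on $\mathrm{SU}(N)$. *)

(* Defs.v *)
From HB Require Import structures.
From mathcomp Require Import all_boot all_order all_algebra.
From mathcomp Require Import all_classical all_reals all_analysis.
From mathcomp.real_closed Require Export complex mxtens.
Import Order.TTheory GRing.Theory Num.Theory numFieldTopology.Exports numFieldNormedType.Exports.

Set Implicit Arguments.
Unset Strict Implicit.
Unset Printing Implicit Defensive.

Local Open Scope ring_scope.
Local Open Scope classical_set_scope.

Section QDefs.
Variable R : realType.
Local Notation C := R[i].

Definition mconj {m n} (A : 'M[C]_(m, n)) : 'M[C]_(m, n) := map_mx (@conjc R) A.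
Definition adjm {m n} (A : 'M[C]_(m, n)) : 'M[C]_(n, m) := (mconj A)^T.

Definition cabs2 (z : C) : R := complex.Re z ^+ 2 + complex.Im z ^+ 2.

Definition vnorm {m} (v : 'cV[C]_m) : R := Num.sqrt (\sum_i cabs2 (v i 0)).
Definition fnorm {m n} (A : 'M[C]_(m, n)) : R :=
  Num.sqrt (\sum_i \sum_j cabs2 (A i j)).

Definition opnorm {m} (A : 'M[C]_m) : R :=
  sup [set vnorm (A *m v) | v in [set v : 'cV[C]_m | vnorm v = 1]].

Definition expm_partial {m} (A : 'M[C]_m) (n : nat) : 'M[C]_m :=
  \sum_(k < n) ((k`!)%:R)^-1 *: A ^+ k.
Definition expm {m} (A : 'M[C]_m) : 'M[C]_m :=
  \matrix_(i, j) Complex (limn (fun n => complex.Re (expm_partial A n i j)))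
                         (limn (fun n => complex.Im (expm_partial A n i j))).

Definition unitary {m} (U : 'M[C]_m) : Prop := U *m adjm U = 1%:M.
Definition SU (m : nat) : set 'M[C]_m := [set U | unitary U /\ \det U = 1].

(* single-qubit Pauli matrices: 0 = identity, 1 = sigma^x, 2 = sigma^y, 3 = sigma^z *)
Definition pauli1 (a : 'I_4) : 'M[C]_2 :=
  \matrix_(r, c)
    (match nat_of_ord a with
     | 0 => if r == c then 1 else 0
     | 1 => if r == c then 0 else 1
     | 2 => if r == c then 0 else
              (if (nat_of_ord r == 0)%N then Complex 0 (-1) else Complex 0 1)
     | _ => if r == c then (if (nat_of_ord r == 0)%N then 1 else -1) else 0
     end).

Fixpoint pauli_seq (s : seq 'I_4) : 'M[C]_(2 ^ size s) :=
  match s return 'M[C]_(2 ^ size s) with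
  | [::] => 1%:M
  | a :: s' => castmx (esym (expnS 2 (size s')), esym (expnS 2 (size s')))
                      (pauli1 a *t pauli_seq s')
  end.
Definition pauli {n} (w : n.-tuple 'I_4) : 'M[C]_(2 ^ n) :=
  castmx (congr1 (expn 2) (size_tuple w), congr1 (expn 2) (size_tuple w))
         (pauli_seq w).

Definition nontriv_pauli (n : nat) : {set n.-tuple 'I_4} :=
  [set w | pauli w != 1%:M].

Definition avg_pauli (n k : nat) (F : n.-tuple 'I_4 -> 'M[C]_k) : 'M[C]_k :=
  (#|nontriv_pauli n|%:R)^-1 *: \sum_(w in nontriv_pauli n) F w.

Definition unif_expect (a b : R) {k} (F : R -> 'M[C]_k) : 'M[C]_k :=
  \matrix_(i, j)
    Complex ((b - a)^-1 * \int[lebesgue_measure]_(x in `]a, b[) complex.Re (F x i j))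
            ((b - a)^-1 * \int[lebesgue_measure]_(x in `]a, b[) complex.Im (F x i j)).

Definition rv_expect d (T : measurableType d) (Pr : probability T R) {k}
  (F : T -> 'M[C]_k) : 'M[C]_k :=
  \matrix_(i, j) Complex (\int[Pr]_(x in setT) complex.Re (F x i j))
                         (\int[Pr]_(x in setT) complex.Im (F x i j)).

Definition mx_continuous {m} (g : 'M[C]_m -> R) : Prop :=
  forall A (e : R), 0 < e -> exists2 del : R, 0 < del &
    forall B, fnorm (B - A) < del -> `|g B - g A| < e.

(* U is a Haar-distributed random element of SU(m): it takes values in SU(m),
   its coordinates are measurable, and its law is left-invariant: for every
   V in SU(m), V U has the same law as U (tested against all bounded
   continuous functions). *)
Definition haar_SU d (T : measurableType d) (Pr : probability T R) (m : nat)
  (U : T -> 'M[C]_m) : Prop :=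
  [/\ forall x, @SU m (U x),
      forall i j, measurable_fun setT (fun x => complex.Re (U x i j)) /\
                  measurable_fun setT (fun x => complex.Im (U x i j)) &
      forall V, @SU m V -> forall g : 'M[C]_m -> R,
        (exists M : R, forall A, `|g A| <= M) -> mx_continuous g ->
        \int[Pr]_(x in setT) g (U x) = \int[Pr]_(x in setT) g (V *m U x)].

Definition unitary_rep (m k : nat) (rho : 'M[C]_m -> 'M[C]_k) : Prop :=
  [/\ forall U V, @SU m U -> @SU m V -> rho (U *m V) = rho U *m rho V,
      forall U, @SU m U -> unitary (rho U) &
      forall U (e : R), @SU m U -> 0 < e -> exists2 del : R, 0 < del &
        forall V, @SU m V -> fnorm (V - U) < del -> fnorm (rho V - rho U) < e].

End QDefs.

Arguments pauli1 {R} a.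
Arguments pauli_seq {R} s.
Arguments pauli {R n} w.
Arguments SU {R} m.

(* Main.v *)
(* The average of rho(e^{i theta P/2}) over a full period of theta is the orthogonal projector Pi_P
   onto the kernel of the generator M_P of theta |-> rho(e^{i theta P/2}), and the Haar average is the
   projector G onto the invariant vectors; so one must bound sum_P (1 - Pi_P) from below on the
   orthogonal complement of the invariants.  The Casimir operator Om = sum_P M_P^2 commutes with the
   representation.  On an eigenspace of Om with eigenvalue om, let s be the largest |eigenvalue| of
   all the M_P and let v be an eigenvector of some M_Z for +-s.  The Paulis anticommuting with Z
   split into 4^n/4 pairs (P, R) such that (M_Z, M_P, M_R) is an su(2) triple, and v is annihilated
   by the raising (or lowering) operator of each of them, whence <M_P^2 + M_R^2> = s on v and
   om >= s^2 + s 4^n/4.  Since M_P^2 <= s^2 (1 - Pi_P) on the eigenspace, this gives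
   sum_P (1 - Pi_P) >= om / s^2 >= 1 + 4^n / (4 s), with s <= t for the representation
   (U (x) conj U)^{(x) t}.  Eigenvalue 0 of Om means invariance under all Pauli rotations, which
   generate a dense subgroup of SU(2^n) by the Trotter formula. *)
Require Import Defs.
From HB Require Import structures.
From mathcomp Require Import all_boot all_order all_algebra.
From mathcomp Require Import all_classical all_reals all_analysis.
From mathcomp.real_closed Require Import complex mxtens.
From mathcomp Require Import measurable_realfun ring lra.
Import Order.TTheory GRing.Theory Num.Theory numFieldTopology.Exports numFieldNormedType.Exports.
Local Open Scope ring_scope.
Local Open Scope classical_set_scope.
Set Implicit Arguments.
Unset Strict Implicit.
Unset Printing Implicit Defensive.

(** * Complex matrices and the Frobenius norm *)

Section Basics.
Variable R : realType.
Local Notation C := R[i].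
Local Notation "x %:C" := (real_complex R x) (format "x %:C").
Local Notation Re := (@complex.Re R).
Local Notation Im := (@complex.Im R).

(** [rho] is only continuous, so its derivative at the identity is never formed. Each M_P is
    extracted from its own one-parameter group, and relations between different M_P come from
    differentiating group identities whose factors are all Pauli rotations. Euler angles supply such
    an identity for the rotation about cos th P + sin th S, which replaces linearity of the
    derivative of [rho]. A raised extremal vector would have weight of modulus s + 1, against the
    maximality of s; this is why it vanishes. The Haar average enters through two properties only:
    rho(V) G = G, and X G = X whenever X rho(V) = X for all V. The first needs invariance of the law
    against functions continuous merely on SU, obtained as limits of functions continuous on all
    matrices. On each factor U (x) conj U the weights are differences of two numbers +-1/2, hence
    the bound t; the constant 1/(4t) comes from 4^n/(4t) >= (4^n - 1)/(4t). The rotation at theta =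
    2 pi is -1, which cancels in U (x) conj U but not in a general [rho]: hence the intervals of
    length 2 pi and 4 pi. *)

Lemma Cext (x y : C) : Re x = Re y -> Im x = Im y -> x = y.
Proof. by case: x => a b; case: y => c d /= -> ->. Qed.
Lemma ReD (x y : C) : Re (x + y) = Re x + Re y. Proof. by case: x; case: y. Qed.
Lemma ImD (x y : C) : Im (x + y) = Im x + Im y. Proof. by case: x; case: y. Qed.
Lemma ReN (x : C) : Re (- x) = - Re x. Proof. by case: x. Qed.
Lemma ImN (x : C) : Im (- x) = - Im x. Proof. by case: x. Qed.
Lemma ReB (x y : C) : Re (x - y) = Re x - Re y. Proof. by rewrite ReD ReN. Qed.
Lemma ImB (x y : C) : Im (x - y) = Im x - Im y. Proof. by rewrite ImD ImN. Qed.
Lemma ReM (x y : C) : Re (x * y) = Re x * Re y - Im x * Im y.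
Proof. by case: x; case: y. Qed.
Lemma ImM (x y : C) : Im (x * y) = Re x * Im y + Im x * Re y.
Proof. by case: x => a b; case: y => c d /=; rewrite addrC. Qed.
Lemma Re_conj (x : C) : Re (conjc x) = Re x. Proof. by case: x. Qed.
Lemma Im_conj (x : C) : Im (conjc x) = - Im x. Proof. by case: x. Qed.
Lemma Re_sum I (s : seq I) (P : pred I) (F : I -> C) :
  Re (\sum_(i <- s | P i) F i) = \sum_(i <- s | P i) Re (F i).
Proof. by apply: (big_morph Re ReD). Qed.
Lemma Im_sum I (s : seq I) (P : pred I) (F : I -> C) :
  Im (\sum_(i <- s | P i) F i) = \sum_(i <- s | P i) Im (F i).
Proof. by apply: (big_morph Im ImD). Qed.

Definition ReImE := (ReD, ImD, ReN, ImN, ReM, ImM, Re_conj, Im_conj, Re_sum, Im_sum).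

Lemma cabs2_ge0 (z : C) : 0 <= cabs2 z.
Proof. by rewrite addr_ge0 // sqr_ge0. Qed.
Lemma cabs2C (z : C) : (cabs2 z)%:C = conjc z * z.
Proof. by case: z => a b; apply: Cext; rewrite !ReImE /cabs2 /=; ring. Qed.
Lemma cabs2M (x y : C) : cabs2 (x * y) = cabs2 x * cabs2 y.
Proof. by rewrite /cabs2 !ReImE; ring. Qed.
Lemma cabs20 : cabs2 (0 : C) = 0.
Proof. by rewrite /cabs2 /= expr0n /= addr0. Qed.
Lemma cabs2_eq0 (z : C) : cabs2 z = 0 -> z = 0.
Proof.
move=> /eqP; rewrite paddr_eq0 ?sqr_ge0 // !sqrf_eq0 => /andP[/eqP h1 /eqP h2].
exact: Cext.
Qed.
Lemma cabs2_conj (z : C) : cabs2 (conjc z) = cabs2 z.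
Proof. by rewrite /cabs2 !ReImE sqrrN. Qed.
Lemma cabs2N (z : C) : cabs2 (- z) = cabs2 z.
Proof. by rewrite /cabs2 !ReImE !sqrrN. Qed.
Lemma cabs2_real (x : R) : cabs2 x%:C = x ^+ 2.
Proof. by rewrite /cabs2 /= expr0n addr0. Qed.

Definition eic (x : R) : C := Complex (cos x) (sin x).
Lemma eic0 : eic 0 = 1. Proof. by rewrite /eic cos0 sin0. Qed.
Lemma eicD x y : eic (x + y) = eic x * eic y.
Proof. by apply: Cext; rewrite !ReImE /= ?cosD ?sinD; ring. Qed.
Lemma eicN x : eic (- x) = conjc (eic x).
Proof. by rewrite /eic cosN sinN. Qed.
Lemma cabs2_eic x : cabs2 (eic x) = 1.
Proof. exact: cos2Dsin2. Qed.
Lemma eic_sum I (s : seq I) (P : pred I) (F : I -> R) :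
  eic (\sum_(i <- s | P i) F i) = \prod_(i <- s | P i) eic (F i).
Proof. by apply: (big_morph eic eicD eic0). Qed.

Lemma mconjE m n (A : 'M[C]_(m, n)) i j : mconj A i j = conjc (A i j).
Proof. by rewrite mxE. Qed.
Lemma adjmE m n (A : 'M[C]_(m, n)) i j : adjm A i j = conjc (A j i).
Proof. by rewrite !mxE. Qed.
Lemma mconjM m n p (A : 'M[C]_(m, n)) (B : 'M[C]_(n, p)) :
  mconj (A *m B) = mconj A *m mconj B.
Proof. exact: map_mxM. Qed.
Lemma mconj1 m : mconj (1%:M : 'M[C]_m) = 1%:M.
Proof. exact: map_mx1. Qed.
Lemma mconjD m n (A B : 'M[C]_(m, n)) : mconj (A + B) = mconj A + mconj B.
Proof. exact: map_mxD. Qed.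
Lemma mconjZ m n a (A : 'M[C]_(m, n)) : mconj (a *: A) = conjc a *: mconj A.
Proof. exact: map_mxZ. Qed.
Lemma adjmM m n p (A : 'M[C]_(m, n)) (B : 'M[C]_(n, p)) :
  adjm (A *m B) = adjm B *m adjm A.
Proof. by rewrite /adjm mconjM trmx_mul. Qed.
Lemma adjmK m n (A : 'M[C]_(m, n)) : adjm (adjm A) = A.
Proof. by apply/matrixP => i j; rewrite !adjmE conjcK. Qed.
Lemma adjm1 m : adjm (1%:M : 'M[C]_m) = 1%:M.
Proof. by rewrite /adjm mconj1 trmx1. Qed.
Lemma adjmD m n (A B : 'M[C]_(m, n)) : adjm (A + B) = adjm A + adjm B.
Proof. by rewrite /adjm mconjD linearD. Qed.
Lemma adjmZ m n a (A : 'M[C]_(m, n)) : adjm (a *: A) = conjc a *: adjm A.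
Proof. by rewrite /adjm mconjZ linearZ. Qed.
Lemma adjmN m n (A : 'M[C]_(m, n)) : adjm (- A) = - adjm A.
Proof. by apply/matrixP => i j; rewrite !(adjmE, mxE) rmorphN. Qed.
Lemma adjmB m n (A B : 'M[C]_(m, n)) : adjm (A - B) = adjm A - adjm B.
Proof. by rewrite adjmD adjmN. Qed.
Lemma adjm0 m n : adjm (0 : 'M[C]_(m, n)) = 0.
Proof. by apply/matrixP => i j; rewrite !(adjmE, mxE) rmorph0. Qed.
Lemma adjm_sum I (s : seq I) (P : pred I) m n (F : I -> 'M[C]_(m, n)) :
  adjm (\sum_(i <- s | P i) F i) = \sum_(i <- s | P i) adjm (F i).
Proof. by apply: (big_morph (@adjm R m n) (@adjmD m n) (@adjm0 m n)). Qed.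

Lemma unitaryK m (U : 'M[C]_m) : unitary U -> adjm U *m U = 1%:M.
Proof. exact: mulmx1C. Qed.
Lemma unitary_adj m (U : 'M[C]_m) : unitary U -> unitary (adjm U).
Proof. by move=> h; rewrite /unitary adjmK; exact: unitaryK. Qed.
Lemma unitary1 m : unitary (1%:M : 'M[C]_m).
Proof. by rewrite /unitary adjm1 mul1mx. Qed.
Lemma unitaryM m (U V : 'M[C]_m) : unitary U -> unitary V -> unitary (U *m V).
Proof. by move=> hU hV; rewrite /unitary adjmM mulmxA -(mulmxA U) hV mulmx1. Qed.
Lemma det_adjm m (U : 'M[C]_m) : \det (adjm U) = conjc (\det U).
Proof. by rewrite /adjm det_tr; exact: det_map_mx. Qed.
Lemma SU1 m : SU m (1%:M : 'M[C]_m).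
Proof. by split; [exact: unitary1 | exact: det1]. Qed.
Lemma SUM m (U V : 'M[C]_m) : SU m U -> SU m V -> SU m (U *m V).
Proof.
by move=> [hU dU] [hV dV]; split; [exact: unitaryM | rewrite det_mulmx dU dV mul1r].
Qed.
Lemma SU_adj m (U : 'M[C]_m) : SU m U -> SU m (adjm U).
Proof.
by move=> [hU dU]; split; [exact: unitary_adj | rewrite det_adjm dU rmorph1].
Qed.

(** Squared norms keep the identities polynomial; square roots return only in [fnorm] and
    [vnorm]. *)
Definition nrm2 m n (A : 'M[C]_(m, n)) : R := \sum_i \sum_j cabs2 (A i j).
Lemma nrm2_ge0 m n (A : 'M[C]_(m, n)) : 0 <= nrm2 A.
Proof. by apply: sumr_ge0 => i _; apply: sumr_ge0 => j _; exact: cabs2_ge0. Qed.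
Lemma nrm2_tr m n (A : 'M[C]_(m, n)) : (nrm2 A)%:C = \tr (adjm A *m A).
Proof.
rewrite /nrm2 exchange_big rmorph_sum; apply: eq_bigr => j _.
rewrite rmorph_sum mxE; apply: eq_bigr => i _.
by rewrite adjmE -cabs2C.
Qed.
Lemma nrm2_col m (x : 'cV[C]_m) : nrm2 x = \sum_i cabs2 (x i 0).
Proof. by apply: eq_bigr => i _; rewrite big_ord1. Qed.
Lemma nrm2_ip m (x : 'cV[C]_m) : (nrm2 x)%:C = (adjm x *m x) 0 0.
Proof. by rewrite nrm2_tr [LHS]big_ord1. Qed.
Lemma nrm2_adj m n (A : 'M[C]_(m, n)) : nrm2 (adjm A) = nrm2 A.
Proof.
rewrite /nrm2 exchange_big; apply: eq_bigr => i _; apply: eq_bigr => j _.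
by rewrite adjmE cabs2_conj.
Qed.
Lemma nrm2_unitl m n (W : 'M[C]_m) (A : 'M[C]_(m, n)) :
  unitary W -> nrm2 (W *m A) = nrm2 A.
Proof.
move=> hW; apply: (@complexI R); rewrite !nrm2_tr adjmM mulmxA -(mulmxA _ _ W).
by rewrite unitaryK // mulmx1.
Qed.
Lemma nrm2_unitr m n (W : 'M[C]_n) (A : 'M[C]_(m, n)) :
  unitary W -> nrm2 (A *m W) = nrm2 A.
Proof.
by move=> hW; rewrite -nrm2_adj adjmM nrm2_unitl ?nrm2_adj //; exact: unitary_adj.
Qed.
Lemma nrm2_eq0 m n (A : 'M[C]_(m, n)) : nrm2 A = 0 -> A = 0.
Proof.
move=> h; apply/matrixP => i j; rewrite mxE; apply: cabs2_eq0; move: h.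
move/psumr_eq0P => /(_ (fun i _ => sumr_ge0 _ (fun j _ => cabs2_ge0 (A i j)))) /(_ i isT).
by move/psumr_eq0P => /(_ (fun j _ => cabs2_ge0 (A i j))) /(_ j isT).
Qed.
Lemma nrm2_gt0 m n (A : 'M[C]_(m, n)) : A <> 0 -> 0 < nrm2 A.
Proof.
move=> h; rewrite lt_neqAle nrm2_ge0 andbT eq_sym.
by apply/eqP => /nrm2_eq0.
Qed.
Lemma nrm2Z m n a (A : 'M[C]_(m, n)) : nrm2 (a *: A) = cabs2 a * nrm2 A.
Proof.
rewrite /nrm2 mulr_sumr; apply: eq_bigr => i _; rewrite mulr_sumr.
by apply: eq_bigr => j _; rewrite mxE cabs2M.
Qed.
Lemma fnormE m n (A : 'M[C]_(m, n)) : fnorm A = Num.sqrt (nrm2 A).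
Proof. by []. Qed.
Lemma vnormE m (v : 'cV[C]_m) : vnorm v = Num.sqrt (nrm2 v).
Proof. by rewrite nrm2_col. Qed.
Lemma fnorm_ge0 m n (A : 'M[C]_(m, n)) : 0 <= fnorm A.
Proof. exact: sqrtr_ge0. Qed.
Lemma fnorm_sqr m n (A : 'M[C]_(m, n)) : fnorm A ^+ 2 = nrm2 A.
Proof. by rewrite sqr_sqrtr // nrm2_ge0. Qed.
Lemma fnorm0 m n : fnorm (0 : 'M[C]_(m, n)) = 0.
Proof.
rewrite fnormE (_ : nrm2 _ = 0) ?sqrtr0 //.
by apply: big1 => i _; apply: big1 => j _; rewrite mxE cabs20.
Qed.
Lemma fnormN m n (A : 'M[C]_(m, n)) : fnorm (- A) = fnorm A.
Proof.
by rewrite !fnormE; congr Num.sqrt; apply: eq_bigr => i _; apply: eq_bigr => j _;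
   rewrite mxE cabs2N.
Qed.
Lemma fnormBC m n (A B : 'M[C]_(m, n)) : fnorm (A - B) = fnorm (B - A).
Proof. by rewrite -fnormN opprB. Qed.
Lemma fnorm_eq0 m n (A : 'M[C]_(m, n)) : fnorm A = 0 -> A = 0.
Proof. by move=> h; apply: nrm2_eq0; rewrite -fnorm_sqr h expr0n. Qed.
Lemma fnorm_unitl m n (W : 'M[C]_m) (A : 'M[C]_(m, n)) :
  unitary W -> fnorm (W *m A) = fnorm A.
Proof. by move=> h; rewrite !fnormE nrm2_unitl. Qed.
Lemma fnorm_unitr m n (W : 'M[C]_n) (A : 'M[C]_(m, n)) :
  unitary W -> fnorm (A *m W) = fnorm A.
Proof. by move=> h; rewrite !fnormE nrm2_unitr. Qed.

Definition mdot m n (A B : 'M[C]_(m, n)) : R :=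
  \sum_i \sum_j (Re (A i j) * Re (B i j) + Im (A i j) * Im (B i j)).
Lemma nrm2_comb m n (x y : R) (A B : 'M[C]_(m, n)) :
  nrm2 (x%:C *: A + y%:C *: B) =
  x ^+ 2 * nrm2 A + 2 * x * y * mdot A B + y ^+ 2 * nrm2 B.
Proof.
rewrite /nrm2 /mdot !mulr_sumr -!big_split; apply: eq_bigr => i _.
rewrite !mulr_sumr -!big_split; apply: eq_bigr => j _.
by rewrite !mxE /cabs2 !ReImE /=; ring.
Qed.
(** Nonnegativity of the squared norm of |B|^2 A - <A,B> B, divided by |B|^2. *)
Lemma mdot_CS m n (A B : 'M[C]_(m, n)) : mdot A B <= fnorm A * fnorm B.
Proof.
have [/nrm2_eq0 ->|/eqP hB] := eqVneq (nrm2 B) 0.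
  rewrite fnorm0 mulr0 /mdot big1 // => i _; rewrite big1 // => j _.
  by rewrite mxE /= !mulr0 addr0.
have B0 : 0 < nrm2 B by rewrite lt_neqAle nrm2_ge0 andbT eq_sym; apply/eqP.
have := nrm2_ge0 ((nrm2 B)%:C *: A + (- mdot A B)%:C *: B).
rewrite nrm2_comb => h.
have h2 : mdot A B ^+ 2 <= nrm2 A * nrm2 B.
  rewrite -subr_ge0 -(pmulr_rge0 _ B0).
  by move: h; congr (0 <= _); ring.
apply: (le_trans (ler_norm _)).
by rewrite -sqrtr_sqr !fnormE -sqrtrM ?nrm2_ge0 // ler_wsqrtr.
Qed.
Lemma fnormD m n (A B : 'M[C]_(m, n)) : fnorm (A + B) <= fnorm A + fnorm B.
Proof.
rewrite -(@ler_pXn2r _ 2) ?nnegrE ?addr_ge0 ?fnorm_ge0 //.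
have := nrm2_comb 1 1 A B; rewrite rmorph1 !scale1r => h.
rewrite fnorm_sqr h.
have := mdot_CS A B; have := fnorm_sqr A; have := fnorm_sqr B.
by move=> <- <- ?; nra.
Qed.
Lemma fnorm_tri m n (A B D : 'M[C]_(m, n)) : fnorm (A - D) <= fnorm (A - B) + fnorm (B - D).
Proof. by rewrite (_ : A - D = (A - B) + (B - D)) ?fnormD // addrA subrK. Qed.

Lemma entry_le_nrm2 m n (A : 'M[C]_(m, n)) i j : cabs2 (A i j) <= nrm2 A.
Proof.
rewrite /nrm2 (bigD1 i) //= (bigD1 j) //= -addrA ler_wpDr //.
by rewrite addr_ge0 //; [|apply: sumr_ge0 => ? _]; apply: sumr_ge0 => ? _; exact: cabs2_ge0.
Qed.
Lemma Re_le_fnorm m n (A : 'M[C]_(m, n)) i j : `|Re (A i j)| <= fnorm A.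
Proof.
rewrite -sqrtr_sqr; apply: ler_wsqrtr; apply: le_trans (entry_le_nrm2 A i j).
by rewrite lerDl sqr_ge0.
Qed.
Lemma Im_le_fnorm m n (A : 'M[C]_(m, n)) i j : `|Im (A i j)| <= fnorm A.
Proof.
rewrite -sqrtr_sqr; apply: ler_wsqrtr; apply: le_trans (entry_le_nrm2 A i j).
by rewrite lerDr sqr_ge0.
Qed.
Lemma fnorm_le_entries m n (A : 'M[C]_(m, n)) :
  fnorm A <= \sum_i \sum_j (`|Re (A i j)| + `|Im (A i j)|).
Proof.
have h0 i : 0 <= \sum_j (`|Re (A i j)| + `|Im (A i j)|).
  by apply: sumr_ge0 => j _; rewrite addr_ge0.
have sqs (J : finType) (F : J -> R) : (forall j, 0 <= F j) ->
    \sum_j F j ^+ 2 <= (\sum_j F j) ^+ 2.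
  move=> F0; elim: (index_enum J) => [|j s IH]; first by rewrite !big_nil expr0n.
  rewrite !big_cons.
  have s0 : 0 <= \sum_(i <- s) F i by apply: sumr_ge0.
  by move: (F0 j) => ?; nra.
rewrite -(@ler_pXn2r _ 2) ?nnegrE ?fnorm_ge0 ?sumr_ge0 // fnorm_sqr.
apply: le_trans (sqs _ _ h0); apply: ler_sum => i _.
apply: le_trans (sqs _ _ _) => [|j]; last by rewrite addr_ge0.
apply: ler_sum => j _; rewrite /cabs2 -(real_normK (num_real (Re _))) -(real_normK (num_real (Im _))).
have := normr_ge0 (Re (A i j)); have := normr_ge0 (Im (A i j)); nra.
Qed.
Lemma fnorm_tens m n p q (A : 'M[C]_(m, n)) (B : 'M[C]_(p, q)) :
  fnorm (A *t B) = fnorm A * fnorm B.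
Proof.
rewrite !fnormE -sqrtrM ?nrm2_ge0 //; congr Num.sqrt.
rewrite /nrm2 mulr_sum; apply: eq_bigr => i _; rewrite mulr_sum; apply: eq_bigr => j _.
by rewrite mxE cabs2M.
Qed.
(** Telescoping: each error is multiplied by unitaries only, so the errors of a Trotter product add
    up linearly. *)
Lemma fnorm_pow_diff m (A B : 'M[C]_m) k : unitary A -> unitary B ->
  fnorm (A ^+ k - B ^+ k) <= fnorm (A - B) *+ k.
Proof.
move=> hA hB; elim: k => [|k IH]; first by rewrite !expr0 subrr fnorm0 mulr0n.
have uB : unitary (B ^+ k).
  by elim: (k) => [|j h]; [exact: unitary1 | rewrite exprS; exact: unitaryM].
apply: (le_trans (fnorm_tri _ (A * B ^+ k) _)).
rewrite !exprS -mulrBr -mulrBl mulrSr; apply: lerD; first by rewrite fnorm_unitl.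
by rewrite fnorm_unitr.
Qed.

End Basics.

(** * Functional calculus of normal matrices *)

Section Spectral.
Variable R : realType.
Local Notation C := R[i].
Local Notation "x %:C" := (real_complex R x) (format "x %:C").
Local Notation Re := (@complex.Re R).
Local Notation Im := (@complex.Im R).

(* With [W] unitary: the matrix with eigenvalues [f j] in the orthonormal basis of rows of [W]. *)
Definition fc m (W : 'M[C]_m) (f : 'I_m -> C) : 'M[C]_m :=
  adjm W *m diag_mx (\row_j f j) *m W.

Lemma eq_fc m (W : 'M[C]_m) f g : f =1 g -> fc W f = fc W g.
Proof. by move=> h; rewrite /fc (_ : \row_j f j = \row_j g j) //; apply/rowP => j; rewrite !mxE. Qed.
Lemma fc_mul m (W : 'M[C]_m) f g : unitary W ->
  fc W f *m fc W g = fc W (fun j => f j * g j).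
Proof.
move=> hW; rewrite /fc !mulmxA -(mulmxA _ W) hW mulmx1 -!mulmxA; congr (_ *m _).
rewrite mulmxA mulmx_diag; congr (diag_mx _ *m _).
by apply/rowP => j; rewrite !mxE.
Qed.
Lemma fc_add m (W : 'M[C]_m) f g :
  fc W f + fc W g = fc W (fun j => f j + g j).
Proof.
rewrite /fc -mulmxDl -mulmxDr -linearD; congr (_ *m diag_mx _ *m _).
by apply/rowP => j; rewrite !mxE.
Qed.
Lemma fc_scale m (W : 'M[C]_m) a f :
  a *: fc W f = fc W (fun j => a * f j).
Proof.
rewrite /fc scalemxAl scalemxAr -linearZ; congr (_ *m diag_mx _ *m _).
by apply/rowP => j; rewrite !mxE.
Qed.
Lemma fc_one m (W : 'M[C]_m) : unitary W -> fc W (fun=> 1) = 1%:M.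
Proof.
move=> hW; rewrite /fc (_ : diag_mx _ = 1%:M) ?mulmx1 ?unitaryK //.
by apply/matrixP => i j; rewrite !mxE.
Qed.
Lemma fc_zero m (W : 'M[C]_m) : fc W (fun=> 0) = 0.
Proof.
rewrite /fc (_ : diag_mx _ = 0) ?mulmx0 ?mul0mx //.
by apply/matrixP => i j; rewrite !mxE mul0rn.
Qed.
Lemma fc_adj m (W : 'M[C]_m) f : adjm (fc W f) = fc W (fun j => conjc (f j)).
Proof.
rewrite /fc !adjmM adjmK mulmxA; congr (_ *m _ *m _).
apply/matrixP => i j; rewrite adjmE !mxE.
by case: (eqVneq i j) => [->|_]; rewrite ?mulr1n ?mulr0n ?rmorph0.
Qed.
Lemma fc_unitary m (W : 'M[C]_m) f : unitary W -> (forall j, cabs2 (f j) = 1) ->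
  unitary (fc W f).
Proof.
move=> hW hf; rewrite /unitary fc_adj fc_mul // -(fc_one hW); apply: eq_fc => j.
by rewrite mulrC -cabs2C hf.
Qed.
Lemma fc_diag m (W : 'M[C]_m) f : unitary W ->
  W *m fc W f = diag_mx (\row_j f j) *m W.
Proof. by move=> hW; rewrite /fc !mulmxA hW mul1mx. Qed.
Lemma fc_vec m (W : 'M[C]_m) f (x : 'cV[C]_m) i : unitary W ->
  (W *m (fc W f *m x)) i 0 = f i * (W *m x) i 0.
Proof. by move=> hW; rewrite mulmxA fc_diag // -mulmxA mul_diag_mx !mxE. Qed.
Lemma fc_quad m (W : 'M[C]_m) f (x : 'cV[C]_m) : unitary W ->
  (adjm x *m fc W f *m x) 0 0 = \sum_j f j * (cabs2 ((W *m x) j 0))%:C.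
Proof.
move=> hW; rewrite /fc !mulmxA -adjmM -mulmxA mul_mx_diag mxE.
apply: eq_bigr => j _; rewrite !mxE cabs2C. by rewrite [_ * f j]mulrC mulrA.
Qed.
Lemma vec_inj m (W : 'M[C]_m) (x y : 'cV[C]_m) : unitary W ->
  (forall i, (W *m x) i 0 = (W *m y) i 0) -> x = y.
Proof.
move=> hW h; have e : W *m x = W *m y by apply/matrixP => i j; rewrite ord1; exact: h.
by rewrite -[x]mul1mx -(unitaryK hW) -mulmxA e mulmxA unitaryK // mul1mx.
Qed.
Lemma vec_neq0 m (W : 'M[C]_m) (x : 'cV[C]_m) : unitary W -> x <> 0 ->
  exists i, (W *m x) i 0 <> 0.
Proof.
move=> hW hx; apply: contrapT => h; apply: hx; apply: (vec_inj hW) => i.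
by rewrite mulmx0 [RHS]mxE; apply: contrapT => h2; apply: h; exists i.
Qed.
Lemma fc_inj m (W : 'M[C]_m) f g : unitary W -> fc W f = fc W g -> f =1 g.
Proof.
move=> hW /(congr1 (fun X => W *m X *m adjm W)).
rewrite !fc_diag // -!mulmxA hW !mulmx1 => /matrixP h j.
by have := h j j; rewrite !mxE eqxx !mulr1n.
Qed.
Lemma conj_commE m (W Wi X D : 'M[C]_m) : Wi *m W = 1%:M -> W *m Wi = 1%:M ->
  X *m (Wi *m D *m W) = Wi *m D *m W *m X <-> W *m X *m Wi *m D = D *m (W *m X *m Wi).
Proof.
move=> h1 h2; split=> [/(congr1 (fun Z => W *m Z *m Wi))|/(congr1 (fun Z => Wi *m Z *m W))].
  by rewrite !mulmxA h2 mul1mx -!mulmxA h2 mulmx1.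
by rewrite !mulmxA h1 mul1mx -!mulmxA h1 mulmx1.
Qed.
(** In the eigenbasis a nonzero entry Y i j of X forces f i = f j, hence g i = g j: whatever
    commutes with a matrix commutes with every function of it, in particular with its spectral
    projectors. *)
Lemma fc_comm m (W X : 'M[C]_m) f g : unitary W ->
  (forall i j, f i = f j -> g i = g j) ->
  X *m fc W f = fc W f *m X -> X *m fc W g = fc W g *m X.
Proof.
move=> hW fg h.
pose Y := W *m X *m adjm W.
have key e : (X *m fc W e = fc W e *m X) <->
    (Y *m diag_mx (\row_j e j) = diag_mx (\row_j e j) *m Y).
  exact: (conj_commE _ _ (unitaryK hW) hW).
apply/key; move/key: h => /matrixP h; clearbody Y.
apply/matrixP => i j; have := h i j.
rewrite !mul_mx_diag !mul_diag_mx ![in X in X -> _]mxE ![in X in _ -> X]mxE.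
have [->|Y0] := eqVneq (Y i j) 0; first by rewrite !(mulr0, mul0r).
rewrite [Y i j * _]mulrC => /(mulIf Y0) /esym/fg <-.
by rewrite mulrC.
Qed.

Lemma normal_spectral m (M : 'M[C]_m) : M *m adjm M = adjm M *m M ->
  exists W f, unitary W /\ M = fc W f.
Proof.
have adjE n p (A : 'M[C]_(n, p)) : (map_mx (@Num.conj C) (A^T)) = adjm A.
  by apply/matrixP => i j; rewrite !mxE.
move=> h; have /orthomx_spectralP : M \is normalmx.
  by apply/normalmxP; rewrite adjE.
have := spectral_unitarymx M.
move: (spectralmx M) (spectral_diag M) => W d hW -> .
exists W, (fun j => d 0 j); split.
  by move/unitarymxP: hW; rewrite adjE.
have -> : invmx W = adjm W by apply: etrans (invmx_unitary hW) _; exact: adjE.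
rewrite /fc (_ : \row_j d 0 j = d) //.
by apply/rowP => j; rewrite mxE.
Qed.
Lemma herm_spectral m (M : 'M[C]_m) : adjm M = M ->
  exists W (d : 'I_m -> R), unitary W /\ M = fc W (fun j => (d j)%:C).
Proof.
move=> h; have [|W [f [hW e]]] := @normal_spectral m M; first by rewrite h.
exists W, (fun j => Re (f j)); split=> //; rewrite e; apply: eq_fc => j.
have := h; rewrite {1 2}e fc_adj => /(fc_inj hW) /(_ j).
by case: (f j) => a b [] hb; apply: Cext => //=; lra.
Qed.
Lemma unitary_spectral m (M : 'M[C]_m) : unitary M ->
  exists W f, [/\ unitary W, M = fc W f & forall j, cabs2 (f j) = 1].
Proof.
move=> h; have [|W [f [hW e]]] := @normal_spectral m M; first by rewrite h unitaryK.
exists W, f; split=> // j.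
have := h; rewrite /unitary e fc_adj fc_mul // -(fc_one hW) => /(fc_inj hW) /(_ j).
by rewrite mulrC -cabs2C => /complexI.
Qed.

Lemma eic_surj (z : C) : cabs2 z = 1 -> exists a, z = eic a.
Proof.
move=> h; have hz : -1 <= Re z <= 1.
  by have := sqr_ge0 (Im z); move: h; rewrite /cabs2 => h1 h2; apply/andP; split; nra.
have s2 : sin (acos (Re z)) ^+ 2 = Im z ^+ 2.
  have := cos2Dsin2 (acos (Re z)); rewrite acosK //.
  by move: h; rewrite /cabs2 => <- /addrI.
have := s2 => /eqP; rewrite eqf_sqr => /orP[] /eqP e.
  by exists (acos (Re z)); apply: Cext; rewrite /= ?acosK.
exists (- acos (Re z)); apply: Cext; rewrite /= ?cosN ?sinN ?acosK //.
by rewrite e opprK.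
Qed.
(** In the right half plane the principal angle is [asin] of the imaginary part; the strict bound
    keeps the roots e^{ia/2^k} in the same half plane. *)
Lemma eic_surj_half (z : C) : cabs2 z = 1 -> 0 < Re z ->
  exists2 a, z = eic a & `|a| < pi / 2.
Proof.
move=> h z0; have hz : -1 < Im z < 1.
  by move: h; rewrite /cabs2 => h1; apply/andP; split; nra.
have hz' : -1 <= Im z <= 1 by case/andP: hz => *; apply/andP; split; lra.
exists (asin (Im z)); last first.
  by rewrite ltr_norml; apply/andP; split; [rewrite asin_gtNpi2 // | rewrite asin_ltpi2 //];
    case/andP: hz => *; apply/andP; split; lra.
apply: Cext; rewrite /= ?asinK // cos_asin // -[LHS](gtr0_norm z0) -sqrtr_sqr.
by congr Num.sqrt; move: h; rewrite /cabs2 => <-; ring.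
Qed.
End Spectral.

(** * One-parameter unitary groups *)

Section OneParam.
Variable R : realType.
Local Notation C := R[i].
Local Notation "x %:C" := (real_complex R x) (format "x %:C").
Local Notation Re := (@complex.Re R).
Local Notation Im := (@complex.Im R).

Lemma norm_sin_le (x : R) : `|sin x| <= `|x|.
Proof.
have pos (y : R) : 0 < y -> `|sin y| <= y.
  move=> y0; have [|c _] := @MVT R sin cos 0 y y0.
    by apply: continuous_subspaceT; exact: continuous_sin.
  rewrite sin0 !subr0 => ->; rewrite normrM (gtr0_norm y0).
  by rewrite ler_piMl ?cos_max // ltW.
have [x0|x0|->] := ltgtP x 0; last by rewrite sin0 normr0.
  by have := pos (- x); rewrite sinN normrN oppr_gt0 (ltr0_norm x0); apply.
by rewrite (gtr0_norm x0) pos.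
Qed.
(** |e^{ix} - 1| = 2 |sin(x/2)|. *)
Lemma cabs2_eicB1 (x : R) : cabs2 (eic x - 1) <= x ^+ 2.
Proof.
have -> : cabs2 (eic x - 1) = 4 * sin (x / 2) ^+ 2.
  have e : x = x / 2 + x / 2 by lra.
  rewrite /cabs2 !ReImE /= {1 2}e cosD sinD.
  have := cos2Dsin2 (x / 2) => h.
  have -> : cos (x / 2) * cos (x / 2) = 1 - sin (x / 2) ^+ 2 by rewrite -expr2; lra.
  have e2 : cos (x / 2) ^+ 2 = 1 - sin (x / 2) ^+ 2 by lra.
  transitivity (4 * sin (x / 2) ^+ 4 + 4 * sin (x / 2) ^+ 2 * cos (x / 2) ^+ 2); first by ring.
  by rewrite e2; ring.
have := norm_sin_le (x / 2) => h.
have : sin (x / 2) ^+ 2 <= (x / 2) ^+ 2.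
  rewrite -real_normK ?num_real // -[leRHS]real_normK ?num_real //.
  by rewrite ler_pXn2r ?nnegrE.
by rewrite expr_div_n; lra.
Qed.

(** <y, A x> is the Hilbert-Schmidt pairing of A with the rank-one matrix [y *m adjm x], whose
    Frobenius norm is |y| |x|. *)
Lemma bilin_bound m n (A : 'M[C]_(m, n)) (y : 'cV[C]_m) (x : 'cV[C]_n) :
  Re ((adjm y *m A *m x) 0 0) <= fnorm A * (fnorm y * fnorm x).
Proof.
have -> : Re ((adjm y *m A *m x) 0 0) = mdot (y *m adjm x) A.
  rewrite -mulmxA mxE Re_sum; apply: eq_bigr => i _.
  rewrite adjmE mxE mulr_sumr Re_sum; apply: eq_bigr => j _.
  by rewrite mxE big_ord1 adjmE !ReImE; ring.
have <- : fnorm (y *m adjm x) = fnorm y * fnorm x.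
  rewrite !fnormE -sqrtrM ?nrm2_ge0 //; congr Num.sqrt.
  rewrite !nrm2_col mulr_suml; apply: eq_bigr => i _; rewrite mulr_sumr.
  by apply: eq_bigr => j _; rewrite mxE big_ord1 adjmE cabs2M cabs2_conj.
by rewrite mulrC; exact: mdot_CS.
Qed.
Lemma quad_bound m (A : 'M[C]_m) (x : 'cV[C]_m) :
  `|Re ((adjm x *m A *m x) 0 0)| <= fnorm A * nrm2 x.
Proof.
rewrite -fnorm_sqr expr2 ler_norml bilin_bound andbT lerNl -ReN -(fnormN A).
by have := bilin_bound (- A) x x; rewrite mulmxN mulNmx [X in Re X]mxE.
Qed.
Lemma fnorm_mulv m n (A : 'M[C]_(m, n)) (x : 'cV[C]_n) : fnorm (A *m x) <= fnorm A * fnorm x.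
Proof.
have := bilin_bound A (A *m x) x; rewrite -mulmxA -nrm2_ip /= -fnorm_sqr.
rewrite expr2 mulrCA; have [->|h] := eqVneq (fnorm (A *m x)) 0.
  by rewrite mulr_ge0 ?fnorm_ge0.
by rewrite ler_pM2l // lt_neqAle fnorm_ge0 andbT eq_sym.
Qed.

(** The one-parameter group e^{itH}, with the Hermitian H given by its spectral data. *)
Definition flow m (W : 'M[C]_m) (d : 'I_m -> R) (t : R) : 'M[C]_m :=
  fc W (fun j => eic (d j * t)).

Lemma flowD m (W : 'M[C]_m) d s t : unitary W ->
  flow W d (s + t) = flow W d s *m flow W d t.
Proof. by move=> hW; rewrite fc_mul //; apply: eq_fc => j; rewrite mulrDr eicD. Qed.
Lemma flow_mulrn m (W : 'M[C]_m) d s q : unitary W ->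
  flow W d (s *+ q) = flow W d s ^+ q.
Proof.
move=> hW; elim: q => [|q IH]; last by rewrite mulrS flowD // exprS IH.
rewrite mulr0n /flow expr0 -[RHS]/(1%:M) -(fc_one hW).
by apply: eq_fc => j; rewrite mulr0 eic0.
Qed.
Lemma flow_unitary m (W : 'M[C]_m) d t : unitary W -> unitary (flow W d t).
Proof. by move=> hW; apply: fc_unitary => // j; rewrite cabs2_eic. Qed.
Lemma flow0 m (W : 'M[C]_m) d : unitary W -> flow W d 0 = 1%:M.
Proof. by move=> hW; rewrite -(fc_one hW); apply: eq_fc => j; rewrite mulr0 eic0. Qed.
Lemma flow_adj m (W : 'M[C]_m) d t : adjm (flow W d t) = flow W d (- t).
Proof. by rewrite fc_adj; apply: eq_fc => j; rewrite mulrN eicN. Qed.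

Lemma nrm2_fc m (W : 'M[C]_m) f : unitary W -> nrm2 (fc W f) = \sum_j cabs2 (f j).
Proof.
move=> hW; rewrite /fc nrm2_unitr // nrm2_unitl; last exact: unitary_adj.
apply: eq_bigr => i _; rewrite (bigD1 i) //= big1 ?addr0 => [|j hj].
  by rewrite !mxE eqxx mulr1n.
by rewrite !mxE eq_sym (negbTE hj) mulr0n cabs20.
Qed.

Lemma flow_cont0 m (W : 'M[C]_m) d (e : R) : unitary W -> 0 < e ->
  exists2 del : R, 0 < del & forall t, `|t| < del -> fnorm (flow W d t - 1%:M) < e.
Proof.
move=> hW e0; pose S := 1 + \sum_j `|d j|.
have S0 : 1 <= S by rewrite lerDl sumr_ge0.
have S0' : 0 < S by exact: lt_le_trans ltr01 S0.
exists (e / S); first by rewrite divr_gt0.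
move=> t ht; have hle : nrm2 (flow W d t - 1%:M) <= (S * `|t|) ^+ 2.
  rewrite -(fc_one hW) -scaleN1r fc_scale fc_add nrm2_fc //.
  apply: (@le_trans _ _ (\sum_j (`|d j| * `|t|) ^+ 2)).
    by apply: ler_sum => j _; rewrite mulr1 -normrM real_normK ?num_real //; exact: cabs2_eicB1.
  apply: (@le_trans _ _ (((\sum_j `|d j|) * `|t|) ^+ 2)); last first.
    by rewrite ler_pXn2r ?nnegrE ?mulr_ge0 ?sumr_ge0 ?(ltW S0') // ler_wpM2r // /S; lra.
  rewrite mulr_suml; elim: (index_enum _) => [|j s IH]; first by rewrite !big_nil expr0n.
  rewrite !big_cons.
  have s0 : 0 <= \sum_(i <- s) `|d i| * `|t| by apply: sumr_ge0 => i _; rewrite mulr_ge0.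
  have : 0 <= `|d j| * `|t| by rewrite mulr_ge0.
  by move=> ?; nra.
rewrite -(@ltr_pXn2r _ 2) ?nnegrE ?fnorm_ge0 ?(ltW e0) // fnorm_sqr.
apply: le_lt_trans hle _; rewrite ltr_pXn2r ?nnegrE ?mulr_ge0 ?(ltW S0') ?(ltW e0) //.
by move: ht; rewrite ltr_pdivlMr // mulrC.
Qed.

Lemma pos_unitmx m (M : 'M[C]_m) :
  (forall x : 'cV[C]_m, x <> 0 -> 0 < Re ((adjm x *m M *m x) 0 0)) -> M \in unitmx.
Proof.
move=> h; rewrite -row_free_unit; apply: inj_row_free => v hv.
apply: contrapT => v0; have := h (adjm v).
rewrite adjmK hv mul0mx mxE /= ltxx => H; have : false by apply: H => e; apply: v0; rewrite -[v]adjmK e adjm0.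
by [].
Qed.

Section Group.
Variables (m : nat) (u : R -> 'M[C]_m).
Hypothesis uD : forall s t, u (s + t) = u s *m u t.
Hypothesis uU : forall t, unitary (u t).
Hypothesis uc : forall e : R, 0 < e -> exists2 del : R, 0 < del &
  forall t, `|t| < del -> fnorm (u t - 1%:M) < e.

Lemma opg0 : u 0 = 1%:M.
Proof.
have := uD 0 0; rewrite addr0 => /(congr1 (mulmx (adjm (u 0)))).
by rewrite mulmxA unitaryK // mul1mx.
Qed.
Lemma opg_adj t : adjm (u t) = u (- t).
Proof.
have h : u t *m u (- t) = 1%:M by rewrite -uD subrr opg0.
by rewrite -[RHS]mul1mx -(unitaryK (uU t)) -mulmxA h mulmx1.
Qed.
Lemma opg_mulrn s k : u (s *+ k) = u s ^+ k.
Proof. by elim: k => [|k IH]; rewrite ?mulr0n ?opg0 // mulrS uD IH exprS. Qed.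

Lemma opg_comm s t : u s *m u t = u t *m u s.
Proof. by rewrite -!uD addrC. Qed.

(* Near 0 the spectrum lies in the right half plane, where unitary square roots are unique;
   so u agrees with the flow read off u(delta) at all dyadic multiples of delta. *)
Theorem opg_flow : exists W d, unitary W /\ forall t, u t = flow W d t.
Proof.
have [del0 del00 hdel0] := uc ltr01.
pose dl := del0 / 2.
have dl0 : 0 < dl by rewrite divr_gt0.
(* As |u t - 1| < 1, the quadratic form of [u t] differs from |x|^2 by less than |x|^2. *)
have upos t (x : 'cV[C]_m) : `|t| < del0 -> x <> 0 -> 0 < Re ((adjm x *m u t *m x) 0 0).
  move=> /hdel0 ht x0; have := quad_bound (u t - 1%:M) x.
  rewrite mulmxBr mulmxBl mulmx1 [(_ - _ *m x) 0 0]mxE [(- (_ *m x)) 0 0]mxE -nrm2_ip ReB /=.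
  move/ler_normlP => [h _]; have := nrm2_gt0 x0 => n0.
  by have : fnorm (u t - 1%:M) * nrm2 x < 1 * nrm2 x; [rewrite ltr_pM2r | lra].
have hdl : `|dl| < del0 by rewrite gtr0_norm // /dl; lra.
have [W [f [hW uf f1]]] := unitary_spectral (uU dl).
have fpos j : 0 < Re (f j).
  pose x := adjm W *m (delta_mx j 0 : 'cV[C]_m).
  have xW : W *m x = delta_mx j 0 by rewrite mulmxA hW mul1mx.
  have x0 : x <> 0.
    move=> e; move: xW; rewrite e mulmx0 => /matrixP /(_ j 0); rewrite !mxE !eqxx.
    by move/eqP; rewrite eq_sym oner_eq0.
  have := upos _ _ hdl x0; rewrite uf fc_quad // xW (bigD1 j) //= big1 => [|i hi].
    by rewrite !mxE !eqxx addr0 /= /cabs2 /= expr0n addr0 expr1n rmorph1 mulr1.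
  by rewrite !mxE (negbTE hi) /= cabs20 mulr0.
(* The logarithm [g] is a function of the eigenvalue, not of its index: equal eigenvalues get equal
   exponents, so [w t] is a function of [u dl] and commutes with every [u s]. *)
have /boolp.choice[g hg] (z : C) : exists a : R,
    cabs2 z = 1 -> 0 < Re z -> z = eic a /\ `|a| < pi / 2.
  have [[h1 h2]|h1] := pselect (cabs2 z = 1 /\ 0 < Re z); last by exists 0 => *; case: h1.
  by have [a ha1 ha2] := eic_surj_half h1 h2; exists a.
pose a j := g (f j).
have fa j : f j = eic (a j) by case: (hg (f j)).
have ap j : `|a j| < pi / 2 by case: (hg (f j)).
pose d j := a j / dl; exists W, d; split=> //.
pose w := flow W d.
have comm t s : u t *m w s = w s *m u t.
  apply: (fc_comm (f := f)) => // [i j e|]; first by rewrite /d /a e.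
  by rewrite -uf opg_comm.
have dyad k : u (dl / 2 ^+ k) = w (dl / 2 ^+ k).
  elim: k => [|k IH].
    by rewrite expr0 divr1 uf; apply: eq_fc => j; rewrite fa /d divfK // gt_eqF.
  set s := dl / 2 ^+ k.+1.
  have es : dl / 2 ^+ k = s + s by rewrite /s exprS; field.
  have hs : 0 < s <= dl.
    rewrite /s divr_gt0 ?exprn_gt0 //= ler_pdivrMr ?exprn_gt0 // ler_peMr ?(ltW dl0) //.
    by rewrite exprn_ege1 // ler1n.
  (* [u s] and [w s] commute and have the same square; their sum is invertible, as one has positive
     and the other nonnegative real part. *)
  have z : (u s - w s) *m (u s + w s) = 0.
    rewrite mulmxDr !mulmxBl comm addrA subrK -uD -flowD // -es IH.
    by rewrite subrr.
  apply/eqP; rewrite -subr_eq0; apply/eqP.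
  have un : u s + w s \in unitmx.
    apply: pos_unitmx => x x0; rewrite mulmxDr mulmxDl mxE ReD.
    have h1 : 0 < Re ((adjm x *m u s *m x) 0 0).
      by apply: upos => //; rewrite gtr0_norm; case/andP: hs => // _ h; rewrite /dl in h *; lra.
    suff : 0 <= Re ((adjm x *m w s *m x) 0 0) by lra.
    rewrite fc_quad // Re_sum sumr_ge0 // => j _; rewrite ReM /= mulr0 subr0.
    rewrite mulr_ge0 ?cabs2_ge0 //= ltW //; apply: cos_gt0_pihalf.
    rewrite -ltr_norml /d normrM normrM normfV (gtr0_norm dl0) -mulrA.
    case/andP: hs => s0 s1; rewrite (gtr0_norm s0); apply: le_lt_trans (ap j).
    by rewrite ler_piMr // mulrC ler_pdivrMr // mul1r.
  by rewrite -[LHS](mulmxK un) z mul0mx.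
have pos t : 0 <= t -> u t = w t.
  move=> t0; apply/eqP; rewrite -subr_eq0; apply/eqP/fnorm_eq0/eqP.
  rewrite eq_le fnorm_ge0 andbT; apply/ler_addgt0Pl => e e0; rewrite addr0.
  have e20 : 0 < e / 2 by rewrite divr_gt0.
  have [d1 d10 hd1] := uc e20; have [d2 d20 hd2] := flow_cont0 d hW e20.
  have [k hk] : exists k, dl / 2 ^+ k < Num.min d1 d2.
    pose M := Num.min d1 d2; have M0 : 0 < M by rewrite lt_min d10 d20.
    exists (Num.truncn (dl / M)).+1; rewrite -/M ltr_pdivrMr ?exprn_gt0 // mulrC -ltr_pdivrMr //.
    apply: lt_trans (truncnS_gt _) _.
    by rewrite -natrX ltr_nat ltn_expl.
  set s := dl / 2 ^+ k in hk.
  have s0 : 0 < s by rewrite divr_gt0 // exprn_gt0.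
  (* t = r + q s with 0 <= r < s: the two groups agree at q s, and at r both lie within e / 2 of the
     identity. *)
  pose q := Num.truncn (t / s).
  have /andP[q1 q2] : q%:R <= t / s < q.+1%:R by apply: truncn_itv; rewrite divr_ge0 // ltW.
  pose r := t - s *+ q.
  have r0 : 0 <= r by rewrite subr_ge0 -mulr_natl -ler_pdivlMr.
  have rs : r < s.
    by rewrite /r ltrBlDr -mulrS -mulr_natl -ltr_pdivrMr.
  have et : t = r + s *+ q by rewrite subrK.
  have wq : w (s *+ q) = u (s *+ q).
    by rewrite opg_mulrn dyad /w flow_mulrn.
  rewrite et uD /w flowD // -/w wq -mulmxBl fnorm_unitr //.
  apply: le_trans (fnorm_tri _ 1%:M _) _.
  rewrite (splitr e) lerD //.
    apply/ltW/hd1; rewrite ger0_norm //; apply: lt_trans rs _.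
    by apply: lt_le_trans hk _; rewrite ge_min lexx.
  rewrite fnormBC; apply/ltW/hd2; rewrite ger0_norm //; apply: lt_trans rs _.
  by apply: lt_le_trans hk _; rewrite ge_min lexx orbT.
move=> t; case: (leP 0 t) => ht; first exact: pos.
rewrite -[t]opprK -opg_adj pos ?oppr_ge0 ?(ltW ht) //.
by rewrite /w flow_adj.
Qed.
End Group.
End OneParam.

(** * Pauli operators *)

Section Pauli.
Variable R : realType.
Local Notation C := R[i].
Local Notation "x %:C" := (real_complex R x) (format "x %:C").
Local Notation Re := (@complex.Re R).
Local Notation Im := (@complex.Im R).

Section Cast.
Variables (m m' : nat) (e : m = m').
Local Notation cst := (@castmx C _ _ _ _ (e, e)).
Lemma cast_mul (A B : 'M[C]_m) : cst (A *m B) = cst A *m cst B.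
Proof. by case: m' / e. Qed.
Lemma cast_one : cst 1%:M = 1%:M.
Proof. by case: m' / e. Qed.
Lemma cast_adj (A : 'M[C]_m) : adjm (cst A) = cst (adjm A).
Proof. by case: m' / e. Qed.
Lemma cast_scale a (A : 'M[C]_m) : cst (a *: A) = a *: cst A.
Proof. by case: m' / e. Qed.
Lemma cast_tr (A : 'M[C]_m) : \tr (cst A) = \tr A.
Proof. by case: m' / e. Qed.
End Cast.

Lemma tens_entry m n p q (A : 'M[C]_(m, n)) (B : 'M[C]_(p, q)) i j :
  (A *t B) i j = A (mxtens_unindex i).1 (mxtens_unindex j).1 *
                 B (mxtens_unindex i).2 (mxtens_unindex j).2.
Proof. by rewrite mxE. Qed.
Lemma tens_mul m n p q r s (A : 'M[C]_(m, n)) (B : 'M[C]_(p, q)) (A' : 'M[C]_(n, r)) (B' : 'M[C]_(q, s)) :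
  (A *t B) *m (A' *t B') = (A *m A') *t (B *m B').
Proof. by rewrite tensmx_mul. Qed.
Lemma tens_adj m n p q (A : 'M[C]_(m, n)) (B : 'M[C]_(p, q)) :
  adjm (A *t B) = adjm A *t adjm B.
Proof. by apply/matrixP => i j; rewrite !mxE rmorphM. Qed.
Lemma tens_one m n : (1%:M : 'M[C]_m) *t (1%:M : 'M[C]_n) = 1%:M.
Proof.
apply/matrixP => i j; case: (mxtens_indexP i) => a b; case: (mxtens_indexP j) => c d.
rewrite tensmxE !mxE (can_eq (@mxtens_indexK m n)) xpair_eqE.
by case: eqP; case: eqP; rewrite ?(mul0r, mulr0, mul1r, mulr1).
Qed.
Lemma tens_scale m n p q a b (A : 'M[C]_(m, n)) (B : 'M[C]_(p, q)) :
  (a *: A) *t (b *: B) = (a * b) *: (A *t B).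
Proof. by apply/matrixP => i j; rewrite !mxE; rewrite mulrACA. Qed.
Lemma tens_tr m n (A : 'M[C]_m) (B : 'M[C]_n) : \tr (A *t B) = \tr A * \tr B.
Proof. by rewrite /mxtrace mulr_sum; apply: eq_bigr => i _; rewrite mxE. Qed.

Local Notation o4 k := (@Ordinal 4 k isT).
(* Pauli matrices multiply as the Klein four-group, up to a fourth root of unity. *)
Definition lxor (a b : 'I_4) : 'I_4 :=
  match nat_of_ord a, nat_of_ord b with
  | 0, _ => b
  | _, 0 => a
  | 1, 1 => o4 0 | 1, 2 => o4 3 | 1, _ => o4 2
  | 2, 1 => o4 3 | 2, 2 => o4 0 | 2, _ => o4 1
  | _, 1 => o4 2 | _, 2 => o4 1 | _, _ => o4 0
  end.
Lemma forall_I4 (P : 'I_4 -> Prop) :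
  P (o4 0) -> P (o4 1) -> P (o4 2) -> P (o4 3) -> forall a, P a.
Proof.
move=> h0 h1 h2 h3 [[|[|[|[|a]]]] ha] //.
- by rewrite (_ : Ordinal ha = o4 0) //; apply: val_inj.
- by rewrite (_ : Ordinal ha = o4 1) //; apply: val_inj.
- by rewrite (_ : Ordinal ha = o4 2) //; apply: val_inj.
- by rewrite (_ : Ordinal ha = o4 3) //; apply: val_inj.
Qed.
Lemma forall_I2 (P : 'I_2 -> Prop) : P ord0 -> P (lift ord0 ord0) -> forall a, P a.
Proof.
move=> h0 h1 [[|[|a]] ha] //.
- by rewrite (_ : Ordinal ha = ord0) //; apply: val_inj.
- by rewrite (_ : Ordinal ha = lift ord0 ord0) //; apply: val_inj.
Qed.
Lemma lxorK a b : lxor a (lxor a b) = b.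
Proof. by move: a b; apply: forall_I4; apply: forall_I4; apply: val_inj. Qed.

Lemma pauli1_mul (a b : 'I_4) : exists c : C, c ^+ 4 = 1 /\
  pauli1 a *m pauli1 b = c *: pauli1 (lxor a b).
Proof.
pose ph (a b : 'I_4) : C := match nat_of_ord a, nat_of_ord b with
  | 0, _ => 1 | _, 0 => 1
  | 1, 1 => 1 | 1, 2 => Complex 0 1 | 1, _ => Complex 0 (-1)
  | 2, 1 => Complex 0 (-1) | 2, 2 => 1 | 2, _ => Complex 0 1
  | _, 1 => Complex 0 1 | _, 2 => Complex 0 (-1) | _, _ => 1 end.
exists (ph a b); split.
  by move: a b; apply: forall_I4; apply: forall_I4;
    apply: Cext; rewrite !exprS expr0 /ph /=; ring.
move: a b; apply: forall_I4; apply: forall_I4; apply/matrixP;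
  apply: forall_I2; apply: forall_I2; rewrite !mxE !big_ord_recl big_ord0 !mxE /=;
  apply: Cext; rewrite !ReImE /=; ring.
Qed.
Lemma pauli1_adj (a : 'I_4) : adjm (pauli1 a : 'M[C]_2) = pauli1 a.
Proof.
move: a; apply: forall_I4; apply/matrixP; apply: forall_I2; apply: forall_I2;
  rewrite adjmE !mxE /=; apply: Cext; rewrite /= ?oppr0 ?opprK //.
Qed.
Lemma pauli1_sqr (a : 'I_4) : pauli1 a *m pauli1 a = 1%:M :> 'M[C]_2.
Proof.
move: a; apply: forall_I4; apply/matrixP;
  apply: forall_I2; apply: forall_I2; rewrite !mxE !big_ord_recl big_ord0 !mxE /=;
  apply: Cext; rewrite !ReImE /=; ring.
Qed.
Lemma pauli1_tr (a : 'I_4) : \tr (pauli1 a : 'M[C]_2) = if nat_of_ord a == 0%N then 2 else 0.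
Proof.
move: a; apply: forall_I4; rewrite /mxtrace !big_ord_recl big_ord0 !mxE /=;
  apply: Cext; rewrite !ReImE /=; ring.
Qed.
(** Entrywise form of a known identity: the sum of sigma_a (x) sigma_a over the four matrices is
    twice the swap. *)
Lemma pauli1_swap (i j k l : 'I_2) :
  \sum_(a : 'I_4) (pauli1 a i j : C) * pauli1 a k l = 2 * (i == l)%:R * (j == k)%:R.
Proof.
move: i j k l; apply: forall_I2; apply: forall_I2; apply: forall_I2; apply: forall_I2;
  rewrite !big_ord_recl big_ord0 !mxE /=; apply: Cext; rewrite !ReImE /=; ring.
Qed.

(** * Pauli words on n qubits *)

Lemma pauli_cons n (a : 'I_4) (w : n.-tuple 'I_4) :
  pauli (cons_tuple a w) = castmx (esym (expnS 2 n), esym (expnS 2 n)) (pauli1 a *t pauli w) :> 'M[C]_(2 ^ n.+1).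
Proof.
case: w => s sz; rewrite /pauli.
move: (size_tuple (Tuple sz)) (size_tuple (cons_tuple a (Tuple sz))) => /=.
move: (eqP sz) => e; case: n / e sz => sz e1 e2.
rewrite (eq_irrelevance e1 (erefl _)) (eq_irrelevance e2 (erefl _)) /=.
by rewrite !castmx_id.
Qed.

Lemma pauli_consE n (a : 'I_4) (w : n.-tuple 'I_4) (i j : 'I_(2 ^ n.+1)) :
  (pauli (cons_tuple a w) i j : C) =
  pauli1 a (mxtens_unindex (cast_ord (expnS 2 n) i)).1 (mxtens_unindex (cast_ord (expnS 2 n) j)).1 *
  pauli w (mxtens_unindex (cast_ord (expnS 2 n) i)).2 (mxtens_unindex (cast_ord (expnS 2 n) j)).2.
Proof.
rewrite pauli_cons castmxE -tens_entry.
by congr ((_ *t _) _ _); apply: val_inj.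
Qed.

Lemma pauli_nil (w : 0.-tuple 'I_4) : pauli w = 1%:M :> 'M[C]_(2 ^ 0).
Proof.
rewrite (tuple0 w) /pauli; move: (size_tuple _) => /= e.
by rewrite (eq_irrelevance e (erefl _)) /= castmx_id.
Qed.

Lemma tuple_consE (T : Type) n (w : n.+1.-tuple T) : w = cons_tuple (thead w) (behead_tuple w).
Proof. by rewrite [LHS]tuple_eta; apply: val_inj. Qed.

Lemma cons_tuple_eq (T : eqType) n a b (w v : n.-tuple T) :
  (cons_tuple a w == cons_tuple b v) = (a == b) && (w == v).
Proof.
apply/eqP/andP => [/(congr1 val) /= [-> h]|[/eqP-> /eqP->] //].
by split=> //; apply/eqP/val_inj.
Qed.

Definition wxor n (w v : n.-tuple 'I_4) : n.-tuple 'I_4 :=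
  map_tuple (fun p => lxor p.1 p.2) (zip_tuple w v).
Lemma wxor_cons n a b (w v : n.-tuple 'I_4) :
  wxor (cons_tuple a w) (cons_tuple b v) = cons_tuple (lxor a b) (wxor w v).
Proof. exact: val_inj. Qed.
Lemma wxorK n (w v : n.-tuple 'I_4) : wxor w (wxor w v) = v.
Proof.
elim: n w v => [|n IH] w v; first by rewrite (tuple0 v) [LHS]tuple0.
by rewrite (tuple_consE w) (tuple_consE v) !wxor_cons lxorK IH.
Qed.

Lemma pauli_adj n (w : n.-tuple 'I_4) : adjm (pauli w : 'M[C]_(2 ^ n)) = pauli w.
Proof.
elim: n w => [|n IH] w; first by rewrite pauli_nil adjm1.
by rewrite (tuple_consE w) pauli_cons cast_adj tens_adj pauli1_adj IH.
Qed.
Lemma pauli_sqr n (w : n.-tuple 'I_4) : pauli w *m pauli w = 1%:M :> 'M[C]_(2 ^ n).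
Proof.
elim: n w => [|n IH] w; first by rewrite pauli_nil mul1mx.
by rewrite (tuple_consE w) pauli_cons -cast_mul tens_mul pauli1_sqr IH tens_one cast_one.
Qed.
Lemma pauli_mul n (w v : n.-tuple 'I_4) : exists c : C, c ^+ 4 = 1 /\
  pauli w *m pauli v = c *: pauli (wxor w v).
Proof.
elim: n w v => [|n IH] w v.
  by exists 1; rewrite expr1n !pauli_nil scale1r mul1mx.
rewrite (tuple_consE w) (tuple_consE v) wxor_cons !pauli_cons -cast_mul tens_mul.
have [c [hc ->]] := pauli1_mul (thead w) (thead v).
have [d [hd ->]] := IH (behead_tuple w) (behead_tuple v).
by exists (c * d); rewrite exprMn hc hd mul1r tens_scale cast_scale.
Qed.

Definition word0 n : n.-tuple 'I_4 := nseq_tuple n ord0.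
Lemma pauli_tr n (w : n.-tuple 'I_4) :
  \tr (pauli w : 'M[C]_(2 ^ n)) = if w == word0 n then (2 ^ n)%:R else 0.
Proof.
elim: n w => [|n IH] w.
  by rewrite pauli_nil mxtrace1 [w]tuple0 [word0 0]tuple0 eqxx.
rewrite (tuple_consE w) pauli_cons cast_tr tens_tr pauli1_tr IH.
rewrite (_ : word0 n.+1 = cons_tuple ord0 (word0 n)); last exact: val_inj.
rewrite cons_tuple_eq (_ : (thead w == ord0) = (nat_of_ord (thead w) == 0%N)) //.
by do 2![case: (_ == _)]; rewrite /= ?(mul0r, mulr0) // -natrM expnS.
Qed.
Lemma pauli_word0 n : pauli (word0 n) = 1%:M :> 'M[C]_(2 ^ n).
Proof.
elim: n => [|n IH]; first exact: pauli_nil.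
rewrite (_ : word0 n.+1 = cons_tuple ord0 (word0 n)); last exact: val_inj.
rewrite pauli_cons IH (_ : pauli1 ord0 = 1%:M) ?tens_one ?cast_one //.
by apply/matrixP => i j; rewrite !mxE /=; case: eqP.
Qed.
(** The trace separates the words: it is 2^n at [word0] and 0 at every other word. *)
Lemma nontrivE n (w : n.-tuple 'I_4) : (w \in nontriv_pauli R n) = (w != word0 n).
Proof.
rewrite inE; congr (~~ _); apply/eqP/eqP => [h|->]; last exact: pauli_word0.
have := pauli_tr w; rewrite h mxtrace1; case: eqP => // _ /eqP.
by rewrite pnatr_eq0 expn_eq0.
Qed.
Lemma card_nontriv n : #|nontriv_pauli R n| = (4 ^ n).-1.
Proof.
rewrite (_ : nontriv_pauli R n = finset.setC (finset.set1 (word0 n))); last first.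
  by apply/setP => w; rewrite nontrivE !inE.
by rewrite cardsC1 card_tuple card_ord.
Qed.

Lemma sum_cons n (V : zmodType) (F : n.+1.-tuple 'I_4 -> V) :
  \sum_w F w = \sum_a \sum_w F (cons_tuple a w).
Proof.
rewrite pair_big /=; apply: reindex; exists (fun w => (thead w, behead_tuple w)) => w _.
  by case: w => a w /=; congr (_, _); apply: val_inj.
by rewrite -tuple_consE.
Qed.
(** The swap identity multiplies over the qubits. Contracting it yields both the expansion
    [pauli_span] and the count [card_panti]. *)
Lemma pauli_swap n (i j k l : 'I_(2 ^ n)) :
  \sum_(w : n.-tuple 'I_4) (pauli w i j : C) * pauli w k l = (2 ^ n)%:R * (i == l)%:R * (j == k)%:R.
Proof.
elim: n i j k l => [|n IH] i j k l.
  rewrite (bigD1 (word0 0)) //= big1 ?addr0 => [|w]; last by rewrite (tuple0 w) (tuple0 (word0 0)) eqxx.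
  by rewrite pauli_nil !mxE (ord1 i) (ord1 j) (ord1 k) (ord1 l) !eqxx !mulr1.
rewrite sum_cons.
pose ci (x : 'I_(2 ^ n.+1)) := cast_ord (expnS 2 n) x.
have ciE x y : (x == y) = ((mxtens_unindex (ci x)).1 == (mxtens_unindex (ci y)).1) &&
                          ((mxtens_unindex (ci x)).2 == (mxtens_unindex (ci y)).2).
  by rewrite -xpair_eqE -!surjective_pairing (can_eq (@mxtens_unindexK 2 (2 ^ n))) (inj_eq (@cast_ord_inj _ _ _)).
rewrite !ciE -!mulnb !natrM [X in X%:R * _](expnS 2 n) natrM.
transitivity ((\sum_a (pauli1 a (mxtens_unindex (ci i)).1 (mxtens_unindex (ci j)).1 : C)
                 * pauli1 a (mxtens_unindex (ci k)).1 (mxtens_unindex (ci l)).1) *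
  (\sum_(w : n.-tuple 'I_4) (pauli w (mxtens_unindex (ci i)).2 (mxtens_unindex (ci j)).2 : C)
                 * pauli w (mxtens_unindex (ci k)).2 (mxtens_unindex (ci l)).2)).
  rewrite mulr_suml; apply: eq_bigr => a _; rewrite mulr_sumr; apply: eq_bigr => w _.
  by rewrite !pauli_consE mulrACA.
by rewrite pauli1_swap IH; ring.
Qed.

Lemma pauli_span n (X : 'M[C]_(2 ^ n)) :
  X = ((2 ^ n)%:R)^-1 *: \sum_(w : n.-tuple 'I_4) \tr (pauli w *m X) *: pauli w.
Proof.
have N0 : ((2 ^ n)%:R : C) != 0 by rewrite pnatr_eq0 expn_eq0.
apply: (scalerI N0); rewrite scalerA divff // scale1r.
apply/matrixP => k l; rewrite summxE !mxE.
transitivity (\sum_i \sum_j \sum_(w : n.-tuple 'I_4) ((pauli w i j : C) * pauli w k l) * X j i).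
  rewrite (bigD1 l) //= [X in _ + X]big1 ?addr0 => [|i il].
    rewrite (bigD1 k) //= [X in _ + X]big1 ?addr0 => [|j jk].
      by rewrite -mulr_suml pauli_swap !eqxx !mulr1.
    by rewrite -mulr_suml pauli_swap (negbTE jk) !(mulr0, mul0r).
  by apply: big1 => j _; rewrite -mulr_suml pauli_swap (negbTE il) !(mulr0, mul0r).
under eq_bigr => i _ do rewrite exchange_big.
rewrite exchange_big /=; apply: eq_bigr => w _; rewrite !mxE mulr_suml; apply: eq_bigr => i _.
by rewrite mxE mulr_suml; apply: eq_bigr => j _; rewrite mulrAC.
Qed.

(** * Anticommuting Pauli words *)

Definition panti n (w v : n.-tuple 'I_4) : bool :=
  pauli w *m pauli v == - (pauli v *m pauli w) :> 'M[C]_(2 ^ n).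

Lemma pauli_neq0 n (w : n.-tuple 'I_4) : pauli w != 0 :> 'M[C]_(2 ^ n).
Proof.
apply/eqP => h; have := pauli_sqr w; rewrite h mul0mx => /(congr1 (fun A => \tr A)).
by rewrite mxtrace1 mxtrace0 => /eqP; rewrite eq_sym pnatr_eq0 expn_eq0.
Qed.
Lemma pauli_mulC n (w v : n.-tuple 'I_4) c :
  pauli w *m pauli v = c *: pauli (wxor w v) -> pauli v *m pauli w = conjc c *: pauli (wxor w v) :> 'M[C]_(2 ^ n).
Proof. by move/(congr1 (@adjm R _ _)); rewrite adjmM adjmZ !pauli_adj. Qed.

(** Both words are Hermitian, so the reversed product carries the conjugate phase; anticommutation
    makes the phase c imaginary, and c^4 = 1 leaves +-i. *)
Lemma pauli_antiP n (w v : n.-tuple 'I_4) : panti w v ->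
  exists2 del : R, del ^+ 2 = 1 & pauli w *m pauli v = Complex 0 del *: pauli (wxor w v) :> 'M[C]_(2 ^ n).
Proof.
have [c [hc e]] := pauli_mul w v.
rewrite /panti e (pauli_mulC e) => /eqP h.
have hr : Re c = 0.
  move: h => /eqP; rewrite -subr_eq0 opprK -scalerDl scaler_eq0 (negbTE (pauli_neq0 _)) orbF => /eqP.
  by case: (c) => a b [] /=; lra.
exists (Im c); last by  congr (_ *: _); apply: Cext.
have : Re (c ^+ 4) = 1 by rewrite hc.
rewrite (_ : c = Complex 0 (Im c)); last exact: Cext.
rewrite !exprS expr0 /= => h4.
have : (Im c ^+ 2 - 1) * (Im c ^+ 2 + 1) = 0 by move: h4; lra.
by move/eqP; rewrite mulf_eq0 => /orP[] /eqP ?; have := sqr_ge0 (Im c); lra.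
Qed.
(** The phase satisfies c^4 = 1. If c^2 = 1 it is real and the words commute; if c^2 = -1 it is
    imaginary and they anticommute. *)
Lemma pauli_commP n (w v : n.-tuple 'I_4) : ~~ panti w v ->
  pauli w *m pauli v = pauli v *m pauli w :> 'M[C]_(2 ^ n).
Proof.
have [c [hc e]] := pauli_mul w v.
rewrite /panti e (pauli_mulC e) => h.
have : (c ^+ 2 - 1) * (c ^+ 2 + 1) = 0.
  by rewrite -subr_sqr expr1n -exprM hc subrr.
move/eqP; rewrite mulf_eq0 => /orP[] /eqP h2.
  have hi : Im c = 0.
    move: h2 => /eqP; rewrite subr_eq0 sqrf_eq1 => /orP[] /eqP -> //=; exact: oppr0.
  by congr (_ *: _); case: (c) hi => a b /= ->; rewrite oppr0.
case/negP: h; apply/eqP; rewrite -scaleNr; congr (_ *: _).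
case: (c) h2 => a b; rewrite expr2 => -[h3 h4]; apply: Cext; rewrite /= ?opprK //.
have ha : a ^+ 2 * (a ^+ 2 + 1) = 0 by nra.
have : a ^+ 2 = 0.
  by move: ha => /eqP; rewrite mulf_eq0 => /orP[] /eqP // ?; have := sqr_ge0 a; lra.
by move/eqP; rewrite sqrf_eq0 => /eqP ->; rewrite oppr0.
Qed.
Lemma panti_sym n (w v : n.-tuple 'I_4) : panti w v -> panti v w.
Proof. by move/eqP => h; apply/eqP; rewrite h opprK. Qed.
Lemma panti_xor n (w v : n.-tuple 'I_4) : panti w v -> panti w (wxor w v).
Proof.
move=> h; have [del d2 e] := pauli_antiP h.
have d0 : (Complex 0 del : C) != 0.
  by apply/eqP => -[] d0; move: d2; rewrite d0 expr0n /= => /eqP; rewrite eq_sym oner_eq0.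
apply/eqP; apply: (scalerI d0).
by rewrite scalemxAr -e scalerN scalemxAl -e -!mulmxA (eqP (panti_sym h)) mulmxN opprK.
Qed.
Lemma panti_nontriv n (w v : n.-tuple 'I_4) : panti w v -> v \in nontriv_pauli R n.
Proof.
move=> h; rewrite inE; apply/eqP => e; move: h; rewrite /panti e mulmx1 mul1mx.
rewrite -subr_eq0 opprK -mulr2n -scaler_nat scaler_eq0 pnatr_eq0 /=.
by rewrite (negbTE (pauli_neq0 _)).
Qed.
Lemma pauli_anti_xor n (w v : n.-tuple 'I_4) (del : R) : del ^+ 2 = 1 ->
  pauli w *m pauli v = Complex 0 del *: pauli (wxor w v) :> 'M[C]_(2 ^ n) ->
  pauli w *m pauli (wxor w v) = Complex 0 (- del) *: pauli v :> 'M[C]_(2 ^ n).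
Proof.
move=> d2 e; have : Complex 0 (- del) *: (pauli w *m (pauli w *m pauli v)) = pauli w *m pauli (wxor w v) :> 'M[C]_(2 ^ n).
  rewrite e -scalemxAr scalerA (_ : _ * _ = 1) ?scale1r //.
  by apply: Cext; rewrite !ReImE /= -?d2; ring.
by move=> <-; rewrite mulmxA pauli_sqr mul1mx.
Qed.

(** By the swap identity the sum of P_v P_w P_v over all words v is 2^n tr(P_w) times the identity,
    hence 0. Each term is also P_w or -P_w, as v commutes or anticommutes with w, so both kinds are
    equally many among the 4^n words. *)
Lemma card_panti n (w : n.-tuple 'I_4) : w \in nontriv_pauli R n ->
  (#|panti w|%:R : R) = (4 ^ n)%:R / 2.
Proof.
move=> hw.
have h : \sum_(v : n.-tuple 'I_4) (pauli v *m pauli w *m pauli v : 'M[C]_(2 ^ n)) = 0.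
  apply/matrixP => i l; rewrite summxE mxE.
  transitivity (\sum_k \sum_j \sum_(v : n.-tuple 'I_4) ((pauli v i j : C) * pauli v k l) * pauli w j k).
    rewrite exchange_big /=; under [RHS]eq_bigr => j _ do rewrite exchange_big.
    rewrite [RHS]exchange_big /=; apply: eq_bigr => v _.
    rewrite mxE [RHS]exchange_big; apply: eq_bigr => k _; rewrite mxE mulr_suml.
    by apply: eq_bigr => j _; rewrite mulrAC.
  transitivity (\sum_k (2 ^ n)%:R * (i == l)%:R * (pauli w k k : C)).
    apply: eq_bigr => k _; rewrite (bigD1 k) //= [X in _ + X]big1 ?addr0 => [|j jk].
      by rewrite -mulr_suml pauli_swap eqxx mulr1.
    by rewrite -mulr_suml pauli_swap (negbTE jk) mulr0 mul0r.
  rewrite -mulr_sumr [\sum_k _](_ : _ = \tr (pauli w)) // pauli_tr.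
  by move: hw; rewrite nontrivE => /negbTE ->; rewrite mulr0.
have e : \sum_(v : n.-tuple 'I_4) (pauli v *m pauli w *m pauli v : 'M[C]_(2 ^ n)) =
   (\sum_(v : n.-tuple 'I_4) (if panti w v then -1 else 1 : C)) *: pauli w.
  rewrite scaler_suml; apply: eq_bigr => v _; case: ifPn => [/panti_sym /eqP ->|/pauli_commP <-].
    by rewrite mulNmx -mulmxA pauli_sqr mulmx1 scaleN1r.
  by rewrite -mulmxA pauli_sqr mulmx1 scale1r.
move: h; rewrite e => /eqP; rewrite scaler_eq0 (negbTE (pauli_neq0 w)) orbF => /eqP.
rewrite (bigID (panti w)) /= (eq_bigr (fun=> -1)) => [|v ->] //.
rewrite [X in _ + X](eq_bigr (fun=> 1)) => [|v /negbTE ->] // => h.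
have hc : (#|[predC panti w]| = #|panti w|)%N.
  apply/eqP; rewrite -(eqr_nat C) -subr_eq0 addrC; apply/eqP; rewrite -[RHS]h.
  by rewrite sumrN !sumr_const.
have : (#|panti w| + #|panti w| = 4 ^ n)%N.
  by rewrite -{2}hc -[in RHS](card_ord 4) -card_tuple -(cardC (panti w)).
move=> <-; rewrite natrD; lra.
Qed.
End Pauli.

(** * Pauli rotations *)

Section Rotations.
Variable R : realType.
Local Notation C := R[i].
Local Notation "x %:C" := (real_complex R x) (format "x %:C").
Local Notation Re := (@complex.Re R).
Local Notation Im := (@complex.Im R).

(* [rot P a] is [e^{iaP}] when [P] is an involution. *)
Definition rot m (P : 'M[C]_m) (a : R) : 'M[C]_m :=
  (cos a)%:C *: 1%:M + Complex 0 (sin a) *: P.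

(** Even powers of iaP are scalars and odd powers are multiples of P, so the exponential series
    splits into the cosine and sine series. *)
Lemma expm_term m (P : 'M[C]_m) (a : R) k : P *m P = 1%:M ->
  ((k`!)%:R)^-1 *: (Complex 0 a *: P) ^+ k =
  (cos_coeff a k)%:C *: 1%:M + Complex 0 (sin_coeff a k) *: P.
Proof.
move=> PP.
have ev j : (Complex 0 a *: P) ^+ j.*2 = ((-1) ^+ j * a ^+ j.*2)%:C *: 1%:M.
  elim: j => [|j IH]; first by rewrite !expr0 mul1r rmorph1 scale1r.
  rewrite doubleS !exprS IH mulrA -[(_ *: P) * (_ *: P)]/((_ *: P) *m (_ *: P)).
  rewrite -scalemxAl -scalemxAr PP scalerA -[_ * _ in LHS]/(_ *m _) -scalemxAl mul1mx scalerA.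
  by congr (_ *: _); apply: Cext; rewrite !ReImE /=; ring.
have fC : ((k`!)%:R : C)^-1 = ((k`!)%:R^-1 : R)%:C by rewrite fmorphV rmorph_nat.
rewrite fC -(odd_double_half k) /cos_coeff /sin_coeff.
case: (odd k); rewrite /= ?add0n ?add1n /= ?odd_double /= ?uphalf_double ?half_double.
  rewrite exprS ev -[_ * _ in LHS]/(_ *m _) -scalemxAl -scalemxAr mulmx1 !scalerA.
  rewrite !mul0r rmorph0 scale0r add0r; congr (_ *: _).
  by apply: Cext; rewrite !ReImE /= ?exprS; ring.
rewrite ev scalerA !mul0r (_ : Complex 0 0 = 0) // scale0r addr0 -exprnP; congr (_ *: _).
by apply: Cext; rewrite !ReImE /=; ring.
Qed.

Lemma expm_rot m (P : 'M[C]_m) (a : R) : P *m P = 1%:M ->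
  expm (Complex 0 a *: P) = rot P a.
Proof.
move=> PP; apply/matrixP => i j.
have e n : expm_partial (Complex 0 a *: P) n i j =
    (series (cos_coeff a) n)%:C * (1%:M : 'M[C]_m) i j + Complex 0 (series (sin_coeff a) n) * P i j.
  rewrite /expm_partial summxE /series /= !big_mkord rmorph_sum /= mulr_suml.
  have -> : Complex 0 (\sum_(i < n) sin_coeff a i) = \sum_(i < n) Complex 0 (sin_coeff a i).
    by apply: Cext; rewrite !ReImE //= big1.
  rewrite mulr_suml -big_split /=; apply: eq_bigr => k _.
  by rewrite expm_term // !mxE.
have cc : series (cos_coeff a) n @[n --> \oo] --> cos a.
  by rewrite cos.unlock; exact: is_cvg_series_cos_coeff.
have cs : series (sin_coeff a) n @[n --> \oo] --> sin a.
  by rewrite sin.unlock; exact: is_cvg_series_sin_coeff.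
rewrite !mxE; apply: Cext => /=.
  under eq_fun => n do rewrite e !ReImE /= mul0r mul0r subr0 sub0r -mulNr.
  apply: cvg_lim => //; rewrite !ReImE /= !mul0r subr0 sub0r -!mulNr !mxE.
  by apply: cvgD; (apply: cvgM; last exact: cvg_cst) => //; exact: cvgN.
under eq_fun => n do rewrite e !ReImE /= mul0r mul0r addr0 add0r.
apply: cvg_lim => //; rewrite !ReImE /= !mul0r addr0 add0r !mxE.
by apply: cvgD; (apply: cvgM; last exact: cvg_cst).
Qed.

Lemma det_fc m (W : 'M[C]_m) f : unitary W -> \det (fc W f) = \prod_j f j.
Proof.
move=> hW; rewrite /fc !det_mulmx mulrAC -det_mulmx unitaryK // det1 mul1r det_diag.
by apply: eq_bigr => j _; rewrite mxE.
Qed.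
Lemma tr_fc m (W : 'M[C]_m) f : unitary W -> \tr (fc W f) = \sum_j f j.
Proof.
move=> hW; rewrite /fc mxtrace_mulC mulmxA hW mul1mx.
by apply: eq_bigr => j _; rewrite !mxE eqxx mulr1n.
Qed.

Section Refl.
Variables (m : nat) (P : 'M[C]_m).
Hypotheses (PP : P *m P = 1%:M) (Pa : adjm P = P).

(** A Hermitian involution has eigenvalues d = +-1, and there cos a + i d sin a = e^{iad}. *)
Lemma rot_flow : exists W d, [/\ unitary W, forall j, d j ^+ 2 = 1,
  P = fc W (fun j => (d j)%:C) & forall a, rot P a = flow W d a].
Proof.
have [W [d [hW eP]]] := herm_spectral Pa.
have d2 j : d j ^+ 2 = 1.
  move: PP; rewrite {1 2}eP fc_mul // -(fc_one hW) => /(fc_inj hW) /(_ j).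
  by rewrite -rmorphM => /complexI; rewrite expr2.
exists W, d; split=> // a.
rewrite /rot /flow {1}eP -(fc_one hW) !fc_scale fc_add; apply: eq_fc => j.
move/eqP: (d2 j); rewrite sqrf_eq1 => /orP[] /eqP ->.
  by apply: Cext; rewrite !ReImE /= mul1r; ring.
by apply: Cext; rewrite !ReImE /= mulN1r ?cosN ?sinN; ring.
Qed.
Lemma rotD a b : rot P (a + b) = rot P a *m rot P b.
Proof. by have [W [d [hW _ _ e]]] := rot_flow; rewrite !e flowD. Qed.
Lemma rot_unitary a : unitary (rot P a).
Proof. by have [W [d [hW _ _ e]]] := rot_flow; rewrite !e; exact: flow_unitary. Qed.
Lemma rot0 : rot P 0 = 1%:M.
Proof. by have [W [d [hW _ _ e]]] := rot_flow; rewrite !e flow0. Qed.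
(** The determinant is e^{ia tr P}. *)
Lemma rot_SU a : \tr P = 0 -> SU m (rot P a).
Proof.
move=> tP; split; first exact: rot_unitary.
have [W [d [hW _ eP e]]] := rot_flow; rewrite e det_fc // -eic_sum -mulr_suml.
rewrite (_ : \sum_i d i = 0) ?mul0r ?eic0 //.
by apply: (@complexI R); rewrite rmorph_sum /= -(tr_fc _ hW) -eP tP.
Qed.
End Refl.

Lemma rot_pi m (P : 'M[C]_m) a : rot P (a + pi) = - rot P a.
Proof.
rewrite /rot cosDpi sinDpi opprD -!scaleNr; congr (_ *: _ + _ *: _);
  by apply: Cext; rewrite !ReImE /= ?oppr0.
Qed.
Lemma rot_mconj m (P : 'M[C]_m) a : rot (mconj P) (- a) = mconj (rot P a).
Proof.
by rewrite /rot cosN sinN mconjD !mconjZ mconj1 conjc_real.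
Qed.
Lemma rot_conj m (P Q V : 'M[C]_m) a : V *m P *m adjm V = Q -> unitary V ->
  V *m rot P a *m adjm V = rot Q a.
Proof.
by move=> <- hV; rewrite /rot mulmxDr mulmxDl -!scalemxAr -!scalemxAl mulmx1 hV.
Qed.

(* Euler angles: e^{isX/2} = e^{iaP/2} e^{ibS/2} e^{iaP/2} for X = cos th P + sin th S, where
   tan(s/2) = tau, tan a = tau cos th and sin(b/2) = sin(s/2) sin th. *)
Lemma euler m (P S : 'M[C]_m) (th tau : R) :
  P *m P = 1%:M -> S *m S = 1%:M -> P *m S = - (S *m P) ->
  let al := atan (tau * cos th) in
  let be := atan (tau * sin th / Num.sqrt (1 + (tau * cos th) ^+ 2)) in
  rot ((cos th)%:C *: P + (sin th)%:C *: S) (atan tau) =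
  rot P (al / 2) *m rot S be *m rot P (al / 2).
Proof.
move=> PP SS PS al be.
(* q = 1 / cos al and p = 1 / cos (atan tau); with these, cos be = q / p. *)
set q := Num.sqrt (1 + (tau * cos th) ^+ 2) in be *.
set p := Num.sqrt (1 + tau ^+ 2).
have q2 : q ^+ 2 = 1 + (tau * cos th) ^+ 2 by rewrite sqr_sqrtr // addr_ge0 ?sqr_ge0.
have q0 : 0 < q by rewrite sqrtr_gt0 ltr_pwDl // sqr_ge0.
have p0 : 0 < p by rewrite sqrtr_gt0 ltr_pwDl // sqr_ge0.
have sin_atan (x : R) : sin (atan x) = x / Num.sqrt (1 + x ^+ 2).
  rewrite -{2}[x]atanK /tan mulrAC -cos_atan mulfK // cos_atan invr_neq0 //.
  by rewrite gt_eqF // sqrtr_gt0 ltr_pwDl // sqr_ge0.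
have pq : Num.sqrt (1 + (tau * sin th / q) ^+ 2) = p / q.
  rewrite -[RHS]ger0_norm ?divr_ge0 ?(ltW p0) ?(ltW q0) // -sqrtr_sqr; congr Num.sqrt.
  rewrite !expr_div_n q2 /p sqr_sqrtr ?addr_ge0 ?sqr_ge0 //.
  have -> : tau ^+ 2 = (tau * cos th) ^+ 2 + (tau * sin th) ^+ 2.
    by rewrite !exprMn -mulrDr cos2Dsin2 mulr1.
  have : 1 + (tau * cos th) ^+ 2 != 0 by rewrite -q2 expf_neq0 // gt_eqF.
  by move=> ?; field.
have SP a : S *m rot P a = rot P (- a) *m S.
  rewrite /rot cosN sinN mulmxDr mulmxDl -!scalemxAr -!scalemxAl mulmx1 mul1mx PS scalerN -scaleNr.
  by congr (_ + _ *: _); apply: Cext; rewrite !ReImE /= ?oppr0 ?opprK.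
have rotPD a b : rot P a *m rot P b = rot P (a + b).
  rewrite /rot cosD sinD mulmxDr !mulmxDl -!scalemxAr -!scalemxAl mulmx1 mul1mx mulmx1 PP !scalerA.
  rewrite [in X in _ + X = _]addrC addrACA -!scalerDl; congr (_ *: _ + _ *: _); by apply: Cext; rewrite !ReImE /=; ring.
have gen (A : 'M[C]_m) u v : A *m (u *: 1%:M + v *: S) *m A = u *: (A *m A) + v *: (A *m (S *m A)).
  by rewrite mulmxDr mulmxDl -!scalemxAr -!scalemxAl mulmx1 mulmxA.
(* Moving [S] past a rotation about P reverses it: the two half rotations add up in the scalar term
   of the middle factor and cancel in its [S] term. *)
have -> : rot P (al / 2) *m rot S be *m rot P (al / 2) =
    (cos be)%:C *: rot P al + Complex 0 (sin be) *: S.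
  rewrite [rot S be]/rot gen rotPD -splitr SP mulmxA rotPD subrr.
  by congr (_ + _ *: _); rewrite /rot cos0 sin0 scale1r (_ : Complex 0 0 = 0) // scale0r addr0 mul1mx.
have hp : p != 0 by rewrite gt_eqF.
have hq : q != 0 by rewrite gt_eqF.
rewrite /rot !sin_atan !cos_atan -/p -/q pq scalerDr !scalerA scalerDr !scalerA addrA.
have comb (p' q' ct st : R) : p' != 0 -> q' != 0 ->
    [/\ (p'^-1)%:C = ((p' / q')^-1)%:C * (q'^-1)%:C,
     Complex 0 (tau / p') * ct%:C = ((p' / q')^-1)%:C * Complex 0 (tau * ct / q') &
     Complex 0 (tau / p') * st%:C = Complex 0 (tau * st / q' / (p' / q'))].
  by move=> p'0 q'0; split; apply: Cext; rewrite !ReImE /=; field; rewrite ?p'0 ?q'0.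
by have [-> -> ->] := comb p q (cos th) (sin th) hp hq.
Qed.
End Rotations.

(** * The Lie algebra relations *)

Section Derivatives.
Variable R : realType.
Local Notation C := R[i].
Local Notation "x %:C" := (real_complex R x) (format "x %:C").
Local Notation Re := (@complex.Re R).
Local Notation Im := (@complex.Im R).

(* Derivatives at 0, of complex-valued functions of a real variable. *)
Definition cder (f : R -> C) (d : C) : Prop :=
  is_derive (0 : R) 1 (fun t => Re (f t) : R^o) (Re d) /\
  is_derive (0 : R) 1 (fun t => Im (f t) : R^o) (Im d).
Definition mder m n (F : R -> 'M[C]_(m, n)) (D : 'M[C]_(m, n)) : Prop :=
  forall i j, cder (fun t => F t i j) (D i j).

Lemma cder_cst (c : C) : cder (fun=> c) 0.
Proof. by split; apply: is_derive_cst. Qed.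
Lemma cderD f g d e : cder f d -> cder g e -> cder (fun t => f t + g t) (d + e).
Proof.
move=> [f1 f2] [g1 g2]; split.
  by under eq_fun do rewrite ReD; rewrite ReD; exact: is_deriveD.
by under eq_fun do rewrite ImD; rewrite ImD; exact: is_deriveD.
Qed.
Lemma cderM f g d e : cder f d -> cder g e ->
  cder (fun t => f t * g t) (d * g 0 + f 0 * e).
Proof.
move=> [f1 f2] [g1 g2]; split.
  under eq_fun do rewrite ReM.
  have h := is_deriveB (is_deriveM f1 g1) (is_deriveM f2 g2).
  apply: (is_derive_eq h); rewrite /GRing.scale /= ReD !ReM; ring.
under eq_fun do rewrite ImM.
have h := is_deriveD (is_deriveM f1 g2) (is_deriveM f2 g1).
apply: (is_derive_eq h); rewrite /GRing.scale /= ImD !ImM; ring.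
Qed.
Lemma cder_sum (I : eqType) (s : seq I) (f : I -> R -> C) (d : I -> C) :
  (forall i, i \in s -> cder (f i) (d i)) ->
  cder (fun t => \sum_(i <- s) f i t) (\sum_(i <- s) d i).
Proof.
elim: s => [|i s IH] h.
  by under eq_fun do rewrite big_nil; rewrite big_nil; exact: cder_cst.
under eq_fun do rewrite big_cons; rewrite big_cons; apply: cderD.
  by apply: h; rewrite mem_head.
by apply: IH => j js; apply: h; rewrite in_cons js orbT.
Qed.
Lemma cder_uniq f d e : cder f d -> cder f e -> d = e.
Proof.
move=> [f1 f2] [g1 g2]; apply: Cext.
  by rewrite -(@derive_val _ _ _ _ _ _ _ f1) -(@derive_val _ _ _ _ _ _ _ g1).
by rewrite -(@derive_val _ _ _ _ _ _ _ f2) -(@derive_val _ _ _ _ _ _ _ g2).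
Qed.
Lemma cder_real (a : R -> R) a' : is_derive (0 : R) 1 (a : R -> R^o) a' ->
  cder (fun t => (a t)%:C) a'%:C.
Proof. by split=> //=; apply: is_derive_cst. Qed.
Lemma cder_eic (a : R -> R) a' (d : R) : is_derive (0 : R) 1 (a : R -> R^o) a' -> a 0 = 0 ->
  cder (fun t => eic (d * a t)) (Complex 0 (d * a')).
Proof.
move=> ha a0.
have hda : is_derive (0 : R) 1 (fun t => d * a t : R^o) (d * a').
  apply: (is_derive_eq (is_deriveM (is_derive_cst d _ _) ha)).
  by rewrite /GRing.scale /= mulr0 addr0.
split=> /=.
  apply: (is_derive_eq (@is_derive1_comp _ (cos : R -> R^o) (fun t => d * a t) _ _ _ (is_derive_cos _) hda)).
  by rewrite a0 mulr0 sin0 oppr0 mul0r.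
apply: (is_derive_eq (@is_derive1_comp _ (sin : R -> R^o) (fun t => d * a t) _ _ _ (is_derive_sin _) hda)).
by rewrite a0 mulr0 cos0 mul1r.
Qed.

Lemma mder_cst m n (A : 'M[C]_(m, n)) : mder (fun=> A) 0.
Proof. by move=> i j; rewrite mxE; exact: cder_cst. Qed.
Lemma mderD m n (F G : R -> 'M[C]_(m, n)) D E : mder F D -> mder G E ->
  mder (fun t => F t + G t) (D + E).
Proof.
by move=> h1 h2 i j; rewrite mxE; under eq_fun do rewrite mxE; exact: cderD.
Qed.
Lemma mderM m n p (F : R -> 'M[C]_(m, n)) (G : R -> 'M[C]_(n, p)) D E :
  mder F D -> mder G E ->
  mder (fun t => F t *m G t) (D *m G 0 + F 0 *m E).
Proof.
move=> h1 h2 i j; rewrite !mxE -big_split /=; under eq_fun do rewrite mxE.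
by apply: cder_sum => l _; exact: cderM.
Qed.
Lemma mder_mulc m n p q (A : 'M[C]_(m, n)) (B : 'M[C]_(p, q)) F D : mder F D ->
  mder (fun t => A *m F t *m B) (A *m D *m B).
Proof.
move=> h; have := mderM (mderM (mder_cst A) h) (mder_cst B).
by rewrite mul0mx add0r mulmx0 addr0.
Qed.
Lemma mder_conj m (F G : R -> 'M[C]_m) (X D E : 'M[C]_m) : F 0 = 1%:M -> G 0 = 1%:M ->
  mder F D -> mder G E -> mder (fun t => F t *m X *m G t) (D *m X + X *m E).
Proof.
move=> F0 G0 dF dG; have := mderM (mderM dF (mder_cst X)) dG.
by rewrite F0 G0 mulmx0 addr0 mulmx1 mul1mx.
Qed.
Lemma mder_scale m n (f : R -> C) d (A : 'M[C]_(m, n)) : cder f d ->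
  mder (fun t => f t *: A) (d *: A).
Proof.
move=> h i j; rewrite mxE; under eq_fun do rewrite mxE.
by have := cderM h (cder_cst (A i j)); rewrite mulr0 addr0.
Qed.
Lemma mder_uniq m n (F : R -> 'M[C]_(m, n)) D E : mder F D -> mder F E -> D = E.
Proof. by move=> h1 h2; apply/matrixP => i j; exact: cder_uniq (h1 i j) (h2 i j). Qed.

Definition gen k (W : 'M[C]_k) (d : 'I_k -> R) : 'M[C]_k := fc W (fun j => (d j)%:C).
Local Notation iC := (Complex 0 1 : C).

(** The reparametrization [a] is general because the Euler angles depend on the curve parameter
    through arctangents. *)
Lemma mder_flow k (W : 'M[C]_k) d (a : R -> R) a' :
  is_derive (0 : R) 1 (a : R -> R^o) a' -> a 0 = 0 ->
  mder (fun t => flow W d (a t)) (Complex 0 a' *: gen W d).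
Proof.
move=> ha a0; rewrite /gen fc_scale; apply: mder_mulc => i j.
rewrite !mxE; under eq_fun do rewrite !mxE.
case: eqP => _; rewrite ?mulr1n ?mulr0n; last exact: cder_cst.
rewrite (_ : _ * _ = Complex 0 (d i * a')); last by apply: Cext; rewrite !ReImE /=; ring.
exact: cder_eic.
Qed.

Lemma is_derive_id0 : is_derive (0 : R) 1 (fun t : R => t : R^o) 1.
Proof. exact: is_derive_id. Qed.

Lemma gen_conj_der k (W : 'M[C]_k) d (X : 'M[C]_k) : unitary W ->
  mder (fun t => flow W d t *m X *m flow W d (- t)) (iC *: (gen W d *m X - X *m gen W d)).
Proof.
move=> hW; have h1 := @mder_flow _ W d id 1 is_derive_id0 erefl.
have hN : is_derive (0 : R) 1 (fun t : R => - t : R^o) (- 1).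
  by have := is_deriveN is_derive_id0.
have h2 := @mder_flow _ W d (fun t => - t) (- 1) hN (oppr0 _).
have G0 : flow W d (- 0) = 1%:M by rewrite oppr0 flow0.
have := mder_conj X (flow0 d hW) G0 h1 h2.
congr mder; rewrite -scalemxAl -scalemxAr scalerBr; congr (_ + _).
by rewrite -scaleNr; congr (_ *: _); apply: Cext; rewrite /= ?oppr0.
Qed.

(** Conditions that place every [rot P a] in SU. *)
Definition good m (P : 'M[C]_m) : Prop := [/\ P *m P = 1%:M, adjm P = P & \tr P = 0].

Lemma good_SU m (P : 'M[C]_m) a : good P -> SU m (rot P a).
Proof. by move=> [h1 h2 h3]; exact: rot_SU. Qed.

(** * Generators of a unitary representation along rotations *)

Section Rep.
Variables (m k : nat) (rho : 'M[C]_m -> 'M[C]_k).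
Hypothesis hrep : unitary_rep rho.

Lemma rep_mul U V : SU m U -> SU m V -> rho (U *m V) = rho U *m rho V.
Proof. by case: hrep => h _ _; exact: h. Qed.
Lemma rep_unitary U : SU m U -> unitary (rho U).
Proof. by case: hrep => _ h _; exact: h. Qed.
Lemma rep1 : rho 1%:M = 1%:M.
Proof.
have := rep_mul (SU1 R m) (SU1 R m); rewrite mulmx1 => /(congr1 (mulmx (adjm (rho 1%:M)))).
by rewrite mulmxA !unitaryK ?mul1mx //; apply: rep_unitary; exact: SU1.
Qed.

(** Along the rotations about P, [rho] is a continuous unitary one-parameter group, so [opg_flow]
    yields the spectral data of M_P. The half angle matches the normalisation of theta. *)
Lemma rep_flow P : good P -> exists W d, unitary W /\
  forall t, rho (rot P (t / 2)) = flow W d t.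
Proof.
move=> gP; have [PP Pa _] := gP; apply: opg_flow => [s t|t|e e0].
- by rewrite mulrDl rotD // rep_mul //; exact: good_SU.
- by apply: rep_unitary; exact: good_SU.
case: hrep => _ _ /(_ 1%:M e (SU1 R m) e0) [del del0 h].
have [W [d [hW _ _ hf]]] := rot_flow PP Pa.
have [del2 del20 h2] := flow_cont0 d hW del0.
exists del2 => // t ht; rewrite -[X in _ - X]rep1; apply: h; first exact: good_SU.
rewrite hf; apply: h2; rewrite normrM; apply: le_lt_trans ht.
by rewrite ler_piMr // ger0_norm //; lra.
Qed.

Variables (Q P S : 'M[C]_m) (del : R).
Hypotheses (gQ : good Q) (gP : good P) (gS : good S) (del2 : del ^+ 2 = 1).
Variables (WQ WP WS : 'M[C]_k) (dQ dP dS : 'I_k -> R).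
Hypotheses (hQ : unitary WQ /\ forall t, rho (rot Q (t / 2)) = flow WQ dQ t).
Hypotheses (hP : unitary WP /\ forall t, rho (rot P (t / 2)) = flow WP dP t).
Hypotheses (hS : unitary WS /\ forall t, rho (rot S (t / 2)) = flow WS dS t).

(** Conjugating P by e^{i th Q/2} gives the involution cos th P + sin th S' with S' = iQP = -del S,
    and [euler] writes its rotations through those about P and S. Applying [rho] and differentiating
    at tau = 0 turns this group identity into the adjoint action on generators. *)
Lemma gen_rotate th : Q *m P = Complex 0 del *: S ->
  flow WQ dQ th *m gen WP dP *m flow WQ dQ (- th) =
  (cos th)%:C *: gen WP dP - (del * sin th)%:C *: gen WS dS.
Proof.
move=> QP; have [QQ Qa tQ] := gQ; have [PP Pa tP] := gP; have [SS Sa tS] := gS.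
have PQ : P *m Q = - (Q *m P).
  have /(congr1 (@adjm R _ _)) := QP; rewrite adjmM adjmZ Qa Pa Sa QP => ->.
  by rewrite -scaleNr; congr (_ *: _); apply: Cext; rewrite /= ?oppr0.
pose S' := - (del%:C *: S).
have dC : del%:C * del%:C = 1 by rewrite -rmorphM -expr2 del2.
have S'S' : S' *m S' = 1%:M.
  by rewrite /S' mulmxN mulNmx opprK -scalemxAl -scalemxAr SS scalerA dC scale1r.
have iQP : Complex 0 1 *: (Q *m P) = S'.
  by rewrite QP scalerA /S' -scaleNr; congr (_ *: _); apply: Cext; rewrite !ReImE /=; ring.
have PS' : P *m S' = - (S' *m P).
  rewrite -iQP -scalemxAr -scalemxAl -scalerN mulmxA PQ mulNmx -mulmxA.
  by [].
have conjP : rot Q (th / 2) *m P *m adjm (rot Q (th / 2)) = (cos th)%:C *: P + (sin th)%:C *: S'.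
  have aR : adjm (rot Q (th / 2)) = rot Q (- (th / 2)).
    have h : rot Q (th / 2) *m rot Q (- (th / 2)) = 1%:M by rewrite -rotD // subrr rot0.
    by rewrite -[RHS]mul1mx -(unitaryK (rot_unitary QQ Qa (th / 2))) -mulmxA h mulmx1.
  rewrite aR.
  have comm : rot Q (th / 2) *m P = P *m rot Q (- (th / 2)).
    rewrite /rot cosN sinN mulmxDr mulmxDl -!scalemxAr -!scalemxAl mulmx1 mul1mx PQ scalerN -scaleNr.
    by congr (_ + _ *: _); apply: Cext; rewrite /= ?oppr0 ?opprK.
  rewrite comm -mulmxA -rotD // -opprD -splitr /rot cosN sinN mulmxDr -!scalemxAr mulmx1.
  by rewrite PQ -iQP scalerN -scaleNr scalerA; congr (_ + _ *: _); apply: Cext; rewrite !ReImE /=; ring.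
have urQ a : unitary (rot Q a) by exact: rot_unitary.
have key tau : flow WQ dQ th *m flow WP dP (2 * atan tau) *m flow WQ dQ (- th) =
   flow WP dP (atan (tau * cos th)) *m
   flow WS dS (- (2 * del * atan (tau * sin th / Num.sqrt (1 + (tau * cos th) ^+ 2)))) *m
   flow WP dP (atan (tau * cos th)).
  have [uQ fQ] := hQ; have [uP fP] := hP; have [uS fS] := hS.
  set al := atan (tau * cos th); set be := atan (tau * sin th / _).
  (* S' is S or -S according to [del]; the factor 2 undoes the half angle in [hS]. *)
  have eS : rot S' be = rot S ((- (2 * del * be)) / 2).
    rewrite (_ : - (2 * del * be) / 2 = - (del * be)); last by field.
    rewrite /rot cosN sinN /S' scalerN scalerA -scaleNr.
    move/eqP: del2; rewrite sqrf_eq1 => /orP[] /eqP ->;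
      rewrite ?mul1r ?mulN1r ?cosN ?sinN; congr (_ + _ *: _); apply: Cext; rewrite !ReImE /=; ring.
  have aQ : flow WQ dQ (- th) = rho (adjm (rot Q (th / 2))).
    rewrite -fQ mulNr; congr rho.
    have h : rot Q (th / 2) *m rot Q (- (th / 2)) = 1%:M by rewrite -rotD // subrr rot0.
    by rewrite -[LHS]mul1mx -(unitaryK (urQ (th / 2))) -mulmxA h mulmx1.
  rewrite aQ -fQ -!fP -fS -eS -!rep_mul;
    try by [exact: good_SU | apply: SU_adj; exact: good_SU | apply: SUM; exact: good_SU
            | rewrite eS; apply: good_SU | apply: SUM; [exact: good_SU| rewrite eS; exact: good_SU]].
  congr rho; rewrite -(euler th tau PP S'S' PS') (_ : 2 * atan tau / 2 = atan tau); last by field.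
  exact: rot_conj.
have [uQ fQ] := hQ; have [uP fP] := hP; have [uS fS] := hS.
have d1 : mder (fun tau => flow WQ dQ th *m flow WP dP (2 * atan tau) *m flow WQ dQ (- th))
    (flow WQ dQ th *m (Complex 0 2 *: gen WP dP) *m flow WQ dQ (- th)).
  apply: mder_mulc; apply: mder_flow; last by rewrite atan0 mulr0.
  apply: (is_derive_eq (is_deriveM (is_derive_cst (2 : R) _ _) (is_derive1_atan _))).
  by rewrite /GRing.scale /= expr0n /= addr0 invr1; ring.
have dat (c : R) : is_derive (0 : R) 1 (fun tau : R => atan (tau * c) : R^o) c.
  have h : is_derive (0 : R) 1 (fun tau : R => tau * c : R^o) c.
    apply: (is_derive_eq (is_deriveM is_derive_id0 (is_derive_cst c _ _))).
    by rewrite /GRing.scale /= mul0r add0r mulr1.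
  apply: (is_derive_eq (@is_derive1_comp _ atan (fun t => t * c) _ _ _ (is_derive1_atan _) h)).
  by rewrite mul0r expr0n /= addr0 invr1 mul1r.
have dbe : is_derive (0 : R) 1
    (fun tau : R => - (2 * del * atan (tau * sin th / Num.sqrt (1 + (tau * cos th) ^+ 2))) : R^o)
    (- (2 * del * sin th)).
  have h1 (c : R) : is_derive (0 : R) 1 (fun tau : R => tau * c : R^o) c.
    apply: (is_derive_eq (is_deriveM is_derive_id0 (is_derive_cst c _ _))).
    by rewrite /GRing.scale /= mul0r add0r mulr1.
  (* The radicand 1 + (tau cos th)^2 is stationary at 0, so the denominator contributes nothing to
     the derivative. *)
  have h2 : is_derive (0 : R) 1 (fun tau : R => 1 + (tau * cos th) * (tau * cos th) : R^o) 0.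
    apply: (is_derive_eq (is_deriveD (is_derive_cst (1 : R) _ _) (is_deriveM (h1 (cos th)) (h1 (cos th))))).
    by rewrite /GRing.scale /= !mul0r !addr0.
  have h3 : is_derive (0 : R) 1 (fun tau : R => (Num.sqrt (1 + (tau * cos th) * (tau * cos th)))^-1 : R^o) 0.
    have hs : is_derive (0 : R) 1 (fun tau : R => Num.sqrt (1 + (tau * cos th) * (tau * cos th)) : R^o) 0.
      have p : 0 < 1 + (0 * cos th) * (0 * cos th) by rewrite !mul0r addr0.
      apply: (is_derive_eq (@is_derive1_comp _ Num.sqrt (fun tau : R => 1 + (tau * cos th) * (tau * cos th)) 0 _ _ (is_derive1_sqrt p) h2)).
      by rewrite mulr0.
    have nz : Num.sqrt (1 + (0 * cos th) * (0 * cos th)) != 0 by rewrite !mul0r addr0 sqrtr1 oner_neq0.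
    have hv := @is_deriveV _ (fun tau : R => Num.sqrt (1 + (tau * cos th) * (tau * cos th))) 0 _ 1 nz hs.
    by apply: (is_derive_eq hv); rewrite scaler0.
  have h4 : is_derive (0 : R) 1 (fun tau : R => tau * sin th / Num.sqrt (1 + (tau * cos th) ^+ 2) : R^o) (sin th).
    apply: (is_derive_eq (is_deriveM (h1 (sin th)) h3)).
    by rewrite /GRing.scale /= !mul0r addr0 sqrtr1 invr1 mul1r add0r.
  have h5 := @is_derive1_comp _ atan (fun tau : R => tau * sin th / Num.sqrt (1 + (tau * cos th) ^+ 2)) 0 _ _ (is_derive1_atan _) h4.
  apply: (is_derive_eq (is_deriveN (is_deriveM (is_derive_cst (2 * del) _ _) h5))).
  by rewrite /GRing.scale /= !mul0r expr0n /= addr0 invr1 mul1r mulr0 addr0.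
have b0 : - (2 * del * atan (0 * sin th / Num.sqrt (1 + (0 * cos th) ^+ 2))) = 0.
  by rewrite !mul0r atan0 mulr0 oppr0.
have a0 : atan (0 * cos th) = 0 by rewrite mul0r atan0.
have d2 := mderM (mderM (@mder_flow _ WP dP _ _ (dat (cos th)) a0) (@mder_flow _ WS dS _ _ dbe b0))
  (@mder_flow _ WP dP _ _ (dat (cos th)) a0).
have := mder_uniq d1; under eq_fun do rewrite key.
move=> /(_ _ d2); rewrite a0 b0 !flow0 // !mulmx1 !mul1mx.
rewrite -scalemxAr -scalemxAl => e.
have := congr1 (fun X => Complex 0 (- (2^-1)) *: X) e.
rewrite scalerA (_ : _ * _ = 1) ?scale1r; last by apply: Cext; rewrite !ReImE /=; field.
move=> ->; rewrite addrAC -scalerDl scalerDr !scalerA -[- (_ *: gen WS dS)]scaleNr.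
by congr (_ *: _ + _ *: _); apply: Cext; rewrite !ReImE /=; field.
Qed.

(** The derivative of [gen_rotate] at th = 0 reads i[M_Q, M_P] = -del M_S. *)
Lemma gen_commutator : Q *m P = Complex 0 del *: S ->
  gen WQ dQ *m gen WP dP - gen WP dP *m gen WQ dQ = Complex 0 del *: gen WS dS.
Proof.
move=> QP; have [uQ _] := hQ.
have d1 := gen_conj_der dQ (gen WP dP) uQ.
have d2 : mder (fun th => (cos th)%:C *: gen WP dP + (- (del * sin th))%:C *: gen WS dS)
   (0 *: gen WP dP + (- del)%:C *: gen WS dS).
  apply: mderD; apply: mder_scale; apply: cder_real.
    by apply: (is_derive_eq (is_derive_cos _)); rewrite sin0 oppr0.
  apply: (is_derive_eq (is_deriveN (is_deriveM (is_derive_cst del _ _) (is_derive_sin _)))).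
  by rewrite /GRing.scale /= cos0 mulr0 addr0 mulr1.
have e : (fun th => flow WQ dQ th *m gen WP dP *m flow WQ dQ (- th)) =
   (fun th => (cos th)%:C *: gen WP dP + (- (del * sin th))%:C *: gen WS dS).
  by apply/funext => th; rewrite gen_rotate // rmorphN scaleNr.
rewrite e in d1; have := mder_uniq d1 d2; rewrite scale0r add0r.
move/(congr1 (fun X => Complex 0 (- 1) *: X)); rewrite !scalerA.
rewrite (_ : _ * _ = 1) ?scale1r; last by apply: Cext; rewrite !ReImE /=; ring.
by move=> ->; congr (_ *: _); apply: Cext; rewrite !ReImE /=; ring.
Qed.

(** The flows commute because the rotations do; differentiating in one parameter at a time passes
    this to the generators. *)
Lemma gen_commute : Q *m P = P *m Q ->
  gen WQ dQ *m gen WP dP = gen WP dP *m gen WQ dQ.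
Proof.
move=> QP; have [uQ fQ] := hQ; have [uP fP] := hP.
have c s t : flow WQ dQ s *m flow WP dP t = flow WP dP t *m flow WQ dQ s.
  rewrite -fQ -fP -!rep_mul; try exact: good_SU; congr rho.
  have cr (A X : 'M[C]_m) a : A *m X = X *m A -> rot A a *m X = X *m rot A a.
    by move=> AX; rewrite /rot mulmxDr mulmxDl -!scalemxAr -!scalemxAl mulmx1 mul1mx AX.
  by apply: (cr Q); apply/esym; apply: cr.
have h1 := @mder_flow _ WP dP id 1 is_derive_id0 erefl.
have c2 s : flow WQ dQ s *m gen WP dP = gen WP dP *m flow WQ dQ s.
  have := mder_uniq (mder_mulc (flow WQ dQ s) 1%:M h1).
  under eq_fun do rewrite mulmx1 c.
  have := mder_mulc 1%:M (flow WQ dQ s) h1.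
  under eq_fun do rewrite mul1mx.
  move=> h /(_ _ h); rewrite mulmx1 mul1mx -scalemxAr -scalemxAl.
  by apply: scalerI; apply/eqP => -[] /eqP; rewrite oner_eq0.
have h2 := @mder_flow _ WQ dQ id 1 is_derive_id0 erefl.
have := mder_uniq (mder_mulc 1%:M (gen WP dP) h2).
under eq_fun do rewrite mul1mx c2.
have := mder_mulc (gen WP dP) 1%:M h2.
under eq_fun do rewrite mulmx1.
move=> h /(_ _ h); rewrite mulmx1 mul1mx -scalemxAr -scalemxAl.
by apply: scalerI; apply/eqP => -[] /eqP; rewrite oner_eq0.
Qed.
End Rep.
End Derivatives.

(** * Pauli rotations generate SU *)

Section Generation.
Variable R : realType.
Local Notation C := R[i].
Local Notation "x %:C" := (real_complex R x) (format "x %:C").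
Local Notation Re := (@complex.Re R).
Local Notation Im := (@complex.Im R).

Lemma der0_small (f : R -> R) : is_derive (0 : R) 1 (f : R -> R^o) 0 -> f 0 = 0 ->
  forall e : R, 0 < e -> \forall s \near (0 : R), `|f s| <= e * `|s|.
Proof.
move=> [df dv] f0 e e0.
have cv : h^-1 *: (((f : R -> R^o) \o shift 0) (h *: 1) - f 0) @[h --> (0 : R)^'] --> (0 : R^o).
  by rewrite -[X in _ --> X]dv; exact: df.
have /cvgrPdist_le /(_ e e0) := cv.
rewrite near_withinE; apply: filterS => s /= hs.
have [->|s0] := eqVneq s 0; first by rewrite f0 normr0 mulr0.
have := hs s0; rewrite sub0r normrN /GRing.scale /= mulr1 addr0 f0 subr0 normrM normfV.
by rewrite mulrC ler_pdivrMr ?normr_gt0.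
Qed.

Lemma mder_small m n (F : R -> 'M[C]_(m, n)) : mder F 0 -> F 0 = 0 ->
  forall e : R, 0 < e -> \forall s \near (0 : R), fnorm (F s) <= e * `|s|.
Proof.
(* The error e is shared among the 2mn real and imaginary parts; the summand 1 keeps K positive for
   an empty matrix. *)
move=> dF F0 e e0; pose K : R := (1 + (m * n)%:R * 2); have K0 : 0 < K by rewrite ltr_pwDl // mulr_ge0.
have e1 : 0 < e / K by rewrite divr_gt0.
have h : \forall s \near (0 : R), forall ij : 'I_m * 'I_n,
    `|Re (F s ij.1 ij.2)| <= e / K * `|s| /\ `|Im (F s ij.1 ij.2)| <= e / K * `|s|.
  have hh (ij : 'I_m * 'I_n) : \forall s \near (0 : R),
    `|Re (F s ij.1 ij.2)| <= e / K * `|s| /\ `|Im (F s ij.1 ij.2)| <= e / K * `|s|; last first.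
    exact: (filter_forall _ hh).
  case: ij => i j /=; have [d1 d2] := dF i j.
  rewrite mxE /= in d1 d2.
  have f1 : Re (F 0 i j) = 0 by rewrite F0 mxE.
  have f2 : Im (F 0 i j) = 0 by rewrite F0 mxE.
  by apply: filterS2 (der0_small d1 f1 e1) (der0_small d2 f2 e1) => s.
near=> s; apply: le_trans (fnorm_le_entries _) _.
have hs : forall ij : 'I_m * 'I_n, `|Re (F s ij.1 ij.2)| <= e / K * `|s| /\ `|Im (F s ij.1 ij.2)| <= e / K * `|s|.
  by near: s.
apply: (@le_trans _ _ (\sum_(i < m) \sum_(j < n) (2 * (e / K * `|s|)))).
  apply: ler_sum => i _; apply: ler_sum => j _; have := hs (i, j) => /= -[? ?]; lra.
rewrite !sumr_const !card_ord -mulrnA -[X in X <= _]mulr_natr.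
have -> : 2 * (e / K * `|s|) * (n * m)%:R = (e * `|s|) * ((m * n)%:R * 2 / K) by rewrite mulnC; field; rewrite gt_eqF.
rewrite ler_piMr ?mulr_ge0 ?(ltW e0) // ler_pdivrMr // mul1r /K; lra.
Unshelve. all: by end_near. Qed.

(** * Trotter products of Pauli rotations *)

Section Words.
Variable n : nat.

Lemma pauli_good (w : n.-tuple 'I_4) : w \in nontriv_pauli R n -> good (pauli w : 'M[C]_(2 ^ n)).
Proof.
move=> hw; split; [exact: pauli_sqr | exact: pauli_adj |].
by rewrite pauli_tr; move: hw; rewrite nontrivE => /negbTE ->.
Qed.

Lemma mder_rot m (P : 'M[C]_m) (h : R) : P *m P = 1%:M -> adjm P = P ->
  mder (fun s => rot P (h * s)) (Complex 0 h *: P).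
Proof.
move=> PP Pa; have [W [d [hW _ eP ef]]] := rot_flow PP Pa.
under eq_fun do rewrite ef; rewrite [X in _ *: X]eP.
apply: mder_flow; last by rewrite mulr0.
apply: (is_derive_eq (is_deriveM (is_derive_cst (h : R) _ _) (is_derive_id0 R))).
by rewrite /GRing.scale /= mul0r addr0 mulr1.
Qed.

(** One Trotter step: the ordered product of the e^{i t h_w P_w}. *)
Definition rots (h : n.-tuple 'I_4 -> R) (s : seq (n.-tuple 'I_4)) (t : R) : 'M[C]_(2 ^ n) :=
  foldr (fun w A => rot (pauli w) (h w * t) *m A) 1%:M s.

Lemma rots0 h s : rots h s 0 = 1%:M.
Proof.
elim: s => //= w s ->; rewrite mulr0 rot0 ?mulmx1 //; [exact: pauli_sqr|exact: pauli_adj].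
Qed.
Lemma mder_rots h s :
  mder (rots h s) (\sum_(w <- s) Complex 0 (h w) *: pauli w).
Proof.
elim: s => [|w s IH]; first by rewrite big_nil; exact: mder_cst.
rewrite big_cons; have := mderM (mder_rot (h w) (pauli_sqr R w) (pauli_adj R w)) IH.
by rewrite rots0 mulmx1 mulr0 rot0 ?mul1mx //; [exact: pauli_sqr|exact: pauli_adj].
Qed.

(** The coefficients tr(P_w H) / 2^n are real for Hermitian H, and the one of the identity word
    vanishes with the trace. *)
Lemma herm_pauli (H : 'M[C]_(2 ^ n)) : adjm H = H -> \tr H = 0 ->
  exists h : n.-tuple 'I_4 -> R, H = \sum_(w <- enum (nontriv_pauli R n)) (h w)%:C *: pauli w.
Proof.
move=> Ha tH; exists (fun w => Re (((2 ^ n)%:R)^-1 * \tr (pauli w *m H))).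
rewrite {1}[H]pauli_span scaler_sumr big_enum /= [LHS](bigID (mem (nontriv_pauli R n))) /=.
rewrite [X in _ + X]big1 ?addr0 => [|w].
  apply: eq_bigr => w _; rewrite scalerA; congr (_ *: _).
  apply: Cext => //=.
  have hr : conjc (\tr (pauli w *m H)) = \tr (pauli w *m H).
    rewrite -{1}(pauli_adj R w) -{1}Ha -adjmM mxtrace_mulC.
    by rewrite /mxtrace rmorph_sum; apply: eq_bigr => i _; rewrite adjmE /= conjcK.
  have : conjc (((2 ^ n)%:R)^-1 * \tr (pauli w *m H)) = ((2 ^ n)%:R)^-1 * \tr (pauli w *m H).
    by rewrite rmorphM /= hr conjc_inv conjc_nat.
  by move/(congr1 Im); rewrite Im_conj => ?; lra.
by rewrite nontrivE negbK => /eqP ->; rewrite pauli_word0 mul1mx tH scale0r scaler0.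
Qed.

Lemma SU_flow (U : 'M[C]_(2 ^ n)) : SU _ U ->
  exists W d, [/\ unitary W, \sum_j d j = 0 & U = flow W d 1].
Proof.
move=> [uU dU]; have [W [f [hW eU f1]]] := unitary_spectral uU.
have /boolp.choice [a ha] (j : 'I_(2 ^ n)) : exists x : R, f j = eic x by exact: eic_surj.
have N0 : (0 < 2 ^ n)%N by rewrite expn_gt0.
pose j0 := Ordinal N0.
(* det U = 1 makes the eigenvalue angles sum to 0 modulo 2 pi; changing one of them makes the sum
   exactly 0, so that the generator is traceless. *)
pose d j := if j == j0 then - \sum_(i | i != j0) a i else a j.
have ds : \sum_j d j = 0.
  rewrite (bigD1 j0) //= {1}/d eqxx addrC.
  by rewrite (eq_bigr a) ?subrr // => i /negbTE; rewrite /d => ->.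
exists W, d; split=> //; rewrite eU; apply: eq_fc => j; rewrite mulr1 /d.
case: eqP => [->|_]; last exact: ha.
have : \prod_j f j = 1 by rewrite -(det_fc f hW) -eU.
rewrite (bigD1 j0) //= (eq_bigr _ (fun i _ => ha i)) -eic_sum => h.
have := congr1 (fun z => z * eic (- \sum_(i | i != j0) a i)) h.
by rewrite mul1r -mulrA -eicD subrr eic0 mulr1.
Qed.

Section Fixed.
Variables (k : nat) (rho : 'M[C]_(2 ^ n) -> 'M[C]_k).
Hypothesis hrep : unitary_rep rho.
Variable v : 'cV[C]_k.
Hypothesis hv : forall w, w \in nontriv_pauli R n -> forall t, rho (rot (pauli w) t) *m v = v.

(* Trotter: if H = sum_w h_w P_w then (prod_w e^{i h_w P_w / m})^m --> e^{iH}. *)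
Lemma fixed_SU U : SU _ U -> rho U *m v = v.
Proof.
move=> hU; have [W [d [hW ds eU]]] := SU_flow hU.
have Ha : adjm (gen W d) = gen W d.
  by rewrite /gen fc_adj; apply: eq_fc => j; rewrite conjc_real.
have tH : \tr (gen W d) = 0 by rewrite tr_fc // -rmorph_sum ds.
have [h eH] := herm_pauli Ha tH.
pose s := enum (nontriv_pauli R n); pose c := rots h s.
have cS t : SU _ (c t) /\ rho (c t) *m v = v.
  rewrite /c; have : {subset s <= nontriv_pauli R n} by move=> w; rewrite mem_enum.
  elim: (s) => [_|w s' IH sub] /=; first by split; [exact: SU1 | rewrite (rep1 hrep) mul1mx].
  have [|i1 i2] := IH; first by move=> x xs; apply: sub; rewrite in_cons xs orbT.
  have wn : w \in nontriv_pauli R n by apply: sub; rewrite mem_head.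
  have gw := good_SU (h w * t) (pauli_good wn).
  split; first exact: SUM.
  by rewrite (rep_mul hrep) // -mulmxA i2 hv.
have cSX t m : SU _ (c t ^+ m) /\ rho (c t ^+ m) *m v = v.
  elim: m => [|m [i1 i2]]; first by split; [exact: SU1 | rewrite (rep1 hrep) mul1mx].
  have [j1 j2] := cS t; rewrite exprS; split; first exact: SUM.
  by rewrite (rep_mul hrep) // -mulmxA i2.
(* The Trotter step and e^{itH} agree to first order at 0. *)
have dF : mder (fun t => c t + (-1 : C) *: flow W d t) 0.
  have d1 := mder_rots h s.
  have d2 := @mder_flow _ _ W d id 1 (is_derive_id0 R) erefl.
  have d3 := mder_mulc ((-1 : C)%:M) 1%:M d2.
  have : mder (fun t => c t + (-1)%:M *m flow W d t *m 1%:M)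
    (\sum_(w <- s) Complex 0 (h w) *: pauli w + (-1)%:M *m (Complex 0 1 *: gen W d) *m 1%:M).
    exact: mderD.
  under eq_fun do rewrite mulmx1 mul_scalar_mx.
  rewrite mulmx1 mul_scalar_mx (_ : _ + _ = 0) // eH -/s scaleN1r scaler_sumr -sumrB big1 // => w _.
  by rewrite scalerA (_ : _ * _ = Complex 0 (h w)) ?subrr //; apply: Cext; rewrite !ReImE /=; ring.
have F0 : c 0 + (-1 : C) *: flow W d 0 = 0 by rewrite /c rots0 flow0 // scaleN1r subrr.
have small := mder_small dF F0.
(* m steps of length 1 / m, each with error at most e / m. *)
have close (e : R) : 0 < e -> exists p q, fnorm (c p ^+ q - U) <= e.
  move=> e0; have /nbhs_ballP [del /= del0 hdel] := small e e0.
  pose m := (Num.truncn del^-1).+1; have m0 : 0 < (m%:R : R) by rewrite ltr0n.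
  exists (m%:R^-1), m.
  have hm : `|(m%:R^-1 : R)| < del.
    rewrite ger0_norm ?invr_ge0 ?(ltW m0) // invf_plt ?posrE //; exact: truncnS_gt.
  have := hdel (m%:R^-1); rewrite /ball /= sub0r normrN => /(_ hm).
  rewrite scaleN1r => hh.
  have eU2 : U = flow W d (m%:R^-1) ^+ m.
    by rewrite -flow_mulrn // -[_ *+ m]mulr_natr mulVf ?gt_eqF.
  rewrite eU2; apply: le_trans (fnorm_pow_diff _ _ _) _.
  - by have [[]] := cS (m%:R^-1).
  - exact: flow_unitary.
  rewrite -[X in X <= _]mulr_natr; apply: le_trans (ler_wpM2r (ltW m0) hh) _.
  by rewrite ger0_norm ?invr_ge0 ?(ltW m0) // divfK ?gt_eqF.
apply/eqP; rewrite -subr_eq0; apply/eqP/fnorm_eq0/eqP; rewrite eq_le fnorm_ge0 andbT.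
apply/ler_addgt0Pl => e e0; rewrite addr0.
have e1 : 0 < e / (1 + fnorm v) by rewrite divr_gt0 // ltr_pwDl ?fnorm_ge0.
case: (hrep) => _ _ /(_ U _ hU e1) [del del0 hdel].
have del20 : 0 < del / 2 by rewrite divr_gt0.
have [p [q hpq]] := close _ del20.
have [X1 X2] := cSX p q.
have hlt : fnorm (c p ^+ q - U) < del by apply: le_lt_trans hpq _; lra.
have := hdel _ X1 hlt => hr.
rewrite -{2}X2 -mulmxBl; apply: le_trans (fnorm_mulv _ _) _.
rewrite fnormBC; apply: le_trans (ler_wpM2r (fnorm_ge0 _) (ltW hr)) _.
rewrite mulrAC ler_pdivrMr ?ltr_pwDl ?fnorm_ge0 // ler_pM2l //; lra.
Qed.
End Fixed.
End Words.
End Generation.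

(** * The Casimir operator and the spectral gap *)

Section Gap.
Variable R : realType.
Local Notation C := R[i].
Local Notation "x %:C" := (real_complex R x) (format "x %:C").
Local Notation Re := (@complex.Re R).
Local Notation Im := (@complex.Im R).

Lemma panti_xorE n (q p : n.-tuple 'I_4) : panti R q (wxor q p) = panti R q p.
Proof.
by apply/idP/idP => [/panti_xor|/panti_xor //]; rewrite wxorK.
Qed.
(** [wxor q] is an involution on the words that anticommute with q; it pairs each of them with the
    third member of its su(2) triple. *)
Lemma sum_panti n (V : zmodType) (q : n.-tuple 'I_4) (F : n.-tuple 'I_4 -> V) :
  \sum_(p | panti R q p) F (wxor q p) = \sum_(p | panti R q p) F p.
Proof.
rewrite [RHS](reindex_onto (wxor q) (wxor q)) => [|p _]; last exact: wxorK.
by apply: eq_bigl => p; rewrite panti_xorE wxorK eqxx andbT.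
Qed.

(** On an eigenvector with d j nonzero the flow at time pi / d j is -1, so invariance kills that
    column of [X *m adjm W]. *)
Lemma fc_inv_proj k l (W : 'M[C]_k) (d : 'I_k -> R) (X : 'M[C]_(l, k)) : unitary W ->
  (forall t, X *m flow W d t = X) -> X *m fc W (fun j => (d j == 0)%:R) = X.
Proof.
move=> hW h; pose Y := X *m adjm W.
have hY i j : d j != 0 -> Y i j = 0.
  move=> dj; have /(congr1 (fun Z => (Z *m adjm W) i j)) := h (pi / d j).
  rewrite /flow /fc -!mulmxA hW mulmx1 mulmxA -/Y mul_mx_diag; clearbody Y.
  rewrite !mxE mulrC mulrCA divff // mulr1 mulrC.
  rewrite /eic cospi sinpi (_ : Complex (-1) 0 = -1); last by apply: Cext; rewrite /= ?oppr0.
  by rewrite mulrN1 => /eqP; rewrite -subr_eq0 -opprD oppr_eq0 -mulr2n mulrn_eq0 => /eqP.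
have {2}-> : X = Y *m W by rewrite /Y -mulmxA unitaryK // mulmx1.
rewrite /fc !mulmxA -/Y; congr (_ *m _); clearbody Y; apply/matrixP => i j; rewrite mul_mx_diag !mxE.
by have [_|/hY ->] := eqVneq (d j) 0; rewrite ?mulr1 ?mul0r.
Qed.

Lemma ip_self k (A : 'M[C]_k) (v : 'cV[C]_k) : adjm A = A ->
  (adjm v *m (A *m A) *m v) 0 0 = (nrm2 (A *m v))%:C.
Proof. by move=> hA; rewrite nrm2_ip adjmM hA !mulmxA. Qed.

(** Applying the opposite ladder operator P - i et S to the annihilated vector gives (P^2 + S^2 + i
    et [P, S]) v = 0, and [P, S] v = i del m0 v. *)
Lemma su2_lowest k (P S Z : 'M[C]_k) (v : 'cV[C]_k) (del m0 et s : R) :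
  adjm P = P -> adjm S = S -> P *m S - S *m P = Complex 0 del *: Z ->
  Z *m v = m0%:C *: v -> et ^+ 2 = 1 -> et * del * m0 = s ->
  P *m v + Complex 0 et *: (S *m v) = 0 ->
  nrm2 (P *m v) + nrm2 (S *m v) = s * nrm2 v.
Proof.
move=> hP hS PS hZ et2 es u0.
have ii : Complex 0 et * Complex 0 et = -1 :> C.
  by apply: Cext; rewrite !ReImE /= ?mul0r ?mulr0 ?add0r -?expr2 ?et2 ?oppr0.
have key : P *m P *m v + S *m S *m v = s%:C *: v.
  have : (P - Complex 0 et *: S) *m (P *m v + Complex 0 et *: (S *m v)) = 0 by rewrite u0 mulmx0.
  rewrite mulmxDr !mulmxBl -!scalemxAl -!scalemxAr !scalerA !mulmxA ii scaleN1r opprK.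
  have -> : P *m S = Complex 0 del *: Z + S *m P by rewrite -PS subrK.
  rewrite mulmxDl -scalemxAl hZ scalerDr !scalerA.
  rewrite (_ : _ * _ * _ = - s%:C); last by apply: Cext; rewrite !ReImE /= -?es; ring.
  set a := _ *: (S *m P *m v) => h.
  by move/eqP: h; rewrite scaleNr [- (_ *: v) + a]addrC !addrA subrK addrAC subr_eq0 => /eqP.
apply: (@complexI R); rewrite rmorphM /= nrm2_ip rmorphD /= -(ip_self v hP) -(ip_self v hS).
transitivity ((adjm v *m (P *m P *m v + S *m S *m v)) 0 0).
  by rewrite mulmxDr [RHS]mxE !mulmxA.
by rewrite key -scalemxAr mxE.
Qed.

Lemma commutator_sqr k (A B : 'M[C]_k) :
  A *m (B *m B) - (B *m B) *m A = (A *m B - B *m A) *m B + B *m (A *m B - B *m A).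
Proof. by rewrite mulmxBl mulmxBr !mulmxA addrA subrK. Qed.
(** Within a triple [Q, S^2] = -[Q, P^2]: the rotation generated by Q preserves P^2 + S^2. *)
Lemma commutator_flip k (Q P S : 'M[C]_k) (del : R) :
  Q *m P - P *m Q = Complex 0 del *: S -> Q *m S - S *m Q = Complex 0 (- del) *: P ->
  (Q *m S - S *m Q) *m S + S *m (Q *m S - S *m Q) =
  - ((Q *m P - P *m Q) *m P + P *m (Q *m P - P *m Q)).
Proof.
move=> -> ->; rewrite -!scalemxAl -!scalemxAr -!scalerDr -scaleNr [X in _ = _ *: X]addrC.
by congr (_ *: _); apply: Cext; rewrite /= ?oppr0.
Qed.
(** u is the image of v under a ladder operator of the triple; the sign [et] decides between raising
    and lowering, and [e] is the resulting shift of the weight. *)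
Lemma su2_raise k (Z P S : 'M[C]_k) (v : 'cV[C]_k) (del m0 et e : R) :
  Z *m P - P *m Z = Complex 0 del *: S -> Z *m S - S *m Z = Complex 0 (- del) *: P ->
  Z *m v = m0%:C *: v -> et * del = e -> e * et = del ->
  let u := P *m v + Complex 0 et *: (S *m v) in Z *m u = (m0 + e)%:C *: u.
Proof.
move=> ZP ZS hZ ed edel u.
have hP : Z *m (P *m v) = m0%:C *: (P *m v) + Complex 0 del *: (S *m v).
  by rewrite mulmxA -[Z *m P](subrK (P *m Z)) ZP mulmxDl -scalemxAl -mulmxA hZ -scalemxAr addrC.
have hS : Z *m (S *m v) = m0%:C *: (S *m v) + Complex 0 (- del) *: (P *m v).
  by rewrite mulmxA -[Z *m S](subrK (S *m Z)) ZS mulmxDl -scalemxAl -mulmxA hZ -scalemxAr addrC.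
rewrite /u mulmxDr -scalemxAr hP hS !scalerDr !scalerA.
rewrite [X in _ + X]addrC addrACA -!scalerDl.
by congr (_ *: _ + _ *: _); apply: Cext; rewrite !ReImE /=; lra.
Qed.

(** * The Casimir operator and its commutation with the generators *)

Section Casimir.
Variables (n k : nat) (rho : 'M[C]_(2 ^ n) -> 'M[C]_k).
Hypothesis hrep : unitary_rep rho.
Local Notation word := (n.-tuple 'I_4).
Local Notation nt := (nontriv_pauli R n).
Variables (W : word -> 'M[C]_k) (d : word -> 'I_k -> R).
Hypothesis hfl : forall w, w \in nt ->
  unitary (W w) /\ forall t, rho (rot (pauli w) (t / 2)) = flow (W w) (d w) t.

Let M w := gen (W w) (d w).
Let Pi w := fc (W w) (fun j => (d w j == 0)%:R).
Let Om := \sum_(w in nt) M w *m M w.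

Lemma M_adj w : adjm (M w) = M w.
Proof. by rewrite fc_adj; apply: eq_fc => j; rewrite conjc_real. Qed.

Lemma M_lie q p : q \in nt -> panti R q p -> exists del : R, [/\ del ^+ 2 = 1,
  M q *m M p - M p *m M q = Complex 0 del *: M (wxor q p),
  M q *m M (wxor q p) - M (wxor q p) *m M q = Complex 0 (- del) *: M p &
  M p *m M (wxor q p) - M (wxor q p) *m M p = Complex 0 del *: M q].
Proof.
move=> hq hqp; have hp := panti_nontriv hqp.
have hx : wxor q p \in nt by apply: (panti_nontriv (w := q)); rewrite panti_xorE.
have [del d2 e] := pauli_antiP hqp.
have e2 := pauli_anti_xor d2 e.
have nd2 : (- del) ^+ 2 = 1 by rewrite sqrrN.
have e3 : pauli p *m pauli (wxor q p) = Complex 0 del *: pauli q :> 'M[C]_(2 ^ n).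
  have : Complex 0 (- del) *: (pauli p *m (pauli q *m pauli p)) = pauli p *m pauli (wxor q p) :> 'M[C]_(2 ^ n).
    rewrite e -scalemxAr scalerA (_ : _ * _ = 1) ?scale1r //.
    by apply: Cext; rewrite !ReImE /= -?d2; ring.
  move=> <-; rewrite mulmxA (eqP (panti_sym hqp)) mulNmx -mulmxA pauli_sqr mulmx1 scalerN -scaleNr.
  by congr (_ *: _); apply: Cext; rewrite /= ?oppr0 ?opprK.
exists del; split=> //.
- exact: (gen_commutator hrep (pauli_good hq) (pauli_good hp) (pauli_good hx) d2 (hfl hq) (hfl hp) (hfl hx)).
- exact: (gen_commutator hrep (pauli_good hq) (pauli_good hx) (pauli_good hp) nd2 (hfl hq) (hfl hx) (hfl hp)).
- exact: (gen_commutator hrep (pauli_good hp) (pauli_good hx) (pauli_good hq) d2 (hfl hp) (hfl hx) (hfl hq)).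
Qed.

(** Words commuting with q contribute 0. On the others the substitution of [wxor q p] for p changes
    the sign of the commutator with the square, so the sum is its own negative. *)
Lemma Om_comm q : q \in nt -> M q *m Om = Om *m M q.
Proof.
move=> hq; apply/eqP; rewrite -subr_eq0 /Om mulmx_sumr mulmx_suml -sumrB.
pose g p := (M q *m M p - M p *m M q) *m M p + M p *m (M q *m M p - M p *m M q).
rewrite (eq_bigr g) => [|p _]; last first.
  exact: commutator_sqr.
rewrite (bigID (panti R q)) /= [X in _ + X]big1 ?addr0 => [|p /andP[hp hqp]]; last first.
  have e := gen_commute hrep (pauli_good hq) (pauli_good hp) (hfl hq) (hfl hp) (pauli_commP hqp).
  by rewrite /g /M e subrr mul0mx mulmx0 addr0.
rewrite (eq_bigl (panti R q)) => [|p]; last first.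
  by case h : (panti R q p); rewrite ?andbF // (panti_nontriv h).
suff h : \sum_(p | panti R q p) g p = - \sum_(p | panti R q p) g p.
  have /eqP : \sum_(p | panti R q p) g p + \sum_(p | panti R q p) g p = 0 by rewrite {1}h addNr.
  by rewrite -mulr2n -scaler_nat scaler_eq0 pnatr_eq0.
rewrite -{1}sum_panti -sumrN; apply: eq_bigr => p hp.
have [del [d2 e1 e2 e3]] := M_lie hq hp.
exact: commutator_flip e1 e2.
Qed.

Lemma Om_adj : adjm Om = Om.
Proof. by rewrite /Om adjm_sum; apply: eq_bigr => w _; rewrite adjmM M_adj. Qed.

Lemma nrm2_M w (v : 'cV[C]_k) : w \in nt -> nrm2 (M w *m v) = \sum_j d w j ^+ 2 * cabs2 ((W w *m v) j 0).
Proof.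
move=> hw; have [uW _] := hfl hw; rewrite -(@nrm2_unitl _ _ _ (W w) (M w *m v) uW) nrm2_col.
by apply: eq_bigr => j _; rewrite fc_vec // cabs2M cabs2_real.
Qed.

Lemma Om_quad (v : 'cV[C]_k) : (adjm v *m Om *m v) 0 0 = (\sum_(w in nt) nrm2 (M w *m v))%:C.
Proof.
rewrite /Om mulmx_sumr mulmx_suml summxE rmorph_sum; apply: eq_bigr => w _.
by rewrite ip_self // M_adj.
Qed.

(** * Weights on an eigenspace of the Casimir operator *)

Section Eigenspace.
Variable om : R.
Local Notation inV v := (Om *m v = om%:C *: v).

Lemma inV_comm A (v : 'cV[C]_k) : A *m Om = Om *m A -> inV v -> inV (A *m v).
Proof. by move=> h e; rewrite mulmxA -h -mulmxA e -scalemxAr. Qed.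

(** The weights that occur on the eigenspace, recorded by their index in the spectral data: this is
    a predicate on a finite type, so a largest [|d w j|] exists. *)
Definition active (wj : word * 'I_k) : Prop := wj.1 \in nt /\
  exists v : 'cV[C]_k, [/\ v <> 0, inV v & M wj.1 *m v = (d wj.1 wj.2)%:C *: v].

(** The spectral projector of M_w at d w j commutes with [Om], so the projection of v stays in the
    eigenspace; it is nonzero because it keeps the j-th component. *)
Lemma activeP w j (v : 'cV[C]_k) : w \in nt -> inV v -> (W w *m v) j 0 <> 0 -> active (w, j).
Proof.
move=> hw hv hj; have [uW _] := hfl hw; split=> //.
exists (fc (W w) (fun i => (d w i == d w j)%:R) *m v); split.
- move=> /(congr1 (fun z => (W w *m z) j 0)); rewrite fc_vec // eqxx mul1r mulmx0 [RHS]mxE.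
  exact: hj.
- apply: inV_comm hv; apply/esym.
  apply: (fc_comm (f := fun i => (d w i)%:C)) => // [i i' /complexI -> //|].
  by apply/esym; exact: Om_comm.
- apply: (vec_inj uW) => i; rewrite -scalemxAr [RHS]mxE !fc_vec //=.
  by case: eqP => [->|_]; rewrite ?mul0r ?mulr0.
Qed.

(* A vector of extremal weight [m0] for [M w0] is killed by the raising operator of every
   su(2) triple through [w0], so <P^2 + R^2> = |m0| on it. *)
Lemma top_weight w0 m0 (v : 'cV[C]_k) (s : R) : w0 \in nt -> inV v ->
  M w0 *m v = m0%:C *: v -> `|m0| = s -> 0 < s ->
  (forall w j, active (w, j) -> `|d w j| <= s) ->
  s ^+ 2 * nrm2 v + s * (4 ^ n)%:R / 4 * nrm2 v <= om * nrm2 v.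
Proof.
move=> hw0 hv hm0 hs s0 hmax.
(* [e] is the sign of m0: the ladder operator has to increase |m0|. *)
have [e [e2 em]] : exists e : R, e ^+ 2 = 1 /\ m0 = e * s.
  have [m0p|m0p] := leP 0 m0.
    by exists 1; rewrite expr1n mul1r -hs ger0_norm.
  by exists (- 1); rewrite sqrrN expr1n mulN1r -hs ltr0_norm // opprK.
have pair p : panti R w0 p -> nrm2 (M p *m v) + nrm2 (M (wxor w0 p) *m v) = s * nrm2 v.
  move=> hp; have [del [d2 e1 e3 e4]] := M_lie hw0 hp.
  have hpn := panti_nontriv hp.
  have hxn : wxor w0 p \in nt by apply: (panti_nontriv (w := w0)); rewrite panti_xorE.
  set P := M p in e1 e3 e4 *; set S := M (wxor w0 p) in e1 e3 e4 *; set Z := M w0 in hm0 e1 e3 e4.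
  pose et := e * del; pose u := P *m v + Complex 0 et *: (S *m v).
  have et2 : et ^+ 2 = 1 by rewrite /et exprMn e2 d2 mulr1.
  have ed : et * del = e by rewrite /et -mulrA -expr2 d2 mulr1.
  have edel : e * et = del by rewrite /et mulrA -expr2 e2 mul1r.
  have uV : inV u.
    rewrite /u mulmxDr -scalemxAr scalerDr (inV_comm (Om_comm hpn) hv) (inV_comm (Om_comm hxn) hv).
    by rewrite !scalerA mulrC.
  have Zu : Z *m u = (m0 + e)%:C *: u by exact: (su2_raise e1 e3 hm0 ed edel).
  (* A nonzero u would produce an active weight m0 + e, of modulus s + 1. *)
  have [u0|u0] := pselect (u = 0); last first.
    have [uZ _] := hfl hw0; have [j hj] := vec_neq0 uZ u0.
    have := hmax w0 j (activeP hw0 uV hj).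
    have -> : d w0 j = m0 + e.
      have := congr1 (fun z => (W w0 *m z) j 0) Zu.
      rewrite -scalemxAr fc_vec // [RHS]mxE => /eqP; rewrite -subr_eq0 -mulrBl mulf_eq0.
      by move/eqP: hj => /negbTE ->; rewrite orbF -rmorphB /= => /eqP /complexI /eqP; rewrite subr_eq0 => /eqP.
    rewrite em -{2}[e]mulr1 -mulrDr normrM (_ : `|e| = 1) ?mul1r; last first.
      by move/eqP: e2; rewrite sqrf_eq1 => /orP[] /eqP ->; rewrite ?normrN1 ?normr1.
    by rewrite ger0_norm; lra.
  apply: (su2_lowest (M_adj p) (M_adj (wxor w0 p)) e4 hm0 et2 _ u0).
  by rewrite ed em mulrA -expr2 e2 mul1r.
(* Each triple is counted from both of its partners, hence the factor 2; with 4^n / 2 anticommuting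
   words the sum is s 4^n / 4 times |v|^2. *)
have anti_sum : (\sum_(p | panti R w0 p) nrm2 (M p *m v)) * 2 = (4 ^ n)%:R / 2 * (s * nrm2 v).
  rewrite -(card_panti hw0) mulr_natr mulr2n -{2}sum_panti -big_split /=.
  by rewrite (eq_bigr _ pair) sumr_const mulr_natl.
have tot : om * nrm2 v = \sum_(w in nt) nrm2 (M w *m v).
  apply: (@complexI R); rewrite -Om_quad -mulmxA hv -scalemxAr [RHS]mxE -nrm2_ip.
  by rewrite rmorphM.
have m0s : nrm2 (M w0 *m v) = s ^+ 2 * nrm2 v.
  by rewrite hm0 nrm2Z cabs2_real em exprMn e2 mul1r.
have n0 : ~~ panti R w0 w0.
  rewrite /panti pauli_sqr -subr_eq0 opprK -mulr2n -scaler_nat scaler_eq0 pnatr_eq0 /=.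
  have := pauli_neq0 R (word0 n); by rewrite pauli_word0.
have hsub : \sum_(w in nt) nrm2 (M w *m v) >= nrm2 (M w0 *m v) + \sum_(p | panti R w0 p) nrm2 (M p *m v).
  rewrite [X in _ <= X](bigD1 w0) //= lerD2l [X in _ <= X](bigID (panti R w0)) /=.
  rewrite [X in _ <= X + _](eq_bigl (panti R w0)); last first.
    move=> p; case h : (panti R w0 p); last by rewrite andbF.
    rewrite (panti_nontriv h) andbT /=; apply/eqP => e'; by rewrite e' (negbTE n0) in h.
  by rewrite lerDl sumr_ge0 // => p _; exact: nrm2_ge0.
rewrite tot; apply: le_trans hsub; rewrite m0s.
lra.
Qed.

(** The right side is the sum of the |(1 - Pi_w) y|^2. The extremal vector v need not be related to
    y: only the common eigenvalue [om] passes from one to the other. A nonzero M_w y ensures that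
    the largest weight s is positive. *)
Lemma eigen_gap (y : 'cV[C]_k) (S : R) : inV y -> 0 < S ->
  (forall w j, w \in nt -> `|d w j| <= S) ->
  (exists2 w, w \in nt & M w *m y <> 0) ->
  (1 + (4 ^ n)%:R / (4 * S)) * nrm2 y <=
  \sum_(w in nt) \sum_j (if d w j == 0 then 0 else cabs2 ((W w *m y) j 0)).
Proof.
move=> hy S0 hS [w1 hw1 My]; have [uW1 _] := hfl hw1.
have [j1 hj1] := vec_neq0 uW1 My.
have [d1 y1] : d w1 j1 != 0 /\ (W w1 *m y) j1 0 <> 0.
  move: hj1; rewrite fc_vec // => hj1; split.
    by apply/eqP => e; apply: hj1; rewrite e mul0r.
  by move=> e; apply: hj1; rewrite e mulr0.
have act1 : `[< active (w1, j1) >] by apply/asboolP; exact: activeP y1.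
have [w0 [j0 [act0 hmax]]] : exists w0 j0, active (w0, j0) /\
    forall w j, active (w, j) -> `|d w j| <= `|d w0 j0|.
  case: (@arg_maxP _ _ _ (w1, j1) (fun wj => `[< active wj >]) (fun wj => `|d wj.1 wj.2|) act1).
  move=> [w0 j0] /asboolP a0 m0; exists w0, j0; split=> // w j /asboolP a.
  exact: (m0 (w, j) a).
set s := `|d w0 j0| in hmax.
have s0 : 0 < s.
  apply: (lt_le_trans _ (hmax w1 j1 _)); first by rewrite normr_gt0.
  exact/asboolP.
have [hw0 [v [v0 hv Mv]]] := act0.
have top := top_weight hw0 hv Mv (erefl _) s0 hmax.
have nv := nrm2_gt0 v0.
have om_ge : s ^+ 2 + s * (4 ^ n)%:R / 4 <= om.
  by rewrite -(ler_pM2r nv) mulrDl.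
have sS : s <= S by exact: hS.
have tot : om * nrm2 y = \sum_(w in nt) nrm2 (M w *m y).
  apply: (@complexI R); rewrite -Om_quad -mulmxA hy -scalemxAr [RHS]mxE -nrm2_ip.
  by rewrite rmorphM.
have le1 : om * nrm2 y <= s ^+ 2 *
    \sum_(w in nt) \sum_j (if d w j == 0 then 0 else cabs2 ((W w *m y) j 0)).
  rewrite tot mulr_sumr; apply: ler_sum => w hw; rewrite nrm2_M // mulr_sumr.
  apply: ler_sum => j _; case: eqP => [->|dj]; first by rewrite expr0n mul0r mulr0.
  have [->|yj] := pselect ((W w *m y) j 0 = 0); first by rewrite cabs20 !mulr0.
  rewrite ler_wpM2r ?cabs2_ge0 // -real_normK ?num_real // ler_pXn2r ?nnegrE ?(ltW s0) //.
  exact: hmax (activeP hw hy yj).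
have s2 : 0 < s ^+ 2 by rewrite exprn_gt0.
rewrite -(ler_pM2l s2); apply: le_trans le1; rewrite mulrA ler_wpM2r ?nrm2_ge0 //.
apply: le_trans om_ge; rewrite mulrDr mulr1 lerD2l.
move: ((4 ^ n)%:R : R) (ler0n R (4 ^ n)) => K K0.
rewrite (_ : s ^+ 2 * _ = s * (s / S) * (K / 4)); last by field; rewrite gt_eqF.
rewrite -(mulrA s K) ler_wpM2r ?divr_ge0 // ger_pMr // ler_pdivrMr // mul1r.
exact: sS.
Qed.
End Eigenspace.

(** * The projector onto the invariants and the norm bound *)

Variable (G : 'M[C]_k).
Hypothesis G_inv : forall U, SU _ U -> rho U *m G = G.
Hypothesis G_fix : forall X : 'M[C]_k, (forall U, SU _ U -> X *m rho U = X) -> X *m G = X.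

Lemma rho_adj U : SU _ U -> rho (adjm U) = adjm (rho U).
Proof.
move=> hU; have h : rho U *m rho (adjm U) = 1%:M.
  rewrite -(rep_mul hrep) //; last exact: SU_adj.
  by case: (hU) => -> _; exact: rep1.
by rewrite -[RHS]mulmx1 -h mulmxA unitaryK ?mul1mx //; exact: rep_unitary.
Qed.
(** The adjoint of G is right invariant, so [adjm G *m G = adjm G], and the left side is
    Hermitian. *)
Lemma G_adj : adjm G = G.
Proof.
have h : adjm G *m G = adjm G.
  apply: G_fix => U hU.
  have := G_inv (SU_adj hU); rewrite rho_adj // => /(congr1 (@adjm R _ _)).
  by rewrite adjmM adjmK.
by rewrite -[RHS]adjmK -h adjmM adjmK.
Qed.
Lemma G_invr U : SU _ U -> G *m rho U = G.
Proof.
move=> hU; have := G_inv (SU_adj hU); rewrite rho_adj // => /(congr1 (@adjm R _ _)).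
by rewrite adjmM adjmK G_adj.
Qed.
Lemma G_sqr : G *m G = G.
Proof. by apply: G_fix => U; exact: G_invr. Qed.
Lemma G_M w : w \in nt -> G *m Pi w = G /\ G *m M w = 0.
Proof.
move=> hw; have [uW fl] := hfl hw.
have h : G *m Pi w = G.
  by apply: fc_inv_proj => // t; rewrite -fl; apply: G_invr; apply: good_SU; exact: pauli_good.
split=> //; rewrite -h -mulmxA fc_mul // (_ : fc _ _ = 0) ?mulmx0 // -(fc_zero (W w)).
apply: eq_fc => j.
by case: eqP => [->|_]; rewrite ?mulr0 ?mul0r.
Qed.
(** A vector killed by every M_w is invariant under [rho], so the rank-one matrix [y *m adjm y] is
    right invariant and [G_fix] applies to it; cancelling |y|^2 leaves G y = y. *)
Lemma G_fixv (y : 'cV[C]_k) : (forall w, w \in nt -> M w *m y = 0) -> G *m y = y.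
Proof.
move=> h; have inv U : SU _ U -> rho U *m y = y.
  move=> hU; apply: (fixed_SU hrep) hU => w hw t; have [uW fl] := hfl hw.
  rewrite (_ : t = (t * 2) / 2); last by field.
  rewrite fl; apply: (vec_inj uW) => j; rewrite fc_vec //.
  have := congr1 (fun z => (W w *m z) j 0) (h w hw); rewrite fc_vec // mulmx0 [RHS]mxE.
  move/eqP; rewrite mulf_eq0 => /orP[/eqP /complexI -> |/eqP ->]; last by rewrite mulr0.
  by rewrite mul0r eic0 mul1r.
have [->|y0] := pselect (y = 0); first by rewrite mulmx0.
have hX : (y *m adjm y) *m G = y *m adjm y.
  apply: G_fix => U hU; rewrite -mulmxA; congr (_ *m _).
  by have := inv _ (SU_adj hU); rewrite rho_adj // => /(congr1 (@adjm R _ _)); rewrite adjmM adjmK.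
have := congr1 (@adjm R _ _) hX; rewrite !adjmM adjmK G_adj => /(congr1 (mulmx^~ y)).
rewrite -!mulmxA (mx11_scalar (adjm y *m y)) -nrm2_ip !mul_mx_scalar -scalemxAr.
by apply: scalerI; apply/eqP => /complexI /nrm2_eq0.
Qed.

Definition avg_proj : 'M[C]_k := (#|nt|%:R)^-1 *: \sum_(w in nt) Pi w.

Hypothesis n_gt0 : (0 < n)%N.

(** [avg_proj - G] is Hermitian, so bounding its eigenvalues is enough. It commutes with [Om], hence
    a nonzero eigenvalue has an eigenvector y in an eigenspace of [Om]; there G y = 0, and the
    eigenvalue is the mean of |Pi_w y|^2 / |y|^2, which [eigen_gap] bounds. *)
Theorem gap_opnorm (S c : R) : 0 < S -> (forall w j, w \in nt -> `|d w j| <= S) -> 0 <= c ->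
  1 - (1 + (4 ^ n)%:R / (4 * S)) / ((4 ^ n)%:R - 1) <= c ->
  opnorm (avg_proj - G) <= c.
Proof.
move=> S0 hS c0 hc; set D := avg_proj - G.
have cnt : (#|nt|%:R : R) = (4 ^ n)%:R - 1.
  by rewrite card_nontriv -subn1 natrB // expn_gt0.
have cnt0 : 0 < (#|nt|%:R : R).
  rewrite cnt subr_gt0 ltr1n; case: (n) n_gt0 => // p _.
  by rewrite expnS (leq_trans (n := 4 * 1)) // leq_mul2l expn_gt0.
have cntC : (#|nt|%:R : C) != 0.
  by rewrite pnatr_eq0; case: #|nt| cnt0 => //; rewrite ltxx.
have Pi_adj w : adjm (Pi w) = Pi w.
  by rewrite fc_adj; apply: eq_fc => j; rewrite conjc_nat.
have T_adj : adjm avg_proj = avg_proj.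
  rewrite adjmZ adjm_sum conjc_inv conjc_nat; congr (_ *: _).
  by apply: eq_bigr => w _.
have D_adj : adjm D = D by rewrite adjmB T_adj G_adj.
have GT : G *m avg_proj = G.
  rewrite -scalemxAr mulmx_sumr (eq_bigr (fun=> G)) => [|w hw]; last by have [] := G_M hw.
  by rewrite sumr_const -[G *+ _]scaler_nat scalerA mulVf // scale1r.
have GD : G *m D = 0 by rewrite mulmxBr GT G_sqr subrr.
have GOm : G *m Om = 0.
  rewrite mulmx_sumr big1 // => w hw; have [_ e] := G_M hw.
  by rewrite mulmxA e mul0mx.
have OmG : Om *m G = 0 by rewrite -[LHS]adjmK adjmM Om_adj G_adj GOm adjm0.
have DOm : D *m Om = Om *m D.
  rewrite mulmxBl mulmxBr GOm OmG !subr0 -scalemxAl -scalemxAr; congr (_ *: _).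
  rewrite mulmx_suml mulmx_sumr; apply: eq_bigr => w hw; apply/esym.
  have [uW _] := hfl hw; apply: (fc_comm (f := fun j => (d w j)%:C)) => //.
    by move=> i j /complexI ->.
  by apply/esym; exact: Om_comm.
have [X [lam [uX eD]]] := herm_spectral D_adj.
have [Z [om [uZ eOm]]] := herm_spectral Om_adj.
have lam_le j : `|lam j| <= c.
  have [->|lj] := eqVneq (lam j) 0; first by rewrite normr0.
  pose x := adjm X *m (delta_mx j 0 : 'cV[C]_k).
  have xX : X *m x = delta_mx j 0 by rewrite mulmxA uX mul1mx.
  have x0 : x <> 0.
    move=> e; move: xX; rewrite e mulmx0 => /matrixP /(_ j 0); rewrite !mxE !eqxx.
    by move/eqP; rewrite eq_sym oner_eq0.
  have Dx : D *m x = (lam j)%:C *: x.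
    apply: (vec_inj uX) => i; rewrite -scalemxAr [RHS]mxE eD fc_vec // xX mxE.
    by case: eqP => [->|_] //=; rewrite !mulr0.
  have [i hi] := vec_neq0 uZ x0.
  pose F := fc Z (fun l => (om l == om i)%:R : C); pose y := F *m x.
  have y0 : y <> 0.
    by move/(congr1 (fun z => (Z *m z) i 0)); rewrite fc_vec // eqxx mul1r mulmx0 [RHS]mxE.
  have FD : F *m D = D *m F.
    apply/esym; apply: (fc_comm (f := fun l => (om l)%:C)) => //; last by rewrite -eOm.
    by move=> a b /complexI ->.
  have Dy : D *m y = (lam j)%:C *: y by rewrite mulmxA -FD -mulmxA Dx -scalemxAr.
  have Omy : Om *m y = (om i)%:C *: y.
    apply: (vec_inj uZ) => l; rewrite -scalemxAr [RHS]mxE eOm !fc_vec //.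
    by case: eqP => [->|_] //; rewrite !mul0r !mulr0.
  have Gy : G *m y = 0.
    have := congr1 (mulmx G) Dy; rewrite mulmxA GD mul0mx -scalemxAr => /esym/eqP.
    by rewrite scaler_eq0 => /orP[/eqP/complexI/eqP|/eqP //]; rewrite (negbTE lj).
  have Ty : avg_proj *m y = (lam j)%:C *: y by rewrite -Dy mulmxBl Gy subr0.
  have hM : exists2 w, w \in nt & M w *m y <> 0.
    apply: contrapT => h; apply: y0; rewrite -Gy; apply/esym; apply: G_fixv => w hw.
    by apply: contrapT => h2; apply: h; exists w.
  have gap := eigen_gap Omy S0 hS hM.
  have ny := nrm2_gt0 y0.
  set q := \sum_(w in nt) _ in gap.
  have q0 w : 0 <= \sum_l (if d w l == 0 then cabs2 ((W w *m y) l 0) else 0).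
    by apply: sumr_ge0 => l _; case: ifP => // _; exact: cabs2_ge0.
  have Piq w : w \in nt -> (adjm y *m Pi w *m y) 0 0 =
     (\sum_l (if d w l == 0 then cabs2 ((W w *m y) l 0) else 0))%:C.
    move=> hw; have [uW _] := hfl hw; rewrite fc_quad // rmorph_sum; apply: eq_bigr => l _.
    by case: eqP; rewrite ?mul1r ?mul0r.
  have lamE : lam j * nrm2 y * #|nt|%:R = \sum_(w in nt) \sum_l (if d w l == 0 then cabs2 ((W w *m y) l 0) else 0).
    apply: (@complexI R); rewrite rmorph_sum -(eq_bigr _ Piq) !rmorphM /= nrm2_ip.
    have -> : (lam j)%:C * (adjm y *m y) 0 0 = (adjm y *m avg_proj *m y) 0 0.
      by rewrite -mulmxA Ty -scalemxAr [RHS]mxE.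
    rewrite -scalemxAr -scalemxAl [X in X * _]mxE mulrAC rmorph_nat mulVf // mul1r.
    by rewrite mulmx_sumr mulmx_suml summxE.
  have lam0 : 0 <= lam j.
    have : 0 <= lam j * nrm2 y * #|nt|%:R by rewrite lamE; apply: sumr_ge0.
    by rewrite pmulr_lge0 // pmulr_lge0.
  rewrite ger0_norm //; apply: le_trans hc; rewrite -cnt.
  have qE : lam j * nrm2 y * #|nt|%:R + q = nrm2 y * #|nt|%:R.
    rewrite lamE /q -big_split /= mulr_natr -sumr_const; apply: eq_bigr => w hw.
    have [uW _] := hfl hw; rewrite -big_split /= -[RHS](nrm2_unitl y uW) nrm2_col.
    by apply: eq_bigr => l _; case: eqP; rewrite ?addr0 ?add0r.
  have : lam j * nrm2 y * #|nt|%:R <= (1 - (1 + (4 ^ n)%:R / (4 * S)) / #|nt|%:R) * nrm2 y * #|nt|%:R.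
    have -> : (1 - (1 + (4 ^ n)%:R / (4 * S)) / #|nt|%:R) * nrm2 y * #|nt|%:R =
       nrm2 y * #|nt|%:R - (1 + (4 ^ n)%:R / (4 * S)) * nrm2 y.
      by field; rewrite !gt_eqF.
    lra.
  by rewrite ler_pM2r // ler_pM2r.
(* For k = 0 there is no unit vector, and the supremum of the empty set is 0. *)
rewrite /opnorm; have [[v0 hv0]|h0] := pselect (exists v : 'cV[C]_k, vnorm v = 1); last first.
  rewrite (_ : [set _ | _ in _] = set0) ?sup0 //.
  by apply/seteqP; split=> // r [v hv _]; case: h0; exists v.
apply: ge_sup; first by exists (vnorm (D *m v0)); exists v0.
move=> _ [v hv <-]; rewrite vnormE -[leRHS]ger0_norm // -sqrtr_sqr; apply: ler_wsqrtr.
have nv : nrm2 v = 1.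
  by move: hv; rewrite /= vnormE => /(congr1 (fun r => r ^+ 2)); rewrite sqr_sqrtr ?nrm2_ge0 // expr1n.
rewrite -(@nrm2_unitl _ _ _ X (D *m v) uX) -[leRHS]mulr1 -nv -(@nrm2_unitl _ _ _ X v uX) !nrm2_col mulr_sumr.
apply: ler_sum => i _; rewrite eD fc_vec // cabs2M cabs2_real ler_wpM2r ?cabs2_ge0 //.
by rewrite -real_normK ?num_real // ler_pXn2r ?nnegrE.
Qed.
End Casimir.
End Gap.

(** * Haar-distributed matrices *)

Section HaarIntegral.
Variable R : realType.
Local Notation C := R[i].
Local Notation "x %:C" := (real_complex R x) (format "x %:C").
Local Notation Re := (@complex.Re R).
Local Notation Im := (@complex.Im R).

(** Every preimage is a countable union of fibres of [c]. *)
Lemma countable_factor_measurable d (T : measurableType d) (K : countType) (c : T -> K) (F : K -> R) :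
  (forall a, measurable (c @^-1` [set a])) -> measurable_fun setT (F \o c).
Proof.
move=> hc _ Y mY; rewrite setTI.
pose A i : set T := if @unpickle K i is Some a then (if `[< Y (F a) >] then c @^-1` [set a] else set0) else set0.
rewrite (_ : _ @^-1` Y = \bigcup_i A i); last first.
  apply/seteqP; split=> [x /= hx|x [i _]].
    by exists (pickle (c x)) => //; rewrite /A pickleK; case: asboolP.
  rewrite /A; case: unpickle => // a; case: asboolP => // Ya /= e.
  by rewrite /= e.
by apply: bigcupT_measurable => i; rewrite /A; case: unpickle => // a; case: ifP.
Qed.

Definition rnd (j : nat) (y : R) : R := (Num.floor (y * j.+1%:R))%:~R / j.+1%:R.
Lemma rnd_dist j y : `|y - rnd j y| <= j.+1%:R^-1.
Proof.
have j0 : 0 < (j.+1%:R : R) by rewrite ltr0n.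
have /andP[h1 h2] := mem_rg1_floor (y * j.+1%:R).
have -> : y - rnd j y = (y * j.+1%:R - (Num.floor (y * j.+1%:R))%:~R) / j.+1%:R.
  by rewrite mulrBl mulfK // gt_eqF.
rewrite ger0_norm; last by rewrite divr_ge0 ?(ltW j0) // subr_ge0.
by rewrite ler_pdivrMr // mulVf ?gt_eqF // lerBlDl ltW.
Qed.

Section Measurability.
Context d (T : measurableType d) (m : nat) (U : T -> 'M[C]_m).
Hypothesis mU : forall i j, measurable_fun setT (fun x => Re (U x i j)) /\
                            measurable_fun setT (fun x => Im (U x i j)).

(* Entries are rounded to a countable grid: any function of the rounded matrix is measurable. *)
Definition rnd_code j (A : 'M[C]_m) : 'M[int * int]_m :=
  \matrix_(a, b) (Num.floor (Re (A a b) * j.+1%:R), Num.floor (Im (A a b) * j.+1%:R)).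
Definition rnd_decode j (K : 'M[int * int]_m) : 'M[C]_m :=
  \matrix_(a, b) Complex ((K a b).1%:~R / j.+1%:R) ((K a b).2%:~R / j.+1%:R).

Lemma rnd_mx_dist j A : fnorm (A - rnd_decode j (rnd_code j A)) <= (m * m)%:R * 2 / j.+1%:R.
Proof.
apply: le_trans (fnorm_le_entries _) _.
apply: (@le_trans _ _ (\sum_(a < m) \sum_(b < m) (2 / j.+1%:R))).
  apply: ler_sum => a _; apply: ler_sum => b _; rewrite !mxE ReB ImB /=.
  have := rnd_dist j (Re (A a b)); have := rnd_dist j (Im (A a b)); rewrite /rnd.
  rewrite [2 / _](_ : _ = j.+1%:R^-1 + j.+1%:R^-1); last by rewrite mulrDl mul1r.
  by move=> h1 h2; exact: lerD.
by rewrite !sumr_const !card_ord -mulrnA -[X in X <= _]mulr_natr mulrAC [X in X * _]mulrC -mulrA.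
Qed.

(** What is known to be measurable is each coordinate of U; the composite is the limit of [h] on the
    rounded matrices, which take countably many values. *)
Lemma measurable_cont (h : 'M[C]_m -> R) : mx_continuous h -> measurable_fun setT (h \o U).
Proof.
move=> hc; pose F j := (h \o rnd_decode j) \o (rnd_code j \o U).
apply: (@measurable_fun_cvg _ _ _ _ F) => [j|x _].
  apply: countable_factor_measurable => K.
  rewrite (_ : _ @^-1` _ = \bigcap_(ab in [set: 'I_m * 'I_m])
     ((fun x => Re (U x ab.1 ab.2) * j.+1%:R) @^-1` `[(K ab.1 ab.2).1%:~R, ((K ab.1 ab.2).1 + 1)%:~R[ `&`
      (fun x => Im (U x ab.1 ab.2) * j.+1%:R) @^-1` `[(K ab.1 ab.2).2%:~R, ((K ab.1 ab.2).2 + 1)%:~R[)).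
    apply: fin_bigcap_measurable; first exact: finite_finset.
    move=> [a b] _ /=; have [m1 m2] := mU a b.
    apply: measurableI.
      rewrite -[X in measurable X]setTI; apply: (measurable_funM m1 (measurable_cst _)) => //.
    rewrite -[X in measurable X]setTI; apply: (measurable_funM m2 (measurable_cst _)) => //.
  apply/seteqP; split=> [x /= e [a b] _ /=|x /= h1].
    move/matrixP: e => /(_ a b); rewrite mxE => <- /=.
    by rewrite !in_itv /= !floor_itv.
  apply/matrixP => a b; have [] := h1 (a, b) I; rewrite /= !in_itv /= => e1 e2.
  by rewrite mxE (floor_def e1) (floor_def e2); case: (K a b).
apply/cvgrPdist_le => e e0.
have [del del0 hdel] := hc (U x) e e0.
pose N := Num.truncn ((m * m)%:R * 2 / del); exists N => // j /= Nj.
rewrite distrC; apply/ltW/hdel; rewrite fnormBC; apply: le_lt_trans (rnd_mx_dist _ _) _.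
rewrite ltr_pdivrMr ?ltr0n // [del * _]mulrC -ltr_pdivrMr //.
by apply: lt_le_trans (truncnS_gt _) _; rewrite ler_nat.
Qed.
End Measurability.

(** * Invariance of the law against functions continuous on SU *)

Section McShane.
Variables (m : nat) (f : 'M[C]_m -> R) (B : R).
Hypothesis fB : forall V, SU m V -> `|f V| <= B.
Hypothesis fc : forall V e, SU m V -> 0 < e -> exists2 del, 0 < del &
  forall V', SU m V' -> fnorm (V' - V) < del -> `|f V' - f V| < e.

(* [haar_SU] tests invariance only against functions continuous on all matrices; [mcst p] is such
   a function and tends to [f] pointwise on SU. *)
Definition mcs (p : nat) (A : 'M[C]_m) : R :=
  inf [set f V + p%:R * fnorm (A - V) | V in SU m].
Definition mcst p A := Num.min (mcs p A) B.

Lemma mcs_le p A V : SU m V -> mcs p A <= f V + p%:R * fnorm (A - V).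
Proof.
move=> hV; apply: ge_inf; last by exists V.
exists (- B) => _ [V' hV' <-]; apply: (@le_trans _ _ (f V')).
  by have := fB hV'; rewrite ler_norml => /andP[].
by rewrite lerDl mulr_ge0 ?fnorm_ge0.
Qed.
Lemma mcs_ge p A x : (forall V, SU m V -> x <= f V + p%:R * fnorm (A - V)) -> x <= mcs p A.
Proof.
move=> h; apply: lb_le_inf; last by move=> _ [V hV <-]; exact: h.
by exists (f 1%:M + p%:R * fnorm (A - 1%:M)); exists 1%:M => //; exact: SU1.
Qed.
Lemma mcs_lip p A A' : mcs p A <= mcs p A' + p%:R * fnorm (A - A').
Proof.
rewrite -lerBlDr; apply: mcs_ge => V hV; rewrite lerBlDr.
apply: le_trans (mcs_le _ _ hV) _; rewrite -addrA lerD2l -mulrDr ler_wpM2l // [leRHS]addrC.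
exact: fnorm_tri.
Qed.
Lemma mcs_geN p A : - B <= mcs p A.
Proof.
apply: mcs_ge => V hV; apply: (@le_trans _ _ (f V)).
  by have := fB hV; rewrite ler_norml => /andP[].
by rewrite lerDl mulr_ge0 ?fnorm_ge0.
Qed.
Lemma B_ge0 : 0 <= B.
Proof. by apply: le_trans (fB (SU1 R m)). Qed.
(** The lower bound holds before truncation; the cut at B limits the growth of the penalty away from
    SU. *)
Lemma mcst_bound p A : `|mcst p A| <= B.
Proof.
have := mcs_geN p A; have := B_ge0; rewrite /mcst ler_norml => h1 h2.
by rewrite ge_min lexx orbT le_min h2 /= andbT; lra.
Qed.
Lemma mcst_cont p : mx_continuous (mcst p).
Proof.
move=> A e e0; have p0 : 0 < (p.+1%:R : R) by rewrite ltr0n.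
exists (e / p.+1%:R); first by rewrite divr_gt0.
move=> A' h; have lt : p%:R * fnorm (A' - A) < e.
  move: h; rewrite ltr_pdivlMr // mulrC; apply: le_lt_trans.
  by rewrite ler_wpM2r ?fnorm_ge0 // ler_nat.
have h1 := mcs_lip p A' A; have := mcs_lip p A A'; rewrite fnormBC => h2.
rewrite /mcst /Num.min ltr_norml; case: (ltP (mcs p A) B) => ?; case: (ltP (mcs p A') B) => ?;
  apply/andP; split; lra.
Qed.
(** Beyond distance del the penalty is at least p del >= 2B and outweighs any gain in f; within del,
    f changes by less than e. *)
Lemma mcst_cvg A : SU m A -> mcst p A @[p --> \oo] --> f A.
Proof.
move=> hA; apply/cvgrPdist_le => e e0.
have [del del0 hdel] := fc hA e0.
pose N := Num.truncn (2 * B / del); exists N.+1 => // p /= Np.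
have pB : 2 * B <= p%:R * del.
  rewrite -ler_pdivrMr //; apply: ltW; apply: lt_le_trans (truncnS_gt _) _.
  by rewrite ler_nat.
have up : mcs p A <= f A.
  by apply: le_trans (mcs_le _ _ hA) _; rewrite subrr fnorm0 mulr0 addr0.
have lo : f A - e <= mcs p A.
  apply: mcs_ge => V hV; have [h|h] := ltP (fnorm (V - A)) del.
    have := hdel _ hV h; rewrite ltr_norml => /andP[h1 _].
    have : 0 <= p%:R * fnorm (A - V) by rewrite mulr_ge0 ?fnorm_ge0.
    lra.
  have := fB hV; have := fB hA; rewrite !ler_norml => /andP[_ a1] /andP[a2 _].
  have : p%:R * del <= p%:R * fnorm (A - V) by rewrite ler_wpM2l // fnormBC.
  lra.
have := fB hA; rewrite ler_norml => /andP[_ a1].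
rewrite /mcst /Num.min; case: ltP => ?; rewrite ler_norml; apply/andP; split; lra.
Qed.

Section Law.
Context d (T : measurableType d) (Pr : probability T R) (U : T -> 'M[C]_m).
Hypothesis HU : haar_SU Pr U.

Lemma mulmx_cont (V : 'M[C]_m) h : SU m V -> mx_continuous h -> mx_continuous (fun A => h (V *m A)).
Proof.
move=> [uV _] hh A e e0; have [del del0 hdel] := hh (V *m A) e e0.
by exists del => // A' hA; apply: hdel; rewrite -mulmxBr fnorm_unitl.
Qed.
Lemma haar_mcst_meas V p : SU m V -> measurable_fun setT (fun x => mcst p (V *m U x)).
Proof.
move=> hV; case: HU => _ mU _.
exact: (measurable_cont mU (mulmx_cont hV (mcst_cont p))).
Qed.
Lemma haar_meas V : SU m V -> measurable_fun setT (fun x => f (V *m U x)).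
Proof.
move=> hV; case: HU => SUU _ _.
apply: (@measurable_fun_cvg _ _ _ _ (fun p x => mcst p (V *m U x))) => [p|x _].
  exact: haar_mcst_meas.
by apply: mcst_cvg; exact: SUM.
Qed.
Lemma bounded_integrable (h : T -> R) (K : R) : measurable_fun setT h -> (forall x, `|h x| <= K) ->
  Pr.-integrable setT (EFin \o h).
Proof.
move=> mh hK; apply: measurable_bounded_integrable => //.
  exact: (le_lt_trans (probability_le1 Pr measurableT) (ltry _)).
exists K; split; first exact: num_real.
by move=> M KM x _ /=; apply: le_trans (hK x) (ltW KM).
Qed.
Lemma haar_cvg V : SU m V ->
  (\int[Pr]_(x in setT) (mcst p (V *m U x))%:E)%E @[p --> \oo] -->
  (\int[Pr]_(x in setT) (f (V *m U x))%:E)%E.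
Proof.
move=> hV; case: HU => SUU _ _.
apply: (@dominated_cvg _ _ _ _ _ measurableT _ _ (cst B%:E)) => //.
- by move=> p; apply/measurable_EFinP; exact: haar_mcst_meas.
- by move=> x _; apply/fine_cvgP; split; [exact: nearW | apply: mcst_cvg; exact: SUM].
- by apply: (@finite_measure_integrable_cst _ _ _ Pr).
- by move=> p x _; rewrite /= lee_fin mcst_bound.
Qed.
(** For each p the two integrals of [mcst p] agree; dominated convergence, with the constant B as
    bound, passes this to f. *)
Lemma haar_shift V : SU m V ->
  \int[Pr]_(x in setT) f (V *m U x) = \int[Pr]_(x in setT) f (U x).
Proof.
move=> hV; have c1 := haar_cvg hV; have c2 := haar_cvg (SU1 R m).
case: (HU) => SUU mU inv.
(* Invariance is stated for real-valued integrals; finiteness lifts it to the extended ones whose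
   limits are compared. *)
have fin_eq (x y : \bar R) : x \is a fin_num -> y \is a fin_num -> fine x = fine y -> x = y.
  by move=> /fineK h1 /fineK h2 h3; rewrite -h1 h3 h2.
have e : (fun p => (\int[Pr]_(x in setT) (mcst p (V *m U x))%:E)%E) =
         (fun p => (\int[Pr]_(x in setT) (mcst p (1%:M *m U x))%:E)%E).
  apply/funext => p; apply: fin_eq.
  - exact: (integrable_fin_num measurableT (bounded_integrable (haar_mcst_meas p hV) (fun x => mcst_bound p _))).
  - exact: (integrable_fin_num measurableT (bounded_integrable (haar_mcst_meas p (SU1 R m)) (fun x => mcst_bound p _))).
  have h := inv V hV (mcst p) (ex_intro _ B (mcst_bound p)) (mcst_cont p).
  under [in RHS]eq_integral do rewrite mul1mx.
  exact: esym h.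
rewrite e in c1; have h := cvg_unique (@ereal_hausdorff R) c1 c2.
rewrite /Rintegral h; congr fine.
by apply: eq_integral => x _; rewrite mul1mx.
Qed.
End Law.
End McShane.
End HaarIntegral.

(** * Averages of matrix-valued functions *)

Section ComplexIntegral.
Variable R : realType.
Local Notation C := R[i].
Local Notation "x %:C" := (real_complex R x) (format "x %:C").
Local Notation Re := (@complex.Re R).
Local Notation Im := (@complex.Im R).

Section Mint.
Context d (T : measurableType d) (mu : {measure set T -> \bar R}) (D : set T) (mD : measurable D).

Definition rintg (f : T -> R) := mu.-integrable D (EFin \o f).
Definition cint (f : T -> C) : C :=
  Complex (\int[mu]_(x in D) Re (f x)) (\int[mu]_(x in D) Im (f x)).
Definition cintg (f : T -> C) := rintg (fun x => Re (f x)) /\ rintg (fun x => Im (f x)).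

Lemma rintgD f g : rintg f -> rintg g -> rintg (fun x => f x + g x).
Proof. by move=> hf hg; exact: (integrableD mD hf hg). Qed.
Lemma rintgZ a f : rintg f -> rintg (fun x => a * f x).
Proof. by move=> hf; exact: (integrableZl mD a hf). Qed.
Lemma rintgB f g : rintg f -> rintg g -> rintg (fun x => f x - g x).
Proof. by move=> hf hg; exact: (integrableB mD hf hg). Qed.

Lemma cint0 : cint (fun=> 0) = 0.
Proof. by apply: Cext; rewrite /= Rintegral_cst // mul0r. Qed.
Lemma cintg0 : cintg (fun=> 0).
Proof. by split; exact: (integrable0 mu D). Qed.
Lemma cintgD f g : cintg f -> cintg g -> cintg (fun x => f x + g x).
Proof.
move=> [f1 f2] [g1 g2]; split; rewrite /rintg.
  by rewrite (_ : (fun x => Re _) = (fun x => Re (f x) + Re (g x))); [exact: rintgD | apply/funext => x; rewrite ReD].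
by rewrite (_ : (fun x => Im _) = (fun x => Im (f x) + Im (g x))); [exact: rintgD | apply/funext => x; rewrite ImD].
Qed.
Lemma cintD f g : cintg f -> cintg g -> cint (fun x => f x + g x) = cint f + cint g.
Proof.
move=> [f1 f2] [g1 g2]; apply: Cext; rewrite /= -RintegralD //; apply: eq_Rintegral => x _.
  by rewrite ReD.
by rewrite ImD.
Qed.
Lemma cintgZ a f : cintg f -> cintg (fun x => a * f x).
Proof.
move=> [f1 f2]; split; rewrite /rintg.
  rewrite (_ : (fun x => Re _) = (fun x => Re a * Re (f x) - Im a * Im (f x))); last by apply/funext => x; rewrite ReM.
  by apply: rintgB; apply: rintgZ.
rewrite (_ : (fun x => Im _) = (fun x => Re a * Im (f x) + Im a * Re (f x))); last by apply/funext => x; rewrite ImM.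
by apply: rintgD; apply: rintgZ.
Qed.
Lemma cintZ a f : cintg f -> cint (fun x => a * f x) = a * cint f.
Proof.
move=> [f1 f2]; apply: Cext; rewrite !ReImE /= -!RintegralZl //.
  rewrite -RintegralB //; [|exact: rintgZ|exact: rintgZ].
  by apply: eq_Rintegral => x _; rewrite ReM.
rewrite -RintegralD //; [|exact: rintgZ|exact: rintgZ].
by apply: eq_Rintegral => x _; rewrite ImM.
Qed.
Lemma cintg_sum (I : eqType) (s : seq I) (f : I -> T -> C) : (forall i, i \in s -> cintg (f i)) ->
  cintg (fun x => \sum_(i <- s) f i x).
Proof.
elim: s => [|i s IH] h.
  by under eq_fun do rewrite big_nil; exact: cintg0.
under eq_fun do rewrite big_cons; apply: cintgD; first by apply: h; rewrite mem_head.
by apply: IH => j js; apply: h; rewrite in_cons js orbT.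
Qed.
Lemma cint_sum (I : eqType) (s : seq I) (f : I -> T -> C) : (forall i, i \in s -> cintg (f i)) ->
  cint (fun x => \sum_(i <- s) f i x) = \sum_(i <- s) cint (f i).
Proof.
elim: s => [|i s IH] h.
  by under eq_fun do rewrite big_nil; rewrite big_nil cint0.
have hs j : j \in s -> cintg (f j) by move=> js; apply: h; rewrite in_cons js orbT.
under eq_fun do rewrite big_cons; rewrite big_cons cintD ?IH //.
  by apply: h; rewrite mem_head.
exact: cintg_sum.
Qed.

Definition mint m n (F : T -> 'M[C]_(m, n)) : 'M[C]_(m, n) := \matrix_(i, j) cint (fun x => F x i j).
Definition mintg m n (F : T -> 'M[C]_(m, n)) := forall i j, cintg (fun x => F x i j).

Lemma mintg_mul m n p q (A : 'M[C]_(m, n)) (B : 'M[C]_(p, q)) F : mintg F -> mintg (fun x => A *m F x *m B).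
Proof.
move=> h i j; under eq_fun do rewrite mxE.
apply: cintg_sum => l _; under eq_fun do rewrite mulrC; apply: cintgZ.
by under eq_fun do rewrite mxE; apply: cintg_sum => r _; exact: cintgZ.
Qed.
Lemma mint_mul m n p q (A : 'M[C]_(m, n)) (B : 'M[C]_(p, q)) F : mintg F ->
  mint (fun x => A *m F x *m B) = A *m mint F *m B.
Proof.
move=> h; apply/matrixP => i j; rewrite !mxE; under eq_fun do rewrite mxE.
have h1 l : cintg (fun x => (A *m F x) i l).
  by under eq_fun do rewrite mxE; apply: cintg_sum => r _; exact: cintgZ.
rewrite cint_sum => [|l _]; last by under eq_fun do rewrite mulrC; apply: cintgZ.
apply: eq_bigr => l _; under eq_fun do rewrite mulrC; rewrite cintZ // mulrC; congr (_ * _).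
under eq_fun do rewrite mxE; rewrite cint_sum => [|r _]; last exact: cintgZ.
by rewrite mxE; apply: eq_bigr => r _; rewrite cintZ // mxE.
Qed.
Lemma mint_sum (I : eqType) (s : seq I) m n (F : I -> T -> 'M[C]_(m, n)) :
  (forall i, i \in s -> mintg (F i)) ->
  mint (fun x => \sum_(i <- s) F i x) = \sum_(i <- s) mint (F i).
Proof.
move=> h; apply/matrixP => i j; rewrite mxE summxE; under eq_fun do rewrite summxE.
rewrite cint_sum => [|l ls]; last exact: h.
by apply: eq_bigr => l _; rewrite mxE.
Qed.
End Mint.

(** * Averages over a period *)

Section Unif.
Local Notation mu := (@lebesgue_measure R).

Lemma FTC_open (F f : R -> R) (a b : R) : a < b -> (forall x : R, is_derive x 1 (F : R -> R^o) (f x)) ->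
  continuous (f : R -> R^o) ->
  mu.-integrable `]a, b[ (EFin \o f) /\ \int[mu]_(x in `]a, b[) f x = F b - F a.
Proof.
move=> ab dF cf.
have cc : mu.-integrable `[a, b] (EFin \o f).
  apply: continuous_compact_integrable; first exact: segment_compact.
  exact: continuous_subspaceT.
have sub c d : [set` Interval c d] `<=` `[a, b] -> mu.-integrable [set` Interval c d] (EFin \o f).
  by move=> h; apply: integrableS cc => //; exact: measurable_itv.
have oo : mu.-integrable `]a, b[ (EFin \o f) by apply: sub; exact: subset_itv_oo_cc.
split=> //; rewrite Rintegral_itv_bndo_bndc // Rintegral_itv_obnd_cbnd; last first.
  by apply: sub; exact: subset_itv_oc_cc.
have cF : continuous (F : R -> R^o).
  by move=> x; apply: differentiable_continuous; apply/derivable1_diffP; exact: ex_derive.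
rewrite /Rintegral (continuous_FTC2 (F := F) ab) //.
- exact: continuous_subspaceT.
- split.
  + by move=> x _; exact: ex_derive.
  + by apply: cvg_at_right_filter; exact: cF.
  + by apply: cvg_at_left_filter; exact: cF.
- by move=> x _; rewrite derive1E; exact: derive_val.
Qed.

Lemma derive_lin (c x : R) : is_derive x 1 (fun t : R => c * t : R^o) c.
Proof.
apply: (is_derive_eq (is_deriveM (is_derive_cst c _ _) (is_derive_id x 1))).
by rewrite /GRing.scale /= mulr0 addr0 mulr1.
Qed.
(** For a nonzero, the real part integrates to 2 sin(aL) / a = 0 and the imaginary part to 0 by
    parity; only frequency 0 survives. *)
Lemma cint_eic (L a : R) : 0 < L -> (a != 0 -> sin (a * L) = 0) ->
  cintg mu `]- L, L[ (fun x => eic (a * x)) /\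
  cint mu `]- L, L[ (fun x => eic (a * x)) = (2 * L)%:C * (a == 0)%:R.
Proof.
move=> L0 ha; have lt : - L < L by rewrite gtrN.
have [a0|a0] := eqVneq a 0.
  have [i1 e1] := FTC_open (F := fun t => 1 * t) (f := fun=> 1) lt (derive_lin 1) (fun x => cvg_cst _).
  have e (x : R) : eic (a * x) = 1 by rewrite a0 mul0r eic0.
  rewrite (funext e : (fun x : R => eic (a * x)) = fun=> 1) /cintg /rintg /cint /=; split.
    by split=> //; exact: (integrable0 mu _).
  by apply: Cext; rewrite /= ?mulr1 ?e1 ?Rintegral_cst // ?mul0r //; ring.
have dsin (x : R) : is_derive x 1 (fun t : R => a^-1 * sin (a * t) : R^o) (cos (a * x)).
  have h := @is_derive1_comp _ sin (fun t => a * t) x _ _ (is_derive_sin _) (derive_lin a x).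
  apply: (is_derive_eq (is_deriveM (is_derive_cst a^-1 _ _) h)).
  by rewrite /GRing.scale /= mulr0 addr0 mulrCA mulVf // mulr1.
have dcos (x : R) : is_derive x 1 (fun t : R => - a^-1 * cos (a * t) : R^o) (sin (a * x)).
  have h := @is_derive1_comp _ cos (fun t => a * t) x _ _ (is_derive_cos _) (derive_lin a x).
  apply: (is_derive_eq (is_deriveM (is_derive_cst (- a^-1) _ _) h)).
  by rewrite /GRing.scale /= mulr0 addr0 !mulNr mulrN opprK mulrCA mulVf // mulr1.
have ccos : continuous (fun t : R => cos (a * t) : R^o).
  move=> x; apply: differentiable_continuous; apply/derivable1_diffP.
  by have [h _] := @is_derive1_comp _ cos (fun t => a * t) x _ _ (is_derive_cos _) (derive_lin a x).
have csin : continuous (fun t : R => sin (a * t) : R^o).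
  move=> x; apply: differentiable_continuous; apply/derivable1_diffP.
  by have [h _] := @is_derive1_comp _ sin (fun t => a * t) x _ _ (is_derive_sin _) (derive_lin a x).
have [i1 e1] := FTC_open lt dsin ccos.
have [i2 e2] := FTC_open lt dcos csin.
split; first by split.
rewrite mulr0; apply: Cext; rewrite /= ?e1 ?e2 mulrN ?sinN ?cosN ?ha // ?oppr0 ?mulr0 subrr //.
Qed.

Lemma mint_flow k (W : 'M[C]_k) (dd : 'I_k -> R) L : 0 < L ->
  (forall j, dd j != 0 -> sin (dd j * L) = 0) ->
  mintg mu `]- L, L[ (flow W dd) /\
  mint mu `]- L, L[ (flow W dd) = (2 * L)%:C *: fc W (fun j => (dd j == 0)%:R).
Proof.
move=> L0 hd; have mI : measurable (`]- L, L[ : set R) by exact: measurable_itv.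
have eD i j : (fun t => diag_mx (\row_l eic (dd l * t)) i j) =
    (if i == j then (fun t => eic (dd i * t)) else (fun=> 0)).
  by apply/funext => t; rewrite !mxE; case: eqP; rewrite ?mulr1n ?mulr0n.
have dg : mintg mu `]- L, L[ (fun t => diag_mx (\row_j eic (dd j * t))).
  move=> i j; rewrite eD; case: eqP => _; last exact: cintg0.
  by have [] := cint_eic L0 (hd i).
split; first exact: mintg_mul.
rewrite /flow /fc mint_mul // scalemxAl scalemxAr; congr (_ *m _ *m _).
apply/matrixP => i j; rewrite mxE eD !mxE; case: eqP => [_|_].
  by have [_ ->] := cint_eic L0 (hd i); rewrite mulr1n.
by rewrite cint0 // mulr0n mulr0.
Qed.

Lemma unif_flows (I : finType) (A : {pred I}) k (W : I -> 'M[C]_k) (dd : I -> 'I_k -> R) L c : 0 < L ->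
  (forall w j, w \in A -> dd w j != 0 -> sin (dd w j * L) = 0) ->
  unif_expect (- L) L (fun t => c *: \sum_(w in A) flow (W w) (dd w) t) =
  c *: \sum_(w in A) fc (W w) (fun j => (dd w j == 0)%:R).
Proof.
move=> L0 hd; have mI : measurable (`]- L, L[ : set R) by exact: measurable_itv.
have -> F : unif_expect (- L) L F = ((2 * L)^-1)%:C *: mint mu `]- L, L[ (F : R -> 'M[C]_k).
  apply/matrixP => i j; rewrite !mxE opprK -mulr2n.
  by apply: Cext; rewrite !ReImE /= mul0r ?subr0 ?addr0 -[L *+ 2]mulr_natl.
have fl w : w \in A -> _ := fun hw => mint_flow (W w) L0 (fun j => hd w j hw).
have -> : (fun t => c *: \sum_(w in A) flow (W w) (dd w) t) =
    (fun t => c%:M *m (\sum_(w <- enum A) flow (W w) (dd w) t) *m 1%:M).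
  by apply/funext => t; rewrite mulmx1 mul_scalar_mx big_enum.
rewrite mint_mul //; last first.
  move=> i j; rewrite (_ : (fun t => _) = (fun t => \sum_(w <- enum A) flow (W w) (dd w) t i j)); last first.
    by apply/funext => t; rewrite summxE.
  apply: cintg_sum => // w.
  by rewrite mem_enum => /fl [h _]; exact: h.
rewrite mulmx1 mul_scalar_mx mint_sum // => [|w]; last by rewrite mem_enum => /fl [].
rewrite big_enum /= scalerA mulrC -scalerA; congr (_ *: _); rewrite scaler_sumr; apply: eq_bigr => w hw.
have [_ ->] := fl w hw; rewrite scalerA -rmorphM /= mulVf ?rmorph1 ?scale1r //.
by rewrite gt_eqF // mulr_gt0.
Qed.
End Unif.

(** * The two properties of the Haar average *)

Section HaarProjector.
Variables (m k : nat) (rho : 'M[C]_m -> 'M[C]_k).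
Hypothesis hrep : unitary_rep rho.
Context d (T : measurableType d) (Pr : probability T R) (U : T -> 'M[C]_m).
Hypothesis HU : haar_SU Pr U.
Local Notation G := (rv_expect Pr (fun x => rho (U x))).

(** [part] treats real and imaginary parts together; the conclusions are the boundedness and
    continuity on SU from which [haar_shift] starts. *)
Lemma rep_entry i j (part : C -> R) : part = Re \/ part = Im ->
  let f := fun A => part (rho A i j) in
  (forall V, SU m V -> `|f V| <= fnorm (1%:M : 'M[C]_k)) /\
  (forall V e, SU m V -> 0 < e -> exists2 del, 0 < del &
     forall V', SU m V' -> fnorm (V' - V) < del -> `|f V' - f V| < e).
Proof.
move=> hp f.
have le (A : 'M[C]_k) : `|part (A i j)| <= fnorm A.
  by case: hp => ->; [exact: Re_le_fnorm | exact: Im_le_fnorm].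
have sub (A B : 'M[C]_k) : part (A i j) - part (B i j) = part ((A - B) i j).
  by case: hp => ->; rewrite !mxE ?ReB ?ImB.
split=> [V hV|V e hV e0].
  by apply: le_trans (le _) _; rewrite -[rho V]mulmx1 fnorm_unitl //; exact: rep_unitary.
case: hrep => _ _ /(_ V e hV e0) [del del0 h]; exists del => // V' hV' lt.
by rewrite /f sub; apply: le_lt_trans (le _) _; exact: h.
Qed.
Lemma rep_mintg : mintg Pr setT (fun x => rho (U x)).
Proof.
have [SUU _ _] := HU.
have key i j part : part = Re \/ part = Im -> rintg Pr setT (fun x => part (rho (U x) i j)).
  move=> hp; have [hB hC] := rep_entry i j hp.
  apply: (@bounded_integrable R d T Pr _ (fnorm (1%:M : 'M[C]_k))) => [|x]; last by apply: hB.
  by have := haar_meas hB hC HU (SU1 R m); under eq_fun do rewrite mul1mx.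
by move=> i j; split; apply: key; [left|right].
Qed.
Lemma haar_inv V : SU m V -> rho V *m G = G.
Proof.
move=> hV; have [SUU _ _] := HU.
have := mint_mul measurableT (rho V) 1%:M rep_mintg; rewrite mulmx1 => <-.
apply/matrixP => i j; rewrite !mxE /cint.
have e x : rho V *m rho (U x) *m 1%:M = rho (V *m U x) by rewrite mulmx1 (rep_mul hrep).
under [X in Complex X _]eq_Rintegral do rewrite e.
under [X in Complex _ X]eq_Rintegral do rewrite e.
have [B1 C1] := rep_entry i j (or_introl (erefl Re)).
have [B2 C2] := rep_entry i j (or_intror (erefl Im)).
by rewrite (haar_shift B1 C1 HU hV) (haar_shift B2 C2 HU hV).
Qed.
Lemma haar_fix (X : 'M[C]_k) : (forall V, SU m V -> X *m rho V = X) -> X *m G = X.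
Proof.
move=> hX; have [SUU _ _] := HU.
have := mint_mul measurableT X 1%:M rep_mintg; rewrite mulmx1 => <-.
have -> : (fun x => X *m rho (U x) *m 1%:M) = (fun=> X) by apply/funext => x; rewrite mulmx1 hX.
have pr1 : fine (Pr setT) = 1 by rewrite probability_setT.
by apply/matrixP => i j; rewrite mxE; apply: Cext; rewrite /= Rintegral_cst // pr1 mulr1.
Qed.
End HaarProjector.
End ComplexIntegral.

(** * Tensor powers *)

Section TensorPower.
Variable R : realType.
Local Notation C := R[i].
Local Notation "x %:C" := (real_complex R x) (format "x %:C").

(** [ntensmx_rec X k] has k + 1 factors. *)
Lemma ntens_mul m (X Y : 'M[C]_m) k :
  ntensmx_rec (X *m Y) k = ntensmx_rec X k *m ntensmx_rec Y k.
Proof. by elim: k => //= k ->; rewrite -tens_mul. Qed.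
Lemma ntens_adj m (X : 'M[C]_m) k : adjm (ntensmx_rec X k) = ntensmx_rec (adjm X) k.
Proof. by elim: k => //= k <-; rewrite -tens_adj. Qed.
Lemma ntens_one m k : ntensmx_rec (1%:M : 'M[C]_m) k = 1%:M.
Proof. by elim: k => //= k ->; exact: tens_one. Qed.
Lemma tens_unitary m n (X : 'M[C]_m) (Y : 'M[C]_n) : unitary X -> unitary Y -> unitary (X *t Y).
Proof. by rewrite /unitary => hX hY; rewrite tens_adj tens_mul hX hY tens_one. Qed.
Lemma ntens_unitary m (X : 'M[C]_m) k : unitary X -> unitary (ntensmx_rec X k).
Proof. by rewrite /unitary => hX; rewrite ntens_adj -ntens_mul hX ntens_one. Qed.
Lemma unitary_fnorm m (X : 'M[C]_m) : unitary X -> fnorm X = fnorm (1%:M : 'M[C]_m).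
Proof. by move=> hX; rewrite -[X]mulmx1 fnorm_unitl. Qed.
(** A (x) B - A' (x) B' = (A - A') (x) B + A' (x) (B - B'). *)
Lemma fnorm_tens_diff m n (A A' : 'M[C]_m) (B B' : 'M[C]_n) :
  fnorm (A *t B - A' *t B') <= fnorm (A - A') * fnorm B + fnorm A' * fnorm (B - B').
Proof.
rewrite -!fnorm_tens; apply: le_trans (fnormD _ _).
rewrite le_eqVlt; apply/orP; left; apply/eqP; congr fnorm.
by apply/matrixP => i j; rewrite !mxE; ring.
Qed.
Lemma ntens_lip m k : exists2 K : R, 0 <= K & forall X Y : 'M[C]_m, unitary X -> unitary Y ->
  fnorm (ntensmx_rec X k - ntensmx_rec Y k) <= K * fnorm (X - Y).
Proof.
elim: k => [|k [K K0 IH]]; first by exists 1 => // X Y _ _; rewrite mul1r.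
exists (fnorm (1%:M : 'M[C]_(m ^ k.+1)) + fnorm (1%:M : 'M[C]_m) * K).
  by rewrite addr_ge0 ?mulr_ge0 ?fnorm_ge0.
move=> X Y hX hY /=; apply: le_trans (fnorm_tens_diff _ _ _ _) _.
rewrite (unitary_fnorm (ntens_unitary k hX)) (unitary_fnorm hY) mulrDl mulrC lerD2l -mulrA.
by rewrite ler_wpM2l ?fnorm_ge0 //; exact: IH.
Qed.

Lemma fc_tens m n (W : 'M[C]_m) (V : 'M[C]_n) f g :
  fc W f *t fc V g = fc (W *t V) (fun i => f (mxtens_unindex i).1 * g (mxtens_unindex i).2).
Proof.
rewrite /fc -!tens_mul -tens_adj; congr (_ *m _ *m _).
have diagE p (h : 'I_p -> C) a b : diag_mx (\row_l h l) a b = h a *+ (a == b).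
  by rewrite !mxE; case: eqP => [->|].
apply/matrixP => i j; rewrite tens_entry !diagE.
have -> : (i == j) = ((mxtens_unindex i).1 == (mxtens_unindex j).1) && ((mxtens_unindex i).2 == (mxtens_unindex j).2).
  by rewrite -xpair_eqE -!surjective_pairing (can_eq (@mxtens_unindexK m n)).
by case: eqP => _; case: eqP => _; rewrite /= ?mulr1n ?mulr0n ?mulr0 ?mul0r.
Qed.
Lemma flow_tens m n (W : 'M[C]_m) (V : 'M[C]_n) d e t :
  flow W d t *t flow V e t =
  flow (W *t V) (fun i => d (mxtens_unindex i).1 + e (mxtens_unindex i).2) t.
Proof. by rewrite fc_tens; apply: eq_fc => i; rewrite mulrDl eicD. Qed.
Lemma flow_mconj m (W : 'M[C]_m) d t :
  mconj (flow W d t) = flow (mconj W) (fun j => - d j) t.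
Proof.
rewrite /flow /fc !mconjM; congr (_ *m _ *m _).
  by apply/matrixP => i j; rewrite !mxE.
apply/matrixP => i j; rewrite !mxE mulNr eicN.
by case: eqP => _; rewrite ?mulr1n ?mulr0n ?rmorph0.
Qed.
Lemma mconj_unitary m (W : 'M[C]_m) : unitary W -> unitary (mconj W).
Proof.
rewrite /unitary => h; have -> : adjm (mconj W) = mconj (adjm W) by apply/matrixP => i j; rewrite !mxE.
by rewrite -mconjM h mconj1.
Qed.
(** Weights add over the k + 1 tensor factors. *)
Lemma flow_ntens m (W : 'M[C]_m) d (S : R) k : unitary W -> (forall j, `|d j| <= S) ->
  exists W' d', [/\ unitary W', forall j, `|d' j| <= S *+ k.+1 &
    forall t, ntensmx_rec (flow W d t) k = flow W' d' t].
Proof.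
move=> hW hd; elim: k => [|k [W' [d' [uW' hd' e]]]]; first by exists W, d; rewrite mulr1n.
exists (W *t W'), (fun i => d (mxtens_unindex i).1 + d' (mxtens_unindex i).2); split=> [|j|t] /=.
- exact: tens_unitary.
- by rewrite mulrS; apply: le_trans (ler_normD _ _) _; exact: lerD.
- by rewrite e flow_tens.
Qed.

Definition tensor_rep m k (A : 'M[C]_m) := ntensmx_rec (A *t mconj A) k.
Lemma tensor_rep_unitary m k : unitary_rep (@tensor_rep m k).
Proof.
have tU (X : 'M[C]_m) : unitary X -> unitary (X *t mconj X).
  by move=> hX; apply: tens_unitary => //; exact: mconj_unitary.
split=> [U V [uU _] [uV _]|U [uU _]|U e [uU _] e0].
- by rewrite /tensor_rep mconjM -tens_mul ntens_mul.
- by rewrite /tensor_rep; apply: ntens_unitary; exact: tU.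
have [K K0 hK] := ntens_lip (m * m) k.
pose L := K * (2 * fnorm (1%:M : 'M[C]_m)) + 1.
have L0 : 0 < L by rewrite ltr_wpDl // !mulr_ge0 // fnorm_ge0.
exists (e / L); first by rewrite divr_gt0.
move=> V [uV _]; rewrite ltr_pdivlMr // => lt; apply: le_lt_trans lt.
apply: le_trans (hK _ _ (tU _ uV) (tU _ uU)) _.
have cn (A : 'M[C]_m) : fnorm (mconj A) = fnorm A.
  congr Num.sqrt; apply: eq_bigr => i _; apply: eq_bigr => j _; by rewrite mconjE cabs2_conj.
have h := fnorm_tens_diff V U (mconj V) (mconj U).
have cB : mconj V - mconj U = mconj (V - U).
  by apply/matrixP => i j; rewrite !mxE rmorphB.
rewrite cB !cn (unitary_fnorm uV) (unitary_fnorm uU) in h.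
apply: le_trans (ler_wpM2l K0 h) _.
rewrite /L [leRHS]mulrDr mulr1 -[leLHS]addr0; apply: lerD; last exact: fnorm_ge0.
by rewrite le_eqVlt; apply/orP; left; apply/eqP; ring.
Qed.

(** cos(2aL) = 1 - 2 sin^2(aL): a period 2L is converted into the condition under which averages
    over (-L, L) are computed. *)
Lemma sin_half_period (a L : R) : eic (a * (2 * L)) = 1 -> sin (a * L) = 0.
Proof.
rewrite (_ : a * (2 * L) = a * L + a * L); last by ring.
rewrite eicD => /(congr1 (@complex.Re R)) /=.
by have := cos2Dsin2 (a * L) => h1 h2; apply/eqP; rewrite -sqrf_eq0; apply/eqP; lra.
Qed.
Lemma flow_period k (W : 'M[C]_k) d L : unitary W -> flow W d (2 * L) = 1%:M ->
  forall j, sin (d j * L) = 0.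
Proof.
move=> hW; rewrite -(fc_one hW) => h j; apply: sin_half_period.
exact: (fc_inj hW h j).
Qed.

End TensorPower.

(** * Assembling the two bounds *)

Section Final.
Variable R : realType.
Local Notation C := R[i].
Variables (n : nat) (hn : (1 <= n)%N).

Lemma mconj_pauli_sqr (w : n.-tuple 'I_4) : mconj (pauli w) *m mconj (pauli w) = 1%:M :> 'M[C]_(2 ^ n).
Proof. by rewrite -mconjM pauli_sqr mconj1. Qed.

Lemma four_n_ge4 : 4 <= (4 ^ n)%:R :> R.
Proof. by rewrite ler_nat -{1}(expn1 4) leq_exp2l. Qed.

(** Common form of both bounds: the rotations have period 2L in theta, S bounds the weights, and [F]
    leaves the integrand in the form in which it is given. *)
Lemma gap_rep d (T : measurableType d) (Pr : probability T R) (U : T -> 'M[C]_(2 ^ n))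
  (k : nat) (rho : 'M[C]_(2 ^ n) -> 'M[C]_k) (F : n.-tuple 'I_4 -> R -> 'M[C]_k) (L S c : R) :
  haar_SU Pr U -> unitary_rep rho -> 0 < L -> 0 < S -> 0 <= c ->
  (forall w t, w \in nontriv_pauli R n -> F w t = rho (rot (pauli w) (t / 2))) ->
  (forall w, w \in nontriv_pauli R n -> exists W dd, [/\ unitary W,
     forall t, rho (rot (pauli w) (t / 2)) = flow W dd t,
     forall j, sin (dd j * L) = 0 & forall j, `|dd j| <= S]) ->
  1 - (1 + (4 ^ n)%:R / (4 * S)) / ((4 ^ n)%:R - 1) <= c ->
  opnorm (unif_expect (- L) L (fun t => avg_pauli (fun w => F w t)) -
          rv_expect Pr (fun x => rho (U x))) <= c.
Proof.
move=> HU hrep L0 S0 c0 hF hfl hc.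
have /boolp.choice[Wd hWd] (w : n.-tuple 'I_4) : exists Wd : 'M[C]_k * ('I_k -> R),
    w \in nontriv_pauli R n -> [/\ unitary Wd.1,
     forall t, rho (rot (pauli w) (t / 2)) = flow Wd.1 Wd.2 t,
     forall j, sin (Wd.2 j * L) = 0 & forall j, `|Wd.2 j| <= S].
  case hw : (w \in nontriv_pauli R n); last by exists (0, fun=> 0).
  by have [W [dd h]] := hfl w hw; exists (W, dd).
pose W w := (Wd w).1; pose dd w := (Wd w).2.
have h1 w : w \in nontriv_pauli R n -> unitary (W w) /\ forall t, rho (rot (pauli w) (t / 2)) = flow (W w) (dd w) t.
  by move=> /hWd [].
rewrite (_ : (fun t => avg_pauli _) = (fun t => (#|nontriv_pauli R n|%:R)^-1 *:
    \sum_(w in nontriv_pauli R n) flow (W w) (dd w) t)); last first.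
  apply/funext => t; rewrite /avg_pauli; congr (_ *: _); apply: eq_bigr => w hw.
  by rewrite hF //; have [_ ->] := h1 w hw.
rewrite unif_flows // => [|w j hw _]; last by have [_ _ ->] := hWd w hw.
apply: (gap_opnorm hrep h1 (haar_inv hrep HU) (haar_fix hrep HU) hn S0 _ c0 hc) => w j hw.
by have [_ _ _] := hWd w hw; apply.
Qed.
End Final.

Theorem theorem1p1 (R : realType) (n t : nat) (hn : (1 <= n)%N) (ht : (1 <= t)%N)
  (d : measure_display) (T : measurableType d) (Pr : probability T R)
  (U : T -> 'M[R[i]]_(2 ^ n)) (HU : haar_SU Pr U) :
  opnorm
    (unif_expect (- pi) pi (fun theta : R =>
        avg_pauli (fun w : n.-tuple 'I_4 =>
          (expm (Complex 0 (theta / 2) *: pauli w)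
             *t expm ((- Complex 0 (theta / 2)) *: mconj (pauli w))) ^t t))
     - rv_expect Pr (fun x => (U x *t mconj (U x)) ^t t))
  <= 1 - (4 * t%:R)^-1 - ((4 ^ n)%:R - 1)^-1
  /\
  forall (k : nat) (rho : 'M[R[i]]_(2 ^ n) -> 'M[R[i]]_k),
    unitary_rep rho ->
    opnorm
      (unif_expect (- (2 * pi)) (2 * pi) (fun theta : R =>
          avg_pauli (fun w : n.-tuple 'I_4 =>
            rho (expm (Complex 0 (theta / 2) *: pauli w))))
       - rv_expect Pr (fun x => rho (U x)))
    <= 1 - ((4 ^ n)%:R - 1)^-1.
Proof.
have N4 := four_n_ge4 R hn; have N1 : 0 < (4 ^ n)%:R - 1 :> R by lra.
have N3 : ((4 ^ n)%:R - 1)^-1 <= 3^-1 :> R by rewrite lef_pV2 ?posrE //; lra.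
have pi2 : 0 < 2 * pi :> R by rewrite mulr_gt0 // pi_gt0.
split=> [|k rho hrep].
  (* The power with exponent t.+1 is [ntensmx_rec] at t, hence [tensor_rep t] below. *)
  case: t ht => // t _.
  have t0 : 0 < t.+1%:R :> R by rewrite ltr0n.
  have t1 : (4 * t.+1%:R)^-1 <= 4^-1 :> R.
    by rewrite lef_pV2 ?posrE ?mulr_gt0 // ler_peMr // ler1n.
  apply: (gap_rep hn (rho := @tensor_rep R (2 ^ n) t) (S := t.+1%:R) HU) => //.
  - exact: tensor_rep_unitary.
  - exact: pi_gt0.
  (* The subtracted terms are at most 1/4 + 1/3. *)
  - rewrite -addrA -opprD subr_ge0; apply: le_trans (lerD t1 N3) _; lra.
  - move=> w th hw; rewrite expm_rot ?pauli_sqr //.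
    rewrite (_ : - Complex 0 (th / 2) = Complex 0 (- (th / 2))); last by apply: Cext; rewrite /= ?oppr0.
    by rewrite expm_rot ?mconj_pauli_sqr // rot_mconj.
  - move=> w hw; have [W [e [uW e2 _ he]]] := rot_flow (pauli_sqr R w) (pauli_adj R w).
    pose f j := e j / 2.
    have hf th : rot (pauli w) (th / 2) = flow W f th.
      by rewrite he; apply: eq_fc => j; congr eic; rewrite /f; ring.
    have nf j : `|f j| = 2^-1.
      rewrite /f normrM [X in _ * X]ger0_norm ?invr_ge0 //.
      by move/eqP: (e2 j); rewrite sqrf_eq1 => /orP[] /eqP ->; rewrite ?normrN normr1 mul1r.
    (* The weights of U are +-1/2 and conjugation negates them, so U (x) conj U has weights of
       modulus at most 1 and its power at most t.+1. *)
    pose g (i : 'I_(2 ^ n * 2 ^ n)) := f (mxtens_unindex i).1 - f (mxtens_unindex i).2.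
    have ng j : `|g j| <= 1.
      by apply: le_trans (ler_normB _ _) _; rewrite !nf; lra.
    have uWW : unitary (W *t mconj W) by apply: tens_unitary => //; exact: mconj_unitary.
    have [W' [d' [uW' hd' e']]] := flow_ntens t uWW ng.
    have hr th : tensor_rep t (rot (pauli w) (th / 2)) = flow W' d' th.
      by rewrite /tensor_rep hf flow_mconj flow_tens e'.
    exists W', d'; split=> //.
    (* At theta = 2 pi the rotation is -1, and the two signs cancel in U (x) conj U. *)
    apply: (flow_period uW'); rewrite -hr [2 * pi]mulrC mulfK // -[pi]add0r rot_pi rot0 ?pauli_sqr ?pauli_adj //.
    rewrite /tensor_rep (_ : - 1%:M *t _ = 1%:M) ?ntens_one //.
    rewrite -scaleN1r mconjZ mconj1 tens_scale tens_one (_ : _ * _ = 1) ?scale1r //.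
    by rewrite rmorphN1 mulrNN mulr1.
  (* With 4^n - 1 in place of 4^n in the inner numerator, the gap is exactly the sum of the two
     stated terms. *)
  - have e3 : 1 - (4 * t.+1%:R)^-1 - ((4 ^ n)%:R - 1)^-1 =
        1 - (1 + ((4 ^ n)%:R - 1) / (4 * t.+1%:R)) / ((4 ^ n)%:R - 1) :> R.
      by field; rewrite !gt_eqF.
    rewrite e3 lerD2l lerN2 ler_pM2r ?invr_gt0 // lerD2l ler_pM2r ?invr_gt0 ?mulr_gt0 //; lra.
have /boolp.choice[Wd hWd] (w : n.-tuple 'I_4) : exists Wd : 'M[R[i]]_k * ('I_k -> R),
    w \in nontriv_pauli R n -> unitary Wd.1 /\ forall t, rho (rot (pauli w) (t / 2)) = flow Wd.1 Wd.2 t.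
  case hw : (w \in nontriv_pauli R n); last by exists (0, fun=> 0).
  by have [W [dd h]] := rep_flow hrep (pauli_good hw); exists (W, dd).
(* Any finite bound on the weights serves here, since the nonnegative term 4^n / (4 S) is dropped at
   the end. *)
pose S : R := 1 + \sum_w \sum_j `|(Wd w).2 j|.
have Sw w j : `|(Wd w).2 j| <= S.
  apply: (@le_trans _ _ (\sum_i `|(Wd w).2 i|)); first by rewrite (bigD1 j) //= lerDl sumr_ge0.
  apply: (@le_trans _ _ (\sum_v \sum_i `|(Wd v).2 i|)); last by rewrite /S lerDr.
  by rewrite (bigD1 w) //= lerDl sumr_ge0 // => v _; apply: sumr_ge0.
have S0 : 0 < S by rewrite ltr_pwDl // sumr_ge0 // => ? _; apply: sumr_ge0.
apply: (gap_rep hn (S := S) HU hrep) => //.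
- by rewrite subr_ge0; apply: le_trans N3 _; lra.
- by move=> w th hw; rewrite expm_rot ?pauli_sqr.
- move=> w hw; have [uW hW] := hWd w hw; exists (Wd w).1, (Wd w).2; split=> //.
  (* At theta = 4 pi the sign -1 has been squared, so the rotation is the identity. *)
  apply: (flow_period uW); rewrite -hW [2 * (2 * pi)]mulrC mulfK //.
  rewrite mulr_natl mulr2n rot_pi -[pi]add0r rot_pi rot0 ?pauli_sqr ?pauli_adj // opprK.
  exact: rep1.
- rewrite lerD2l lerN2 -[leLHS]mul1r ler_pM2r ?invr_gt0 // lerDl.
  by rewrite divr_ge0 // mulr_ge0 // ltW.
Qed.
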